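(* Let $\Bbbk$ be a field of characteristic $p\neq2$ and let $d,m,n$ be nonnegative integers with $m,n\ge d$. Put $\mathcal{S}^{\mathrm I}=\mathcal{S}(m|n,d)$, $\mathcal{S}^{\mathrm{II}}=\mathcal{Q}(n,d)$, $G^{\mathrm I}=GL(m|n)$ and $G^{\mathrm{II}}=Q(n)$. Then for $\dagger=\mathrm{I},\mathrm{II}$ respectively there are equivalences of categories: (i) $\Psi:\ \mathfrak{pol}_d(G^\dagger)\to{}_{\mathcal{S}^\dagger}\mathsf{smod}$; (ii) $\Phi:\ \mathfrak{Pol}^{(\dagger)}_d\to\mathsf{Pol}^{(\dagger)}_d$.
   Context: **Superspaces and supermodules.** A superspace is a $\mathbb{Z}_2$-graded $\Bbbk$-vector space $M=M_0\oplus M_1$; $|v|$ is the degree of a homogeneous $v$. $\mathrm{Hom}_\Bbbk(M,N)$ is a superspace (even maps preserve, odd maps reverse degree); $M^\vee=\mathrm{Hom}_\Bbbk(M,\Bbbk)$ with $\Bbbk$ in degree $0$. $\mathsf{svec}_\Bbbk$ is the category of finite dimensional superspaces with all linear maps; $\Pi$ is parity change and $\Bbbk^{m|n}=\Bbbk^m\oplus(\Pi\Bbbk)^n$. Superalgebras are $\mathbb{Z}_2$-graded associative unital algebras, with product on $\mathcal{A}\otimes\mathcal{B}$ given by $(a\otimes b)(a'\otimes b')=(-1)^{|b||a'|}aa'\otimes bb'$. ${}_{\mathcal{B}}\mathsf{smod}$ (resp. $\mathsf{smod}_{\mathcal{B}}$) is the category of finite dimensional left (resp. right) $\mathcal{B}$-supermodules,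 with morphisms the (not necessarily homogeneous) linear maps with $\varphi(av)=(-1)^{|\varphi||a|}a\varphi(v)$ (resp. $\varphi(va)=\varphi(v)a$). $S^*M=\bigoplus_dS^dM$ is the symmetric superalgebra, the quotient of the tensor algebra by the superideal generated by $x\otimes y-(-1)^{|x||y|}y\otimes x$. $\mathcal{C}(1)$ is the superalgebra generated by an odd $c$ with $c^2=1$; $\mathcal{U}_l(1)$ (resp. $\mathcal{U}(1)$) is $\mathcal{C}(1)$ as left (resp. right) supermodule over itself. **The categories $\mathsf{Pol}^{(\dagger)}_d$ and Schur superalgebras.** $\mathfrak{S}_d$ acts on the right of $M^{\otimes d}$ by $(v_1\otimes\cdots\otimes v_d).(i\ i{+}1)=(-1)^{|v_i||v_{i+1}|}v_1\otimes\cdots\otimes v_{i+1}\otimes v_i\otimes\cdots\otimes v_d$; $\Gamma^dM=(M^{\otimes d})^{\mathfrak{S}_d}$. $\mathcal{B}\wr\mathfrak{S}_d=\Bbbk\mathfrak{S}_d\otimes\mathcal{B}^{\otimes d}$ with product $(\sigma\otimes a)(\sigma'\otimes b)=\sigma\sigma'\otimes(a.\sigma')b$; $\mathcal{W}(d)=\mathcal{C}(1)\wr\mathfrak{S}_d$. For $V\in\mathsf{smod}_\mathcal{B}$, $V^{\otimes d}$ is a right $\mathcal{B}\wr\mathfrak{S}_d$-supermodule via the $\mathfrak{S}_d$-action and $(v\otimes w).(a\otimes b)=(-1)^{|w||a|}v.a\otimes w.b$. For $\mathcal{B}=\Bbbk,\mathcal{C}(1)$, the category $\Gamma^d\mathsf{smod}_\mathcal{B}$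 has the objects of $\mathsf{smod}_{\mathcal{B}}$ and $\mathrm{hom}(V,W)=\Gamma^d\mathrm{Hom}_\mathcal{B}(V,W)$, identified with $\mathrm{Hom}_{\mathcal{B}\wr\mathfrak{S}_d}(V^{\otimes d},W^{\otimes d})$ via $f_1\otimes\cdots\otimes f_d\mapsto f_1\boxtimes\cdots\boxtimes f_d$, $(f\boxtimes f')(v\otimes w)=(-1)^{|f'||v|}f(v)\otimes f'(w)$, with composition of $\mathcal{B}\wr\mathfrak{S}_d$-homomorphisms. $\mathsf{Pol}^{\mathrm{(I)}}_d$ and $\mathsf{Pol}^{\mathrm{(II)}}_d$ are the categories of even $\Bbbk$-linear functors (inducing even linear maps on hom-superspaces) from $\Gamma^d\mathsf{svec}_\Bbbk$, respectively $\Gamma^d\mathsf{smod}_{\mathcal{C}(1)}$, to $\mathsf{svec}_\Bbbk$; morphisms are natural transformations between functors, the set of all of which between two objects is naturally a superspace. $\mathcal{S}(m|n,d)=\mathrm{End}_{\Bbbk\mathfrak{S}_d}((\Bbbk^{m|n})^{\otimes d})$ and $\mathcal{Q}(n,d)=\mathrm{End}_{\mathcal{W}(d)}((\mathcal{U}(1)^{\oplus n})^{\otimes d})$. **Superschemes.** $\mathfrak{salg}_\Bbbk$ is the category of commutative superalgebras ($ab=(-1)^{|a||b|}ba$) and even homomorphisms. $\mathfrak{ssch}_\Bbbk$, the category of superschemes, is a full subcategory of the functors $\mathfrak{salg}_\Bbbk\to\mathfrak{sets}$; affine superschemes are representable functors $X=\mathrm{hom}_{\mathfrak{salg}_\Bbbk}(\Bbbk[X],-)$.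 For $M\in\mathsf{svec}_\Bbbk$, $M_a(\mathcal{A})=(M\otimes\mathcal{A})_0$ is affine with $\Bbbk[M_a]=S^*(M^\vee)$, and by Yoneda morphisms of superschemes $M_a\to N_a$ correspond to elements of $(N\otimes S^*(M^\vee))_0$. **The categories $\mathfrak{Pol}^{(\dagger)}_d$.** Let $\mathcal{B}$ be a superalgebra. ${}_\mathcal{B}\mathfrak{smod}$ is the $\mathfrak{ssch}_\Bbbk$-enriched category with the objects of ${}_\mathcal{B}\mathsf{smod}$ and hom-objects $\mathrm{Hom}_\mathcal{B}(V,W)_a$, composition and units being induced by composition of the $\mathcal{B}\otimes\mathcal{A}$-linear even maps $V\otimes\mathcal{A}\to W\otimes\mathcal{A}$ (via $\mathrm{Hom}_\mathcal{B}(V,W)\otimes\mathcal{A}\simeq\mathrm{Hom}_{\mathcal{B}\otimes\mathcal{A}}(V\otimes\mathcal{A},W\otimes\mathcal{A})$) and by identity maps; $\mathfrak{svec}_\Bbbk={}_\Bbbk\mathfrak{smod}$. An $\mathfrak{ssch}_\Bbbk$-functor $T:{}_\mathcal{B}\mathfrak{smod}\to\mathfrak{svec}_\Bbbk$ assigns $T(V)\in\mathsf{svec}_\Bbbk$ to each $V$, together with superscheme morphisms $T_{V,W}:\mathrm{Hom}_\mathcal{B}(V,W)_a\to\mathrm{Hom}_\Bbbk(T(V),T(W))_a$ compatible with composition and identities. An $\mathfrak{ssch}_\Bbbk$-natural transformation $\alpha:S\to T$ is a collection of even linear maps $\alpha_V:S(V)\to T(V)$ with $(\alpha_W\circ-)\circ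 S_{V,W}=(-\circ\alpha_V)\circ T_{V,W}$ as superscheme morphisms $\mathrm{Hom}_\mathcal{B}(V,W)_a\to\mathrm{Hom}_\Bbbk(S(V),T(W))_a$. $T$ is homogeneous of degree $d$ if $T_{V,W}\in(\mathrm{Hom}_\Bbbk(T(V),T(W))\otimes S^d(\mathrm{Hom}_\mathcal{B}(V,W)^\vee))_0$ for all $V,W$. $\mathfrak{Pol}^{\mathrm{(I)}}_d$ and $\mathfrak{Pol}^{\mathrm{(II)}}_d$ are the categories of degree $d$ homogeneous $\mathfrak{ssch}_\Bbbk$-functors to $\mathfrak{svec}_\Bbbk$ from $\mathfrak{svec}_\Bbbk$ and ${}_{\mathcal{C}(1)}\mathfrak{smod}$ respectively, with $\mathfrak{ssch}_\Bbbk$-natural transformations. **Supergroups.** For $V\in{}_\mathcal{B}\mathsf{smod}$, $End_{\mathcal{B},V}=\mathrm{End}_\mathcal{B}(V)_a$ is the functor sending $\mathcal{A}$ to the even $\mathcal{B}\otimes\mathcal{A}$-linear endomorphisms of $V\otimes\mathcal{A}$, with $\Bbbk[End_{\mathcal{B},V}]=S^*(\mathrm{End}_\mathcal{B}(V)^\vee)$; $GL_{\mathcal{B},V}$ is the subfunctor of automorphisms, an algebraic supergroup whose Hopf superalgebra $\Bbbk[GL_{\mathcal{B},V}]$ contains $\Bbbk[End_{\mathcal{B},V}]$ as a subcoalgebra. $GL(m|n)=GL_{\Bbbk,\Bbbk^{m|n}}$ and $Q(n)=GL_{\mathcal{C}(1),\mathcal{U}_l(1)^{\oplus n}}$. For $G=GL_{\mathcal{B},V}$,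 a representation $G\to GL_{\Bbbk,M}$ with $M\in\mathsf{svec}_\Bbbk$ is the same as a right $\Bbbk[G]$-cosupermodule structure on $M$, with even structure map $\Delta_M:M\to M\otimes\Bbbk[G]$. $\mathfrak{pol}_d(G)$ is the category of those $M$ with $\Delta_M(M)\subseteq M\otimes S^d(\mathrm{End}_\mathcal{B}(V)^\vee)$, i.e. the category of right $S^d(\mathrm{End}_\mathcal{B}(V)^\vee)$-cosupermodules, with morphisms all cosupermodule homomorphisms (which are just ordinary comodule homomorphisms).
   Formalization: In (ii), Pol_d is taken with even natural transformations only (false otherwise, e.g. d=0); in (i) type II, the equivalence is for even morphisms over every k, and for all morphisms only if k contains a square root of -1 (false otherwise, e.g. k=R, d=n=1). *)

(* Defs.v *)
From HB Require Import structures.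
From mathcomp Require Import all_boot all_order all_fingroup all_algebra.
From mathcomp Require Import boolp.

Set Implicit Arguments.
Unset Strict Implicit.
Unset Printing Implicit Defensive.

Import GRing.Theory.
Local Open Scope ring_scope.

Lemma sval_eq (T : Type) (P : T -> Prop) (a b : {x | P x}) : sval a = sval b -> a = b.
Proof. by case: a b => [x p] [y q] /= xy; apply: eq_exist. Qed.

Record category := Category {
  obj :> Type;
  hom : obj -> obj -> Type;
  idm : forall X, hom X X;
  cmp : forall X Y Z, hom Y Z -> hom X Y -> hom X Z;
  cmp1m : forall X Y (f : hom X Y), cmp (idm Y) f = f;
  cmpm1 : forall X Y (f : hom X Y), cmp f (idm X) = f;
  cmpA : forall X Y Z T (f : hom Z T) (g : hom Y Z) (h : hom X Y),
    cmp f (cmp g h) = cmp (cmp f g) h }.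
Arguments idm {_} X.
Arguments cmp {_ X Y Z} _ _.

Record functor (C D : category) := Functor {
  fob :> C -> D;
  fmor : forall X Y : C, hom X Y -> hom (fob X) (fob Y);
  fmor1 : forall X : C, fmor (idm X) = idm (fob X);
  fmorM : forall (X Y Z : C) (f : hom Y Z) (g : hom X Y),
    fmor (cmp f g) = cmp (fmor f) (fmor g) }.
Arguments fmor {C D} _ {X Y} _.

Record nattrans (C D : category) (F G : functor C D) := NatTrans {
  nt :> forall X : C, hom (F X) (G X);
  nt_nat : forall (X Y : C) (f : hom X Y),
    cmp (nt Y) (fmor F f) = cmp (fmor G f) (nt X) }.

Definition is_iso (C : category) (X Y : C) (f : hom X Y) : Prop :=
  exists g : hom Y X, cmp g f = idm X /\ cmp f g = idm Y.

Definition natiso (C D : category) (F G : functor C D) : Prop :=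
  exists a : nattrans F G, forall X, is_iso (a X).

Program Definition functor_id (C : category) : functor C C :=
  @Functor C C (fun X => X) (fun X Y f => f) _ _.

Program Definition functor_comp (C D E : category)
    (F : functor D E) (G : functor C D) : functor C E :=
  @Functor C E (fun X => F (G X)) (fun X Y f => fmor F (fmor G f)) _ _.
Next Obligation. by rewrite !fmor1. Qed.
Next Obligation. by rewrite !fmorM. Qed.

Definition equivalent (C D : category) : Prop :=
  exists (F : functor C D) (G : functor D C),
    natiso (functor_comp G F) (functor_id C) /\
    natiso (functor_comp F G) (functor_id D).

Program Definition wide_subcategory (C : category)
    (P : forall X Y : C, hom X Y -> Prop)
    (P1 : forall X : C, P X X (idm X))
    (PM : forall (X Y Z : C) (f : hom Y Z) (g : hom X Y),
       P Y Z f -> P X Y g -> P X Z (cmp f g)) : category :=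
  @Category C (fun X Y => {f : hom X Y | P X Y f})
    (fun X => exist _ (idm X) (P1 X))
    (fun X Y Z f g =>
       exist _ (cmp (sval f) (sval g)) (PM X Y Z _ _ (svalP f) (svalP g)))
    _ _ _.
Next Obligation. by apply: eq_exist; rewrite /= cmp1m. Qed.
Next Obligation. by apply: eq_exist; rewrite /= cmpm1. Qed.
Next Obligation. by apply: eq_exist; rewrite /= cmpA. Qed.

Definition full_subcategory (C : category) (P : C -> Prop) : category.
Proof.
refine (@Category {X : C | P X} (fun X Y => @hom C (sval X) (sval Y))
  (fun X => idm (sval X)) (fun X Y Z f g => cmp f g) _ _ _).
- by move=> *; apply: cmp1m.
- by move=> *; apply: cmpm1.
- by move=> *; apply: cmpA.
Defined.

Program Definition typeCat : category :=
  @Category Type (fun X Y => X -> Y) (fun X x => x)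
    (fun X Y Z f g x => f (g x)) _ _ _.

Record superspace (k : fieldType) := SuperSpace {
  ss_car :> vectType k;
  gr : bool -> {vspace ss_car};
  gr_sum : (gr false + gr true)%VS = fullv;
  gr_cap : (gr false :&: gr true)%VS = 0%VS }.

Section Superspaces.
Variable k : fieldType.
Implicit Types U V W : superspace k.

Lemma idem_sum (V : vectType k) (P : 'End(V)) :
  (P \o P)%VF = P -> (limg P + lker P)%VS = fullv.
Proof.
move=> PP; apply/eqP; rewrite eqEsubv subvf /=; apply/subvP => v _.
rewrite -[v](subrK (P v)) addrC memv_add ?memv_img ?memvf //.
by rewrite memv_ker linearB /= -comp_lfunE PP subrr.
Qed.

Lemma idem_cap (V : vectType k) (P : 'End(V)) :
  (P \o P)%VF = P -> (limg P :&: lker P)%VS = 0%VS.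
Proof.
move=> PP; apply/eqP; rewrite -subv0; apply/subvP => v.
rewrite memv_cap memv0 => /andP[/memv_imgP[u _ ->]].
by rewrite memv_ker -comp_lfunE PP.
Qed.

(* An idempotent P grades V: the even part is the image of P, the odd part its
   kernel. *)
Definition superspace_of_idem (V : vectType k) (P : 'End(V))
    (PP : (P \o P)%VF = P) : superspace k :=
  @SuperSpace k V (fun e => if e then lker P else limg P)
    (idem_sum PP) (idem_cap PP).

Definition proj V (e : bool) : 'End(V) := daddv_pi (gr V e) (gr V (~~ e)).

Lemma gr_capN V e : (gr V e :&: gr V (~~ e))%VS = 0%VS.
Proof. by case: e; rewrite /= ?gr_cap // capvC gr_cap. Qed.

Lemma gr_sumN V e : (gr V e + gr V (~~ e))%VS = fullv.
Proof. by case: e; rewrite /= ?gr_sum // addvC gr_sum. Qed.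

Lemma proj_mem V e v : proj V e v \in gr V e.
Proof. exact: memv_pi. Qed.

Lemma proj_id V e v : v \in gr V e -> proj V e v = v.
Proof. exact/daddv_pi_id/gr_capN. Qed.

Lemma proj_add V e v : proj V e v + proj V (~~ e) v = v.
Proof.
by rewrite /proj negbK daddv_pi_add ?gr_capN // gr_sumN memvf.
Qed.

Lemma proj_neg V e v : v \in gr V (~~ e) -> proj V e v = 0.
Proof.
by move=> hv; apply: (addIr (proj V (~~ e) v)); rewrite proj_add add0r proj_id.
Qed.

Lemma proj_proj V e c v : proj V e (proj V c v) = if e == c then proj V c v else 0.
Proof.
case: eqP => [->|/eqP ec]; first by rewrite proj_id ?proj_mem.
by apply: proj_neg; have -> : ~~ e = c by [case: e c ec => [] []]; apply: proj_mem.
Qed.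

(* The homogeneous component of degree e of a linear map. *)
Definition hpart V W (e : bool) (f : 'Hom(V, W)) : 'Hom(V, W) :=
  ((proj W e \o f \o proj V false) + (proj W (~~ e) \o f \o proj V true))%VF.

Lemma hpart_is_linear V W e : linear (@hpart V W e).
Proof.
move=> c f g; apply/lfunP => v.
by rewrite !(add_lfunE, scale_lfunE, comp_lfunE) !linearP /= scalerDr addrACA.
Qed.
HB.instance Definition _ V W e :=
  GRing.isLinear.Build k 'Hom(V, W) 'Hom(V, W) _ (@hpart V W e)
    (@hpart_is_linear V W e).

(* The homogeneous linear maps of degree e. *)
Definition hgr V W (e : bool) : {vspace 'Hom(V, W)} :=
  lker (linfun (@hpart V W (~~ e))).

Lemma hpartE V W e (f : 'Hom(V, W)) c v :
  v \in gr V c -> hpart e f v = proj W (c (+) e) (f v).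
Proof.
rewrite /hpart add_lfunE !comp_lfunE; case: c => hv /=.
  by rewrite (@proj_neg V false v hv) (proj_id hv) !linear0 add0r.
by rewrite (@proj_neg V true v hv) (proj_id hv) !linear0 addr0.
Qed.

Lemma eq_on_gr V (W : vectType k) (f g : 'Hom(V, W)) :
  (forall c v, v \in gr V c -> f v = g v) -> f = g.
Proof.
move=> fg; apply/lfunP => v; rewrite -(proj_add false v) !linearD /=.
by congr (_ + _); apply: fg; apply: proj_mem.
Qed.

Lemma hpart_add V W e (f : 'Hom(V, W)) : hpart e f + hpart (~~ e) f = f.
Proof.
apply: eq_on_gr => c v hv; rewrite add_lfunE !(hpartE _ _ hv).
by rewrite -[RHS](proj_add (c (+) e)) addbN.
Qed.

Lemma hgrP V W e (f : 'Hom(V, W)) :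
  reflect (forall c v, v \in gr V c -> f v \in gr W (c (+) e)) (f \in hgr V W e).
Proof.
rewrite memv_ker lfunE /=; apply: (iffP eqP) => [f0 c v hv | hf].
  by rewrite -(hpart_add e f) f0 addr0 (hpartE _ _ hv) proj_mem.
apply: eq_on_gr => c v hv; rewrite (hpartE _ _ hv) zero_lfunE proj_neg //.
by rewrite addbN negbK hf.
Qed.

Lemma hpart_hgr V W e (f : 'Hom(V, W)) : hpart e f \in hgr V W e.
Proof. by apply/hgrP => c v hv; rewrite (hpartE _ _ hv) proj_mem. Qed.

Lemma hpart_id V W e (f : 'Hom(V, W)) : f \in hgr V W e -> hpart e f = f.
Proof.
move=> /hgrP hf; apply: eq_on_gr => c v hv.
by rewrite (hpartE _ _ hv) proj_id // hf.
Qed.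

Lemma hpart_neg V W e (f : 'Hom(V, W)) : f \in hgr V W (~~ e) -> hpart e f = 0.
Proof. by rewrite memv_ker lfunE /= negbK => /eqP. Qed.

Lemma hgr_comp U V W e c (f : 'Hom(V, W)) (g : 'Hom(U, V)) :
  f \in hgr V W e -> g \in hgr U V c -> (f \o g)%VF \in hgr U W (c (+) e).
Proof.
move=> /hgrP hf /hgrP hg; apply/hgrP => a v hv.
by rewrite comp_lfunE addbA; apply/hf/hg.
Qed.

Lemma hgr1 V : \1%VF \in hgr V V false.
Proof. by apply/hgrP => c v hv; rewrite id_lfunE addbF. Qed.

Lemma hpart_comp U V W e (f : 'Hom(V, W)) (g : 'Hom(U, V)) :
  hpart e (f \o g)%VF =
  ((hpart e f \o hpart false g) + (hpart (~~ e) f \o hpart true g))%VF.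
Proof.
apply: eq_on_gr => c v hv; rewrite add_lfunE !comp_lfunE !(hpartE _ _ hv).
rewrite comp_lfunE (hpartE _ _ (proj_mem (c (+) false) _)).
rewrite (hpartE _ _ (proj_mem (c (+) true) _)).
rewrite -[g v in LHS](proj_add c) !linearD /=.
by rewrite addbF addbT; case: c {hv}; case: e.
Qed.

(* Homogeneous coordinates: the basis of the even part, then that of the odd
   part. *)

Definition sdim V : nat := \dim (gr V false) + \dim (gr V true).

Definition spar V (i : 'I_(sdim V)) : bool :=
  if split i is inr _ then true else false.

Definition sbasis V (i : 'I_(sdim V)) : V :=
  match split i with
  | inl a => (vbasis (gr V false))`_a
  | inr b => (vbasis (gr V true))`_b
  end.

Definition scoord V (i : 'I_(sdim V)) (v : V) : k :=
  match split i with
  | inl a => coord (vbasis (gr V false)) a (proj V false v)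
  | inr b => coord (vbasis (gr V true)) b (proj V true v)
  end.

Lemma sbasis_gr V i : sbasis i \in gr V (spar i).
Proof.
by rewrite /sbasis /spar; case: split => a; apply: vbasis_mem;
  rewrite mem_nth // size_tuple.
Qed.

Lemma scoordK V v : v = \sum_i scoord i v *: sbasis i :> V.
Proof.
rewrite big_split_ord /= -[LHS](proj_add false); congr (_ + _).
  rewrite [LHS](coord_vbasis (proj_mem false v)); apply: eq_bigr => i _.
  by rewrite /scoord /sbasis -/(unsplit (inl i)) unsplitK.
rewrite [LHS](coord_vbasis (proj_mem true v)); apply: eq_bigr => i _.
by rewrite /scoord /sbasis -/(unsplit (inr i)) unsplitK.
Qed.

Lemma scoord_sbasis V (i j : 'I_(sdim V)) : scoord i (sbasis j) = (i == j)%:R.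
Proof.
have fr e : free (vbasis (gr V e)) := basis_free (vbasisP _).
rewrite -{2}(splitK i) -{2}(splitK j) /scoord /sbasis.
have H (e : bool) (a : 'I_(\dim (gr V e))) : (vbasis (gr V e))`_a \in gr V e.
  by apply: vbasis_mem; rewrite mem_nth // size_tuple.
have uI := can_inj (@unsplitK (\dim (gr V false)) (\dim (gr V true))).
case: (split i) (split j) => a [] b.
- by rewrite (proj_id (H _ b)) coord_free ?fr // (inj_eq uI) eq_sym.
- by rewrite (@proj_neg _ false _ (H true b)) linear0 (inj_eq uI).
- by rewrite (@proj_neg _ true _ (H false b)) linear0 (inj_eq uI).
- by rewrite (proj_id (H _ b)) coord_free ?fr // (inj_eq uI) eq_sym.
Qed.

Lemma scoord_is_linear V i : linear (@scoord V i : V -> k^o).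
Proof. by move=> c u v; rewrite /scoord; case: split => a; rewrite !linearP. Qed.
HB.instance Definition _ V i :=
  GRing.isLinear.Build k V k^o _ (@scoord V i) (@scoord_is_linear V i).

Lemma scoord_gr V i e (v : V) : v \in gr V e -> e != spar i -> scoord i v = 0.
Proof.
rewrite /scoord /spar => hv; case: split => a ei.
  by rewrite proj_neg ?linear0 //; case: e hv ei.
by rewrite proj_neg ?linear0 //; case: e hv ei.
Qed.

Definition lmx V W (f : 'Hom(V, W)) : 'M[k]_(sdim W, sdim V) :=
  \matrix_(i, j) scoord i (f (sbasis j)).

Lemma lmx1 V : lmx (\1%VF : 'End(V)) = 1%:M.
Proof. by apply/matrixP => i j; rewrite !mxE id_lfunE scoord_sbasis. Qed.

Lemma lmxM U V W (f : 'Hom(V, W)) (g : 'Hom(U, V)) :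
  lmx (f \o g)%VF = lmx f *m lmx g.
Proof.
apply/matrixP => i j; rewrite !mxE comp_lfunE {1}(scoordK (g (sbasis j))).
rewrite linear_sum /= (linear_sum (@scoord W i)) /=; apply: eq_bigr => l _.
by rewrite !mxE linearZ /= linearZ /= mulrC.
Qed.

End Superspaces.

Record superalg (k : fieldType) := SuperAlg {
  sa_ss :> superspace k;
  sa_mul : sa_ss -> sa_ss -> sa_ss;
  sa_one : sa_ss;
  sa_mul_linl : forall b, linear (sa_mul^~ b);
  sa_mul_linr : forall a, linear (sa_mul a);
  sa_mulA : associative sa_mul;
  sa_mul1l : left_id sa_one sa_mul;
  sa_mul1r : right_id sa_one sa_mul;
  sa_gr1 : sa_one \in gr sa_ss false;
  sa_grM : forall e c a b, a \in gr sa_ss e -> b \in gr sa_ss c ->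
    sa_mul a b \in gr sa_ss (e (+) c) }.

Section Supermodules.
Variables (k : fieldType) (B : superalg k).

Record lsmod := LSMod {
  ls_ss :> superspace k;
  lact : B -> 'End(ls_ss);
  lact_lin : linear lact;
  lact1 : lact (sa_one B) = \1%VF;
  lactM : forall a b, lact (sa_mul a b) = (lact a \o lact b)%VF;
  lact_gr : forall e b, b \in gr B e -> lact b \in hgr ls_ss ls_ss e }.

Record rsmod := RSMod {
  rs_ss :> superspace k;
  ract : B -> 'End(rs_ss);
  ract_lin : linear ract;
  ract1 : ract (sa_one B) = \1%VF;
  ractM : forall a b, ract (sa_mul a b) = (ract b \o ract a)%VF;
  ract_gr : forall e b, b \in gr B e -> ract b \in hgr rs_ss rs_ss e }.

(* phi (b v) = (-1)^(|phi||b|) b (phi v), imposed on the homogeneous components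
   of phi. *)
Definition smod_hom (V W : lsmod) (phi : 'Hom(V, W)) : Prop :=
  forall e c b, b \in gr B c ->
    (hpart e phi \o lact V b)%VF
    = (-1) ^+ (e && c) *: (lact W b \o hpart e phi)%VF.

Lemma smod_hom1 (V : lsmod) : smod_hom (\1%VF : 'Hom(V, V)).
Proof.
move=> [] c b hb; last first.
  by rewrite (hpart_id (hgr1 V)) comp_lfun1l comp_lfun1r scale1r.
by rewrite (@hpart_neg _ _ _ true _ (hgr1 V)) comp_lfun0l comp_lfun0r scaler0.
Qed.

Lemma smod_homM (U V W : lsmod) (f : 'Hom(V, W)) (g : 'Hom(U, V)) :
  smod_hom f -> smod_hom g -> smod_hom (f \o g)%VF.
Proof.
move=> hf hg e c b hb; rewrite hpart_comp comp_lfunDl comp_lfunDr scalerDr.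
rewrite -!comp_lfunA !(hg _ _ _ hb) -!comp_lfunZr !comp_lfunA !(hf _ _ _ hb).
rewrite -!comp_lfunZl !scalerA -!signr_addb.
by congr (_ *: _ + _ *: _); case: e; case: c {hb}.
Qed.

Program Definition smod : category :=
  @Category lsmod (fun V W => {f : 'Hom(V, W) | smod_hom f})
    (fun V => exist _ \1%VF (smod_hom1 V))
    (fun U V W f g => exist _ (sval f \o sval g)%VF
       (smod_homM (svalP f) (svalP g))) _ _ _.
Next Obligation. by apply: eq_exist; rewrite /= comp_lfun1l. Qed.
Next Obligation. by apply: eq_exist; rewrite /= comp_lfun1r. Qed.
Next Obligation. by apply: eq_exist; rewrite /= comp_lfunA. Qed.

Definition smod_even : category :=
  @wide_subcategory smod (fun V W f => sval f \in hgr V W false)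
    (fun V => hgr1 V) (fun U V W f g hf hg => hgr_comp hf hg).

End Supermodules.

Section Examples.
Variable k : fieldType.

Definition fst_part (V W : vectType k) (v : (V * W)%type) : (V * W)%type :=
  (v.1, 0).

Lemma fst_part_is_linear V W : linear (@fst_part V W).
Proof.
by move=> c u v; congr pair; rewrite /= scaler0 addr0.
Qed.
HB.instance Definition _ (V W : vectType k) :=
  GRing.isLinear.Build k (V * W)%type (V * W)%type _ (@fst_part V W)
    (@fst_part_is_linear V W).

Lemma fst_part_idem V W :
  (linfun (@fst_part V W) \o linfun (@fst_part V W) = linfun (@fst_part V W))%VF.
Proof. by apply/lfunP => v; rewrite comp_lfunE !lfunE. Qed.

(* V in degree 0 plus W in degree 1. *)
Definition pair_ss (V W : vectType k) : superspace k :=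
  superspace_of_idem (fst_part_idem V W).

Lemma pair_ssP V W e (v : pair_ss V W) :
  reflect (if e then v.1 = 0 else v.2 = 0) (v \in gr (pair_ss V W) e).
Proof.
case: e => /=.
  rewrite memv_ker lfunE /= /fst_part.
  by apply: (iffP eqP) => [[->]|->].
apply: (iffP memv_imgP) => [[u _ ->]|v2]; first by rewrite lfunE.
by exists v; rewrite ?memvf // lfunE /= /fst_part -v2; case: (v).
Qed.

Definition kmn (m n : nat) : superspace k := pair_ss 'rV[k]_m 'rV[k]_n.

Lemma kalg_idem : (\1 \o \1 = \1 :> 'End(k^o))%VF.
Proof. exact: comp_lfun1l. Qed.

Definition kss : superspace k := superspace_of_idem kalg_idem.

Lemma kssP e (v : kss) : v \in gr kss e = ~~ e || (v == 0).
Proof.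
case: e => /=; first by rewrite memv_ker id_lfunE.
by apply/memv_imgP; exists v; rewrite ?memvf // id_lfunE.
Qed.

Lemma kssI (e : bool) (v : kss) : reflect (e -> v = 0) (v \in gr kss e).
Proof.
rewrite kssP; case: e => /=; last by apply: ReflectT.
by apply: (iffP eqP) => [->|->].
Qed.

Lemma kss_gr1 : (1 : k) \in gr kss false.
Proof. exact/(@kssI false). Qed.

Lemma kss_grM e c (a b : kss) : a \in gr kss e -> b \in gr kss c ->
  ((a : k) * b : k) \in gr kss (e (+) c).
Proof.
move=> /kssI ha /kssI hb; apply/(@kssI (e (+) c) ((a : k) * b)).
case: e ha => [/(_ isT) ->|_]; first by rewrite mul0r.
by case: c hb => [/(_ isT) ->|_] //; rewrite mulr0.
Qed.

Program Definition kalg : superalg k :=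
  @SuperAlg k kss (fun a b => (a : k) * b) (1 : k) _ _ _ _ _ _ _.
Next Obligation.
by move=> c u v; rewrite /GRing.scale /= mulrDl mulrA.
Qed.
Next Obligation.
by move=> c u v; rewrite /GRing.scale /= mulrDr mulrCA.
Qed.
Next Obligation. exact: mulrA. Qed.
Next Obligation. exact: mul1r. Qed.
Next Obligation. exact: mulr1. Qed.
Next Obligation. exact: kss_gr1. Qed.
Next Obligation. exact: kss_grM. Qed.

(* C(1), with (a, b) standing for a + b c. *)
Program Definition C1 : superalg k :=
  @SuperAlg k (pair_ss k^o k^o)
    (fun x y => ((x.1 : k) * y.1 + (x.2 : k) * y.2,
                 (x.1 : k) * y.2 + (x.2 : k) * y.1))
    (1 : k, 0 : k) _ _ _ _ _ _ _.
Next Obligation.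
by move=> c [u1 u2] [v1 v2]; congr pair; rewrite /= /GRing.scale /= !mulrDl mulrDr !mulrA addrACA.
Qed.
Next Obligation.
by move=> c [u1 u2] [v1 v2]; congr pair; rewrite /= /GRing.scale /= !mulrDr !(mulrCA c) addrACA.
Qed.
Next Obligation.
have E (x y z w : k) : (x + y) + (z + w) = (x + w) + (y + z).
  by rewrite -!addrA; congr (_ + _); rewrite addrA addrC.
by move=> [a b] [a' b'] [a'' b'']; congr pair; rewrite /= !mulrDr !mulrDl !mulrA E.
Qed.
Next Obligation. by move=> [a b]; rewrite /= !mul1r !mul0r !addr0. Qed.
Next Obligation. by move=> [a b]; rewrite /= !mulr1 !mulr0 addr0 add0r. Qed.
Next Obligation. exact/(@pair_ssP k^o k^o false). Qed.
Next Obligation.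
move/(@pair_ssP k^o k^o e): H => h1; move/(@pair_ssP k^o k^o c): H0 => h2.
apply/(@pair_ssP k^o k^o (e (+) c)).
by case: e h1 => /= ->; case: c h2 => /= ->; rewrite ?mulr0 ?mul0r ?addr0.
Qed.

Section Trivial.
Variable M : superspace k.

Definition kact (a : kalg) : 'End(M) := (a : k) *: \1%VF.

Lemma kact_lin : linear kact.
Proof. by move=> c u v; rewrite /kact scalerDl -scalerA. Qed.

Lemma kact1 : kact (sa_one kalg) = \1%VF.
Proof. exact: scale1r. Qed.

Lemma kactM a b : kact (sa_mul a b) = (kact a \o kact b)%VF.
Proof.
by rewrite /kact -comp_lfunZl -comp_lfunZr comp_lfun1l scalerA.
Qed.

Lemma kact_gr e b : b \in gr kalg e -> kact b \in hgr M M e.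
Proof.
rewrite kssP; case: e => /= [/eqP ->|_]; first by rewrite /kact scale0r mem0v.
by rewrite memvZ // hgr1.
Qed.

(* A superspace as a left, resp. right, k-supermodule. *)
Definition klmod : lsmod kalg := LSMod kact_lin kact1 kactM kact_gr.

Lemma kactMr a b : kact (sa_mul a b) = (kact b \o kact a)%VF.
Proof. by rewrite -kactM /= mulrC. Qed.

Definition krmod : rsmod kalg := RSMod kact_lin kact1 kactMr kact_gr.
End Trivial.

Section Regular.
Variables (B : superalg k) (n : nat).
Let T := {ffun 'I_n -> B}.

Definition ffun_even (f : T) : T := [ffun i => proj B false (f i)].

Lemma ffun_even_is_linear : linear ffun_even.
Proof. by move=> c u v; apply/ffunP => i; rewrite !ffunE linearP. Qed.
HB.instance Definition _ :=
  GRing.isLinear.Build k T T _ ffun_even ffun_even_is_linear.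

Lemma ffun_even_idem : (linfun ffun_even \o linfun ffun_even = linfun ffun_even)%VF.
Proof.
apply/lfunP => f; rewrite comp_lfunE !lfunE /=; apply/ffunP => i.
by rewrite !ffunE proj_proj.
Qed.

Definition ffun_ss : superspace k := superspace_of_idem ffun_even_idem.

Lemma ffun_ssP e (f : ffun_ss) :
  reflect (forall i, f i \in gr B e) (f \in gr ffun_ss e).
Proof.
case: e => /=.
  rewrite memv_ker lfunE /=; apply: (iffP eqP) => [f0 i | hf].
    have := congr1 (fun g : T => g i) f0; rewrite !ffunE => p0.
    by rewrite -[f i](proj_add false) p0 add0r proj_mem.
  by apply/ffunP => i; rewrite !ffunE (@proj_neg _ _ false) ?hf.
apply: (iffP memv_imgP) => [[u _ ->] i|hf].
  by rewrite lfunE /= ffunE proj_mem.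
by exists f; rewrite ?memvf // lfunE; apply/ffunP => i; rewrite ffunE proj_id ?hf.
Qed.

Definition rmul_fun (b : B) (f : T) : T := [ffun i => sa_mul (f i) b].
Definition lmul_fun (b : B) (f : T) : T := [ffun i => sa_mul b (f i)].

Lemma rmul_fun_is_linear b : linear (rmul_fun b).
Proof. by move=> c u v; apply/ffunP => i; rewrite !ffunE (@sa_mul_linl _ B). Qed.
HB.instance Definition _ (b : B) :=
  GRing.isLinear.Build k T T _ (rmul_fun b) (rmul_fun_is_linear b).

Lemma lmul_fun_is_linear b : linear (lmul_fun b).
Proof. by move=> c u v; apply/ffunP => i; rewrite !ffunE (@sa_mul_linr _ B). Qed.
HB.instance Definition _ (b : B) :=
  GRing.isLinear.Build k T T _ (lmul_fun b) (lmul_fun_is_linear b).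

Lemma rmul_gr e b : b \in gr B e -> linfun (rmul_fun b) \in hgr ffun_ss ffun_ss e.
Proof.
move=> hb; apply/(@hgrP k ffun_ss ffun_ss) => c f /ffun_ssP hf.
by apply/ffun_ssP => i; rewrite lfunE /= ffunE sa_grM.
Qed.

Lemma lmul_gr e b : b \in gr B e -> linfun (lmul_fun b) \in hgr ffun_ss ffun_ss e.
Proof.
move=> hb; apply/(@hgrP k ffun_ss ffun_ss) => c f /ffun_ssP hf.
by apply/ffun_ssP => i; rewrite lfunE /= ffunE addbC sa_grM.
Qed.

(* The n-fold direct sum of the right regular supermodule; U(1)^n for C1. *)
Program Definition rreg : rsmod B :=
  @RSMod k B ffun_ss (fun b => linfun (rmul_fun b)) _ _ _ _.
Next Obligation.
move=> c a b; apply/lfunP => f; rewrite add_lfunE scale_lfunE !lfunE /=.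
by apply/ffunP => i; rewrite !ffunE (@sa_mul_linr _ B).
Qed.
Next Obligation.
by apply/lfunP => f; rewrite id_lfunE lfunE /=; apply/ffunP => i; rewrite ffunE sa_mul1r.
Qed.
Next Obligation.
apply/lfunP => f; rewrite comp_lfunE !lfunE /=; apply/ffunP => i.
by rewrite !ffunE sa_mulA.
Qed.
Next Obligation. exact: rmul_gr. Qed.

(* The n-fold direct sum of the left regular supermodule; U_l(1)^n for C1. *)
Program Definition lreg : lsmod B :=
  @LSMod k B ffun_ss (fun b => linfun (lmul_fun b)) _ _ _ _.
Next Obligation.
move=> c a b; apply/lfunP => f; rewrite add_lfunE scale_lfunE !lfunE /=.
by apply/ffunP => i; rewrite !ffunE (@sa_mul_linl _ B).
Qed.
Next Obligation.
by apply/lfunP => f; rewrite id_lfunE lfunE /=; apply/ffunP => i; rewrite ffunE sa_mul1l.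
Qed.
Next Obligation.
apply/lfunP => f; rewrite comp_lfunE !lfunE /=; apply/ffunP => i.
by rewrite !ffunE sa_mulA.
Qed.
Next Obligation. exact: lmul_gr. Qed.
End Regular.

End Examples.

Section TensorPower.
Variables (k : fieldType) (d : nat).

(* The basis vector of V^(tensor d) indexed by t is the tensor product of the
   sbasis (t l), l < d. *)
Definition tidx (V : superspace k) := {ffun 'I_d -> 'I_(sdim V)}.
Definition tcar (V : superspace k) := {ffun tidx V -> k^o}.

Definition tpar (V : superspace k) (t : tidx V) : bool :=
  odd (\sum_l spar (t l)).

Definition teven (V : superspace k) (x : tcar V) : tcar V :=
  [ffun t : tidx V => if tpar t then 0 else x t].

Lemma teven_is_linear V : linear (@teven V).
Proof.
move=> c x y; apply/ffunP => t; rewrite !ffunE.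
by case: ifP; rewrite ?scaler0 ?addr0.
Qed.
HB.instance Definition _ (V : superspace k) :=
  GRing.isLinear.Build k (tcar V) (tcar V) _ (@teven V) (@teven_is_linear V).

Lemma teven_idem V : (linfun (@teven V) \o linfun (@teven V) = linfun (@teven V))%VF.
Proof.
apply/lfunP => x; rewrite comp_lfunE !lfunE /=; apply/ffunP => t.
by rewrite !ffunE; case: (tpar t).
Qed.

Definition tpow (V : superspace k) : superspace k :=
  superspace_of_idem (@teven_idem V).

Lemma tpowP V e (x : tpow V) :
  reflect (forall t, tpar t != e -> x t = 0) (x \in gr (tpow V) e).
Proof.
case: e => /=.
  rewrite memv_ker lfunE /=; apply: (iffP eqP) => [x0 t | hx].
    have := congr1 (fun y : tcar V => y t) x0; rewrite !ffunE.
    by case: (tpar t).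
  by apply/ffunP => t; rewrite !ffunE; case: ifP => // ht; rewrite hx ?ht.
apply: (iffP memv_imgP) => [[u _ ->] t|hx].
  by rewrite lfunE /= ffunE; case: (tpar t).
exists x; rewrite ?memvf // lfunE; apply/ffunP => t; rewrite ffunE.
by case: ifP => // ht; rewrite hx ?ht.
Qed.

(* For j = i + 1 this is the right action of the transposition (i j):
   e_t . (i j) = (-1)^(|t_i||t_j|) e_(t o (i j)). *)
Definition swap_idx (V : superspace k) (i j : 'I_d) (t : tidx V) : tidx V :=
  [ffun l => t (tperm i j l)].

Definition swap_fun (V : superspace k) (i j : 'I_d) (x : tcar V) : tcar V :=
  [ffun t : tidx V => (-1) ^+ (spar (t i) && spar (t j)) * (x (swap_idx i j t) : k)].

Lemma swap_fun_is_linear V i j : linear (@swap_fun V i j).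
Proof.
move=> c x y; apply/ffunP => t; rewrite !ffunE /GRing.scale /=.
by rewrite mulrDr mulrCA.
Qed.
HB.instance Definition _ (V : superspace k) (i j : 'I_d) :=
  GRing.isLinear.Build k (tcar V) (tcar V) _ (@swap_fun V i j)
    (@swap_fun_is_linear V i j).

Definition swapT (V : superspace k) (i j : 'I_d) : 'End(tpow V) :=
  linfun (@swap_fun V i j).

Lemma swapT_gr V i j : swapT V i j \in hgr (tpow V) (tpow V) false.
Proof.
apply/hgrP => c x /tpowP hx; apply/tpowP => t; rewrite addbF => ht.
rewrite lfunE /= ffunE hx ?mulr0 //.
suff -> : tpar (swap_idx i j t) = tpar t by [].
rewrite /tpar (reindex_inj (@perm_inj _ (tperm i j))) /=; congr odd.
by apply: eq_bigr => l _; rewrite ffunE tpermK.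
Qed.

Section Action.
Variables (B : superalg k).

Definition upd (V : superspace k) (t : tidx V) (i : 'I_d) (u : 'I_(sdim V)) : tidx V :=
  [ffun l => if l == i then u else t l].

(* The right action of 1 (x) .. (x) b (x) .. (x) 1, with b of degree e in
   position i:
   (v_1 (x) .. (x) v_d) . b_i =
     (-1)^(e (|v_(i+1)| + .. + |v_d|)) v_1 (x) .. (x) v_i b (x) .. (x) v_d. *)
Definition act_fun (V : rsmod B) (e : bool) (i : 'I_d) (b : B) (x : tcar V) : tcar V :=
  [ffun t : tidx V => (-1) ^+ (e * \sum_(j < d | (i < j)%N) spar (t j))%N *
     \sum_(u < sdim V) (x (upd t i u) : k) * scoord (t i) (ract V b (sbasis u))].

Lemma act_fun_is_linear V e i b : linear (@act_fun V e i b).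
Proof.
move=> c x y; apply/ffunP => t; rewrite !ffunE /GRing.scale /=.
rewrite mulrCA -mulrDr; congr (_ * _); rewrite mulr_sumr -big_split /=.
by apply: eq_bigr => u _; rewrite !ffunE mulrDl -mulrA.
Qed.
HB.instance Definition _ (V : rsmod B) (e : bool) (i : 'I_d) (b : B) :=
  GRing.isLinear.Build k (tcar V) (tcar V) _ (@act_fun V e i b)
    (@act_fun_is_linear V e i b).

Definition actT (V : rsmod B) (e : bool) (i : 'I_d) (b : B) : 'End(tpow V) :=
  linfun (@act_fun V e i b).

Lemma actT_lin V e i : linear (@actT V e i).
Proof.
move=> c a b; apply/lfunP => x; rewrite add_lfunE scale_lfunE !lfunE /=.
apply/ffunP => t; rewrite !ffunE /GRing.scale /= mulrCA -mulrDr; congr (_ * _).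
rewrite mulr_sumr -big_split /=; apply: eq_bigr => u _.
by rewrite ract_lin add_lfunE scale_lfunE scoord_is_linear /GRing.scale /= mulrDr mulrCA.
Qed.
HB.instance Definition _ (V : rsmod B) (e : bool) (i : 'I_d) :=
  GRing.isLinear.Build k B 'End(tpow V) _ (@actT V e i) (@actT_lin V e i).

Lemma actT_gr V e i b : b \in gr B e -> @actT V e i b \in hgr (tpow V) (tpow V) e.
Proof.
move=> hb; apply/hgrP => c x /tpowP hx; apply/tpowP => t ht.
rewrite lfunE /= ffunE [X in _ * X]big1 ?mulr0 // => u _.
have [ct|ct] := eqVneq (tpar (upd t i u)) c; last by rewrite hx // mul0r.
suff eu : spar u (+) e != spar (t i).
  rewrite (scoord_gr _ eu) ?mulr0 //.
  by have /hgrP := ract_gr V hb; apply; apply: sbasis_gr.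
apply: contra_neq ht => E; rewrite -ct /tpar (bigD1 i) //= [in RHS](bigD1 i) //=.
rewrite !oddD !oddb ffunE eqxx -E addbAC; congr (_ (+) odd _ (+) _).
by apply: eq_bigr => l li; rewrite ffunE (negPf li).
Qed.

Definition commutator (V W : superspace k) (u : 'End(tpow V)) (v : 'End(tpow W))
    (f : 'Hom(tpow V, tpow W)) : 'Hom(tpow V, tpow W) := (f \o u)%VF - (v \o f)%VF.

Lemma commutator_is_linear V W u v : linear (@commutator V W u v).
Proof.
move=> c f g; rewrite /commutator comp_lfunDl comp_lfunDr -comp_lfunZl -comp_lfunZr.
by rewrite scalerBr opprD addrACA.
Qed.
HB.instance Definition _ (V W : superspace k) (u : 'End(tpow V)) (v : 'End(tpow W)) :=
  GRing.isLinear.Build k 'Hom(tpow V, tpow W) 'Hom(tpow V, tpow W) _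
    (@commutator V W u v) (@commutator_is_linear V W u v).

(* The homomorphisms V^(tensor d) -> W^(tensor d) of right supermodules over
   B wr S_d: the linear maps commuting with the generators of B wr S_d. *)
Definition GHom (V W : rsmod B) : {vspace 'Hom(tpow V, tpow W)} :=
  ((\bigcap_(i < d) \bigcap_(j < d | j == i.+1 :> nat)
      lker (linfun (commutator (swapT V i j) (swapT W i j)))) :&:
   (\bigcap_(e : bool) \bigcap_(i < d) \bigcap_(a < \dim (gr B e))
      lker (linfun (commutator (actT V e i (vbasis (gr B e))`_a)
                               (actT W e i (vbasis (gr B e))`_a)))))%VS.

Lemma commutatorP V W u v (f : 'Hom(tpow V, tpow W)) :
  reflect (f \o u = v \o f)%VF (f \in lker (linfun (commutator u v))).
Proof.
rewrite memv_ker lfunE /= /commutator subr_eq0; exact: eqP.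
Qed.

Lemma memv_bigcap (I : finType) (P : pred I) (vT : vectType k)
    (F : I -> {vspace vT}) v :
  reflect (forall i, P i -> v \in F i) (v \in (\bigcap_(i | P i) F i)%VS).
Proof.
rewrite memvE; apply: (iffP subv_bigcapP) => h i Pi; first by rewrite memvE h.
by rewrite -memvE h.
Qed.

Lemma GHomP (V W : rsmod B) (f : 'Hom(tpow V, tpow W)) :
  reflect
    ((forall i j : 'I_d, j = i.+1 :> nat -> (f \o swapT V i j = swapT W i j \o f)%VF) /\
     (forall e (i : 'I_d) b, b \in gr B e -> (f \o actT V e i b = actT W e i b \o f)%VF))
    (f \in GHom V W).
Proof.
rewrite memv_cap; apply: (iffP andP) => [[hs ha] | [hs ha]]; split.
- move=> i j ij; apply/commutatorP.
  move/memv_bigcap: hs => /(_ i isT)/memv_bigcap; apply; exact/eqP.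
- move=> e i b /coord_vbasis ->; rewrite !linear_sum /=.
  apply/lfunP => x; rewrite !comp_lfunE !sum_lfunE linear_sum /=.
  apply: eq_bigr => a _; rewrite !linearZ !scale_lfunE linearZ /=; congr (_ *: _).
  rewrite -!comp_lfunE; congr (fun_of_lfun _ x); apply/commutatorP.
  by move/memv_bigcap: ha => /(_ e isT)/memv_bigcap/(_ i isT)/memv_bigcap; apply.
- apply/memv_bigcap => i _; apply/memv_bigcap => j /eqP ij.
  by apply/commutatorP; apply: hs.
- apply/memv_bigcap => e _; apply/memv_bigcap => i _; apply/memv_bigcap => a _.
  by apply/commutatorP/ha/vbasis_mem; rewrite mem_nth // size_tuple.
Qed.

Lemma hpart_commute (V W : superspace k) (u : 'End(V)) (v : 'End(W)) e c
    (f : 'Hom(V, W)) :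
  u \in hgr V V e -> v \in hgr W W e -> (f \o u = v \o f)%VF ->
  (hpart c f \o u = v \o hpart c f)%VF.
Proof.
move=> /hgrP hu /hgrP hv fu; apply: eq_on_gr => a x hx; rewrite !comp_lfunE.
rewrite (hpartE _ _ (hu _ _ hx)) (hpartE _ _ hx).
have -> : f (u x) = v (f x) by rewrite -!comp_lfunE fu.
rewrite -{1}(proj_add (a (+) c) (f x)) !linearD /=.
rewrite proj_id; last by rewrite addbAC; apply/hv/proj_mem.
rewrite (proj_neg (v := v (proj W (~~ _) _))) ?addr0 //.
have -> : ~~ (a (+) e (+) c) = ~~ (a (+) c) (+) e by case: (a) (e) (c) => [] [] [].
exact/hv/proj_mem.
Qed.

Lemma hpart_GHom (V W : rsmod B) c (f : 'Hom(tpow V, tpow W)) :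
  f \in GHom V W -> hpart c f \in GHom V W.
Proof.
move=> /GHomP[hs ha]; apply/GHomP; split=> [i j ij|e i b hb].
  by apply: hpart_commute (hs _ _ ij); apply: swapT_gr.
by apply: hpart_commute (ha _ _ _ hb); apply: actT_gr.
Qed.

Lemma GHom1 (V : rsmod B) : \1%VF \in GHom V V.
Proof. by apply/GHomP; split=> *; rewrite comp_lfun1l comp_lfun1r. Qed.

Lemma GHom_comp (U V W : rsmod B) (f : 'Hom(tpow V, tpow W)) (g : 'Hom(tpow U, tpow V)) :
  f \in GHom V W -> g \in GHom U V -> (f \o g)%VF \in GHom U W.
Proof.
move=> /GHomP[fs fa] /GHomP[gs ga]; apply/GHomP; split=> [i j ij|e i b hb].
  by rewrite -comp_lfunA gs // comp_lfunA fs // comp_lfunA.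
by rewrite -comp_lfunA ga // comp_lfunA fa // comp_lfunA.
Qed.

Definition ggr (V W : rsmod B) (e : bool) : {vspace subvs_of (GHom V W)} :=
  (linfun (@vsval k _ (GHom V W)) @^-1: hgr (tpow V) (tpow W) e)%VS.

Lemma mem_ggr (V W : rsmod B) e (f : subvs_of (GHom V W)) :
  (f \in ggr V W e) = (vsval f \in hgr (tpow V) (tpow W) e).
Proof. by rewrite -memv_preim lfunE. Qed.

Lemma ggr_sum V W : (ggr V W false + ggr V W true)%VS = fullv.
Proof.
apply/eqP; rewrite eqEsubv subvf /=; apply/subvP => f _.
have -> : f = Subvs (hpart_GHom false (subvsP f)) + Subvs (hpart_GHom true (subvsP f)).
  by apply: (@subvs_inj _ _ (GHom V W)); exact: esym (@hpart_add k (tpow V) (tpow W) false (vsval f)).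
by rewrite memv_add // mem_ggr hpart_hgr.
Qed.

Lemma ggr_cap V W : (ggr V W false :&: ggr V W true)%VS = 0%VS.
Proof.
apply/eqP; rewrite -subv0.
apply/subvP => f.
rewrite memv_cap.
rewrite memv0.
move=> /andP[h0 h1].
have {}h0 := etrans (esym (mem_ggr false f)) h0.
have {}h1 := etrans (esym (mem_ggr true f)) h1.
apply/eqP/val_inj.
by rewrite /= -(hpart_id h0) (@hpart_neg k _ _ false _ h1).
Qed.

(* Gamma^d Hom_B(V, W), identified with Hom_(B wr S_d)(V^(tensor d), W^(tensor d)),
   the degree of a homomorphism being its degree as a linear map. *)
Definition ghom (V W : rsmod B) : superspace k :=
  SuperSpace (ggr_sum V W) (ggr_cap V W).

Definition gid (V : rsmod B) : ghom V V := Subvs (GHom1 V).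

Definition gcomp (U V W : rsmod B) (f : ghom V W) (g : ghom U V) : ghom U W :=
  Subvs (GHom_comp (subvsP f) (subvsP g)).

(* The Schur superalgebra End_(B wr S_d)(V^(tensor d)). *)
Section Schur.
Variable V : rsmod B.

Lemma gcomp_linl (g : ghom V V) : linear (fun f : ghom V V => gcomp f g).
Proof. by move=> c f f'; apply: subvs_inj; rewrite /= comp_lfunDl comp_lfunZl. Qed.

Lemma gcomp_linr (f : ghom V V) : linear (@gcomp V V V f).
Proof. by move=> c g g'; apply: subvs_inj; rewrite /= comp_lfunDr comp_lfunZr. Qed.

Lemma gcompA : associative (@gcomp V V V).
Proof. by move=> f g h; apply: subvs_inj; rewrite /= comp_lfunA. Qed.

Lemma gcomp1l : left_id (gid V) (@gcomp V V V).
Proof. by move=> f; apply: subvs_inj; rewrite /= comp_lfun1l. Qed.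

Lemma gcomp1r : right_id (gid V) (@gcomp V V V).
Proof. by move=> f; apply: subvs_inj; rewrite /= comp_lfun1r. Qed.

Lemma gid_gr : gid V \in gr (ghom V V) false.
Proof. exact: etrans (mem_ggr false (gid V)) (hgr1 _). Qed.

Lemma gcomp_gr e c (f g : ghom V V) :
  f \in gr (ghom V V) e -> g \in gr (ghom V V) c ->
  gcomp f g \in gr (ghom V V) (e (+) c).
Proof.
move=> hf hg; have {}hf := etrans (esym (mem_ggr e f)) hf.
have {}hg := etrans (esym (mem_ggr c g)) hg.
have hfg := hgr_comp hf hg; rewrite addbC in hfg.
exact: etrans (mem_ggr (e (+) c) (gcomp f g)) hfg.
Qed.

Definition schur : superalg k :=
  SuperAlg gcomp_linl gcomp_linr gcompA gcomp1l gcomp1r gid_gr gcomp_gr.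
End Schur.

Record polfun := PolFun {
  pf_ob : rsmod B -> superspace k;
  pf_mor : forall V W, ghom V W -> 'Hom(pf_ob V, pf_ob W);
  pf_lin : forall V W, linear (@pf_mor V W);
  pf_even : forall V W e f,
    f \in gr (ghom V W) e -> pf_mor f \in hgr (pf_ob V) (pf_ob W) e;
  pf_id : forall V, pf_mor (gid V) = \1%VF;
  pf_comp : forall U V W (f : ghom V W) (g : ghom U V),
    pf_mor (gcomp f g) = (pf_mor f \o pf_mor g)%VF }.

Definition pol_natural (S T : polfun) (eta : forall V, 'Hom(pf_ob S V, pf_ob T V)) : Prop :=
  forall V W (f : ghom V W), (eta W \o pf_mor S f = pf_mor T f \o eta V)%VF.

Lemma pol_natural1 (S : polfun) : pol_natural (fun V => \1%VF : 'End(pf_ob S V)).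
Proof. by move=> V W f; rewrite comp_lfun1l comp_lfun1r. Qed.

Lemma pol_naturalM (S T U : polfun) (a : forall V, 'Hom(pf_ob T V, pf_ob U V))
    (b : forall V, 'Hom(pf_ob S V, pf_ob T V)) :
  pol_natural a -> pol_natural b -> pol_natural (fun V => (a V \o b V)%VF).
Proof. by move=> ha hb V W f; rewrite -comp_lfunA hb !comp_lfunA ha. Qed.

Program Definition Pol : category :=
  @Category polfun (fun S T => {eta | @pol_natural S T eta})
    (fun S => exist _ _ (@pol_natural1 S))
    (fun S T U a b => exist _ _ (pol_naturalM (svalP a) (svalP b))) _ _ _.
Next Obligation.
apply: sval_eq; apply: functional_extensionality_dep => V; exact: comp_lfun1l.
Qed.
Next Obligation.
apply: sval_eq; apply: functional_extensionality_dep => V; exact: comp_lfun1r.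
Qed.
Next Obligation.
apply: sval_eq; apply: functional_extensionality_dep => V; exact: comp_lfunA.
Qed.

(* The underlying ordinary category of Pol, whose hom-sets are superspaces: only
   the even natural transformations are kept.  On these a Koszul sign in
   pol_natural would make no difference. *)
Definition Pol_even : category :=
  @wide_subcategory Pol
    (fun S T eta => forall V, sval eta V \in hgr (pf_ob S V) (pf_ob T V) false)
    (fun S V => hgr1 (pf_ob S V))
    (fun S T U a b ha hb V => hgr_comp (ha V) (hb V)).

End Action.
End TensorPower.

(* algType excludes the zero algebra, over which all functors considered below
   have exactly one point. *)
Record csalg (k : fieldType) := CSAlg {
  ca_car :> algType k;
  ca_gr : bool -> ca_car -> Prop;
  ca_gr0 : forall e, ca_gr e 0;
  ca_grP : forall e (c : k) x y, ca_gr e x -> ca_gr e y -> ca_gr e (c *: x + y);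
  ca_dec : forall x, exists x0 x1, [/\ ca_gr false x0, ca_gr true x1 & x = x0 + x1];
  ca_cap : forall x, ca_gr false x -> ca_gr true x -> x = 0;
  ca_gr1 : ca_gr false 1;
  ca_grM : forall e c x y, ca_gr e x -> ca_gr c y -> ca_gr (e (+) c) (x * y);
  ca_comm : forall e c x y, ca_gr e x -> ca_gr c y ->
    x * y = (-1) ^+ (e && c) * (y * x) }.
Arguments ca_gr {k} A e x : rename.

Section Schemes.
Variable k : fieldType.

Definition is_csmor (A A' : csalg k) (f : A -> A') : Prop :=
  [/\ linear f, f 1 = 1, {morph f : x y / x * y}
    & forall e x, ca_gr A e x -> ca_gr A' e (f x)].

Definition csmor (A A' : csalg k) := {f : A -> A' | is_csmor f}.
Definition csfun (A A' : csalg k) (u : csmor A A') : A -> A' := sval u.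

Lemma csfun_is_linear (A A' : csalg k) (u : csmor A A') : linear (csfun u).
Proof. by case: (svalP u). Qed.
Lemma csfun_is_monoid_morphism (A A' : csalg k) (u : csmor A A') :
  monoid_morphism (csfun u).
Proof. by case: (svalP u). Qed.
HB.instance Definition _ (A A' : csalg k) (u : csmor A A') :=
  GRing.isLinear.Build k A A' _ (csfun u) (csfun_is_linear u).
HB.instance Definition _ (A A' : csalg k) (u : csmor A A') :=
  GRing.isMonoidMorphism.Build A A' (csfun u) (csfun_is_monoid_morphism u).

Lemma csmor1 (A : csalg k) : is_csmor (fun x : A => x).
Proof. by split. Qed.

Lemma csmorM (A B C : csalg k) (f : B -> C) (g : A -> B) :
  is_csmor f -> is_csmor g -> is_csmor (fun x => f (g x)).
Proof.
move=> [f1 f2 f3 f4] [g1 g2 g3 g4]; split=> [c x y||x y|e x hx].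
- by rewrite g1 f1.
- by rewrite g2 f2.
- by rewrite g3 f3.
- exact/f4/g4.
Qed.

Program Definition salg : category :=
  @Category (csalg k) csmor (fun A => exist _ _ (csmor1 A))
    (fun A B C f g => exist _ _ (csmorM (svalP f) (svalP g))) _ _ _.
Next Obligation. exact: sval_eq. Qed.
Next Obligation. exact: sval_eq. Qed.
Next Obligation. exact: sval_eq. Qed.

(* The matrix of f (x) id_A : V (x) A -> W (x) A, a map of right A-modules, in
   the A-bases of V (x) A and W (x) A given by sbasis. *)
Definition mxA (A : csalg k) (V W : superspace k) (f : 'Hom(V, W)) :
  'M[A]_(sdim W, sdim V) := map_mx (in_alg A) (lmx f).

Lemma mxA1 (A : csalg k) (V : superspace k) : mxA A (\1%VF : 'End(V)) = 1%:M.
Proof. by rewrite /mxA lmx1 map_mx1. Qed.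

Lemma mxAM (A : csalg k) (U V W : superspace k) (f : 'Hom(V, W)) (g : 'Hom(U, V)) :
  mxA A (f \o g)%VF = mxA A f *m mxA A g.
Proof. by rewrite /mxA lmxM map_mxM. Qed.

Lemma csfun_mxA (A A' : csalg k) (u : csmor A A') (V W : superspace k)
  (f : 'Hom(V, W)) : map_mx (csfun u) (mxA A f) = mxA A' f.
Proof. by apply/matrixP => i j; rewrite !mxE linearZ /= rmorph1. Qed.

Section Points.
Variable B : superalg k.
Implicit Types U V W : lsmod B.

(* Matrices of the even B (x) A-linear maps V (x) A -> W (x) A, i.e. of the
   elements of (Hom_B(V, W) (x) A)_0. *)
Definition is_point (A : csalg k) V W (g : 'M[A]_(sdim W, sdim V)) : Prop :=
  (forall i j, ca_gr A (spar i (+) spar j) (g i j)) /\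
  (forall b : B, g *m mxA A (lact V b) = mxA A (lact W b) *m g).

Definition point (A : csalg k) V W := {g : 'M[A]_(sdim W, sdim V) | is_point g}.

Lemma ca_sum (A : csalg k) e (I : finType) (F : I -> A) :
  (forall i, ca_gr A e (F i)) -> ca_gr A e (\sum_i F i).
Proof.
move=> hF; apply: big_ind => [|x y hx hy|i _]; [exact: ca_gr0| |exact: hF].
by rewrite -[x]scale1r; apply: ca_grP.
Qed.

Lemma is_point1 (A : csalg k) V : @is_point A V V 1%:M.
Proof.
split=> [i j|b]; last by rewrite mul1mx mulmx1.
by rewrite !mxE; case: eqP => [->|_]; rewrite ?addbb; [exact: ca_gr1|exact: ca_gr0].
Qed.

Lemma is_pointM (A : csalg k) U V W (g : 'M[A]_(sdim W, sdim V))
    (h : 'M[A]_(sdim V, sdim U)) :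
  is_point g -> is_point h -> @is_point A U W (g *m h).
Proof.
move=> [g0 gB] [h0 hB]; split=> [i j|b]; last first.
  by rewrite -mulmxA hB !mulmxA gB.
rewrite mxE; apply: ca_sum => l.
have -> : spar i (+) spar j = (spar i (+) spar l) (+) (spar l (+) spar j).
  by rewrite addbA addbK.
exact: ca_grM.
Qed.

Lemma is_point_map (A A' : csalg k) (u : csmor A A') V W (g : 'M[A]_(sdim W, sdim V)) :
  is_point g -> @is_point A' V W (map_mx (csfun u) g).
Proof.
move=> [g0 gB]; split=> [i j|b].
  by rewrite mxE; case: (svalP u) => _ _ _; apply.
by rewrite -!(csfun_mxA u) -!map_mxM gB.
Qed.

Definition pt1 (A : csalg k) V : point A V V := exist _ _ (is_point1 A V).
Definition ptM (A : csalg k) U V W (g : point A V W) (h : point A U V) : point A U W :=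
  exist _ _ (is_pointM (svalP g) (svalP h)).
Definition pt_map (A A' : csalg k) (u : csmor A A') V W (g : point A V W) :
  point A' V W := exist _ _ (is_point_map u (svalP g)).

Program Definition Hom_a V W : functor salg typeCat :=
  @Functor salg typeCat (fun A : csalg k => point A V W)
    (fun A A' u g => pt_map u g) _ _.
Next Obligation.
apply: functional_extensionality_dep => g; apply: sval_eq.
by apply/matrixP => i j; rewrite !mxE.
Qed.
Next Obligation.
apply: functional_extensionality_dep => x; apply: sval_eq.
by apply/matrixP => i j; rewrite !mxE.
Qed.

Definition gl (A : csalg k) V :=
  {g : point A V V | exists h, ptM g h = pt1 A V /\ ptM h g = pt1 A V}.

Lemma ptMA (A : csalg k) U V W X (f : point A W X) (g : point A V W) (h : point A U V) :
  ptM f (ptM g h) = ptM (ptM f g) h.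
Proof. by apply: sval_eq; rewrite /= mulmxA. Qed.

Lemma ptM1 (A : csalg k) V W (g : point A V W) : ptM g (pt1 A V) = g.
Proof. by apply: sval_eq; rewrite /= mulmx1. Qed.

Lemma ptM_map (A A' : csalg k) (u : csmor A A') U V W (g : point A V W) (h : point A U V) :
  pt_map u (ptM g h) = ptM (pt_map u g) (pt_map u h).
Proof. by apply: sval_eq; rewrite /= map_mxM. Qed.

Lemma pt1_map (A A' : csalg k) (u : csmor A A') V : pt_map u (pt1 A V) = pt1 A' V.
Proof. by apply: sval_eq; rewrite /= map_mx1. Qed.

Lemma gl_mul (A : csalg k) V (g h : gl A V) :
  exists h', ptM (ptM (sval g) (sval h)) h' = pt1 A V /\
             ptM h' (ptM (sval g) (sval h)) = pt1 A V.
Proof.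
case: g h => [g [g' [g1 g2]]] [h [h' [h1 h2]]] /=; exists (ptM h' g').
rewrite -ptMA (ptMA h) h1 ptMA ptM1 g1; split=> //.
by rewrite -ptMA (ptMA g') g2 ptMA ptM1 h2.
Qed.

Definition glM (A : csalg k) V (g h : gl A V) : gl A V := exist _ _ (gl_mul g h).

Lemma gl_map_subproof (A A' : csalg k) (u : csmor A A') V (g : gl A V) :
  exists h, ptM (pt_map u (sval g)) h = pt1 A' V /\
            ptM h (pt_map u (sval g)) = pt1 A' V.
Proof.
case: g => [g [h [h1 h2]]] /=; exists (pt_map u h).
by rewrite -!ptM_map h1 h2 pt1_map.
Qed.

Definition gl_map (A A' : csalg k) (u : csmor A A') V (g : gl A V) : gl A' V :=
  exist _ _ (gl_map_subproof u g).

Program Definition GL V : functor salg typeCat :=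
  @Functor salg typeCat (fun A : csalg k => gl A V) (fun A A' u g => gl_map u g) _ _.
Next Obligation.
apply: functional_extensionality_dep => g; do 2 apply: sval_eq.
by apply/matrixP => i j; rewrite !mxE.
Qed.
Next Obligation.
apply: functional_extensionality_dep => x; do 2 apply: sval_eq.
by apply/matrixP => i j; rewrite !mxE.
Qed.
End Points.

(* The coordinate functions g |-> g i j generate k[Hom_B(V, W)_a] =
   S^*(Hom_B(V, W)^dual), so S^d(Hom_B(V, W)^dual) is spanned by their d-fold
   products.  An element of Hom_k(M, N) (x) S^d(Hom_B(V, W)^dual) is thus given
   by a family of coefficients c, and corresponds to the morphism
   g |-> polyeval c g. *)
Definition polyeval (d p q r s : nat)
    (c : 'I_r -> 'I_s -> {ffun 'I_d -> 'I_p * 'I_q} -> k)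
    (A : csalg k) (g : 'M[A]_(p, q)) : 'M[A]_(r, s) :=
  \matrix_(i, j) \sum_t c i j t *: \prod_(l < d) g (t l).1 (t l).2.

Definition homogeneous (d p q r s : nat) (X : csalg k -> Type)
    (x : forall A, X A -> 'M[A]_(p, q)) (y : forall A, X A -> 'M[A]_(r, s)) : Prop :=
  exists c : 'I_r -> 'I_s -> {ffun 'I_d -> 'I_p * 'I_q} -> k,
    forall A (g : X A), y A g = polyeval c (x A g).

Section SschFunctors.
Variable B : superalg k.

Record sschfun := SschFun {
  sf_ob : lsmod B -> superspace k;
  sf_mor : forall V W,
    nattrans (Hom_a V W) (Hom_a (klmod (sf_ob V)) (klmod (sf_ob W)));
  sf_id : forall V (A : csalg k),
    sf_mor V V A (pt1 A V) = pt1 A (klmod (sf_ob V));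
  sf_comp : forall U V W (A : csalg k) (g : point A V W) (h : point A U V),
    sf_mor U W A (ptM g h) = ptM (sf_mor V W A g) (sf_mor U V A h) }.

Definition sf_mx (T : sschfun) V W (A : csalg k) (g : point A V W) :
  'M[A]_(sdim (sf_ob T W), sdim (sf_ob T V)) := sval (sf_mor T V W A g).

Definition ssch_natural (S T : sschfun)
    (a : forall V, 'Hom(sf_ob S V, sf_ob T V)) : Prop :=
  (forall V, a V \in hgr (sf_ob S V) (sf_ob T V) false) /\
  (forall V W (A : csalg k) (g : point A V W),
    mxA A (a W) *m sf_mx S g = sf_mx T g *m mxA A (a V)).

Lemma ssch_natural1 (S : sschfun) :
  @ssch_natural S S (fun V => \1%VF : 'End(sf_ob S V)).
Proof. by split=> [V|V W A g]; rewrite ?hgr1 // !mxA1 mul1mx mulmx1. Qed.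

Lemma ssch_naturalM (S T U : sschfun) (a : forall V, 'Hom(sf_ob T V, sf_ob U V))
    (b : forall V, 'Hom(sf_ob S V, sf_ob T V)) :
  ssch_natural a -> ssch_natural b -> ssch_natural (fun V => (a V \o b V)%VF).
Proof.
move=> [a0 ha] [b0 hb]; split=> [V|V W A g].
  exact: (@hgr_comp _ _ _ _ false false).
by rewrite !mxAM -mulmxA hb !mulmxA ha.
Qed.

Program Definition sschFun : category :=
  @Category sschfun (fun S T => {a | @ssch_natural S T a})
    (fun S => exist _ _ (ssch_natural1 S))
    (fun S T U a b => exist _ _ (ssch_naturalM (svalP a) (svalP b))) _ _ _.
Next Obligation.
apply: sval_eq; apply: functional_extensionality_dep => V; exact: comp_lfun1l.
Qed.
Next Obligation.
apply: sval_eq; apply: functional_extensionality_dep => V; exact: comp_lfun1r.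
Qed.
Next Obligation.
apply: sval_eq; apply: functional_extensionality_dep => V; exact: comp_lfunA.
Qed.

Definition sschPol (d : nat) : category :=
  @full_subcategory sschFun (fun T : sschfun => forall V W : lsmod B,
    @homogeneous d _ _ _ _ (fun A => point A V W)
      (fun A g => sval g) (fun A g => sf_mx T g)).
End SschFunctors.

Section Representations.
Variables (B : superalg k) (V : lsmod B).

Record rep := Rep {
  rp_ss : superspace k;
  rp_mor : nattrans (GL V) (GL (klmod rp_ss));
  rp_mul : forall (A : csalg k) (g h : gl A V),
    rp_mor A (glM g h) = glM (rp_mor A g) (rp_mor A h) }.

Definition rp_mx (M : rep) (A : csalg k) (g : gl A V) :
  'M[A]_(sdim (rp_ss M), sdim (rp_ss M)) := sval (sval (rp_mor M A g)).

(* The structure map of M sends m to the value at m (x) 1 of the generic point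
   of GL_(B, V); so these are the linear maps, of any parity, compatible with the
   structure maps. *)
Definition rep_hom (M N : rep) (f : 'Hom(rp_ss M, rp_ss N)) : Prop :=
  forall (A : csalg k) (g : gl A V), mxA A f *m rp_mx M g = rp_mx N g *m mxA A f.

Lemma rep_hom1 (M : rep) : @rep_hom M M \1%VF.
Proof. by move=> A g; rewrite !mxA1 mul1mx mulmx1. Qed.

Lemma rep_homM (M N P : rep) (f : 'Hom(rp_ss N, rp_ss P)) (g : 'Hom(rp_ss M, rp_ss N)) :
  rep_hom f -> rep_hom g -> @rep_hom M P (f \o g)%VF.
Proof. by move=> hf hg A x; rewrite !mxAM -mulmxA hg !mulmxA hf. Qed.

Program Definition repCat : category :=
  @Category rep (fun M N => {f | @rep_hom M N f})
    (fun M => exist _ _ (rep_hom1 M))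
    (fun M N P f g => exist _ _ (rep_homM (svalP f) (svalP g))) _ _ _.
Next Obligation. by apply: sval_eq; rewrite /= comp_lfun1l. Qed.
Next Obligation. by apply: sval_eq; rewrite /= comp_lfun1r. Qed.
Next Obligation. by apply: sval_eq; rewrite /= comp_lfunA. Qed.

Definition polrep (d : nat) : category :=
  @full_subcategory repCat (fun M : rep =>
    @homogeneous d _ _ _ _ (fun A => gl A V)
      (fun A g => sval (sval g)) (fun A g => rp_mx M g)).

Definition polrep_even (d : nat) : category :=
  @wide_subcategory (polrep d)
    (fun M N f => sval f \in hgr (rp_ss (sval M)) (rp_ss (sval N)) false)
    (fun M => hgr1 (rp_ss (sval M))) (fun M N P f g hf hg => hgr_comp hf hg).
End Representations.
End Schemes.

(* Main.v *)
(* A law of degree d from H = Hom_B(V, W) to Hom(M, N) is the same as a linear map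
   G from Gamma^d H to Hom(M, N): Gamma^d H is realised by GHom, and the matrix X(g)
   of the d-th tensor power of an A-point g of H is an A-linear combination of
   elements of GHom, so that G can be extended A-linearly and evaluated at X(g).
   Every polynomial in the entries of g arises in this way, because the entries of
   X(g) are up to sign all the d-fold products of entries of g.  Conversely G is
   determined by the law, and turns composition of points into composition, because
   every element of GHom is the image of X(g) under a linear functional A -> k, for
   the generic g over a free supercommutative algebra A in nilpotent variables
   (divided powers being dual to symmetric powers; this uses that the characteristic
   is not 2); two elements can be treated at once with a disjoint set of variables.
   Adding a constant matrix to g does not change the part of degree d in the
   variables, so the generic g may be chosen invertible, congruent to 1; this is why
   laws on the supergroup GL and on all of End are the same.

   Finally, matrices of points compose and commute without signs, while morphisms of
   supermodules follow the sign rule.  The two notions of morphism are matched by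
   twisting the odd part of a morphism by an operator implementing the parity: the
   element of the Schur superalgebra given by the parity of the tensor power in type
   I, and a square root of -1 times the parity in type II. *)

From HB Require Import structures.
From mathcomp Require Import all_boot all_order all_fingroup all_algebra.
From mathcomp Require Import boolp ring.
Require Import Defs.

Set Implicit Arguments.
Unset Strict Implicit.
Unset Printing Implicit Defensive.

Import GRing.Theory.
Local Open Scope ring_scope.


(** * Equivalences of categories *)

(** The obstacle is the signs. [GHom] is cut out by equations whose Koszul signs depend on row and
    column parities, whereas the entries of an A-point obey only the commutation rule of A. The
    factor [sgn], the sign of a tensor product of matrix units, reconciles them: once entries are
    multiplied by it, the equations of [GHom] become literally the relations among monomials in the
    entries of an even B-linear point. Such relations pass to coefficients over independent elements
    of A, so X(g) lies in GHom tensor A; conversely a projection onto the B-linear matrices makes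
    enough points out of free variables. Left and right supermodules can be exchanged because k and
    C(1) are both commutative as plain algebras. The twisting operator j must commute with even f
    and satisfy j f j = f for odd f. In type I an even element of the Schur superalgebra does this.
    In type II the parity of the tensor power anticommutes with the action of c, and the parity of
    the module itself gives j f j = -f, whence the factor i with i^2 = -1; over other fields only
    even morphisms are compared there. *)

Lemma equivalent_of_ff_es (C D : category) (F : functor C D) :
  (forall X Y (h : hom (F X) (F Y)), exists f : hom X Y, fmor F f = h) ->
  (forall (X Y : C) (f g : hom X Y), fmor F f = fmor F g -> f = g) ->
  (forall Y : D, exists (X : C) (f : hom (F X) Y), is_iso f) ->
  equivalent C D.
Proof.
move=> full faith es.
(* The object, the isomorphism and its inverse form one witness, so that a single choice keeps them
   coherent. *)
have ex Y : exists p : {X : C & (hom (F X) Y * hom Y (F X))%type},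
    cmp (projT2 p).2 (projT2 p).1 = idm _ /\ cmp (projT2 p).1 (projT2 p).2 = idm _.
  by have [X [f [g fg]]] := es Y; exists (existT _ X (f, g)).
pose G0 Y := sval (cid (ex Y)).
have hG Y : cmp (projT2 (G0 Y)).2 (projT2 (G0 Y)).1 = idm _ /\
            cmp (projT2 (G0 Y)).1 (projT2 (G0 Y)).2 = idm _ := svalP (cid (ex Y)).
pose Go Y : C := projT1 (G0 Y).
pose u Y : hom (F (Go Y)) Y := (projT2 (G0 Y)).1.
pose v Y : hom Y (F (Go Y)) := (projT2 (G0 Y)).2.
have vu Y : cmp (v Y) (u Y) = idm _ by case: (hG Y).
have uv Y : cmp (u Y) (v Y) = idm _ by case: (hG Y).
pose inv X Y (h : hom (F X) (F Y)) : hom X Y := sval (cid (full X Y h)).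
have invK X Y (h : hom (F X) (F Y)) : fmor F (inv _ _ h) = h by rewrite /inv; case: cid.
pose Gm X Y (f : hom X Y) : hom (Go X) (Go Y) := inv _ _ (cmp (v Y) (cmp f (u X))).
have Gm1 X : Gm _ _ (idm X) = idm (Go X).
  by apply: faith; rewrite invK cmp1m vu fmor1.
have GmM X Y Z (f : hom Y Z) (g : hom X Y) : Gm _ _ (cmp f g) = cmp (Gm _ _ f) (Gm _ _ g).
  apply: faith; rewrite fmorM !invK -!cmpA; congr cmp; congr cmp.
  by rewrite (cmpA (u Y)) uv cmp1m.
pose G := Functor Gm1 GmM; exists F, G; split; last first.
  have nat X Y (f : hom X Y) : cmp (u Y) (fmor (functor_comp F G) f) = cmp f (u X).
    by rewrite /= invK cmpA uv cmp1m.
  by exists (@NatTrans _ _ (functor_comp F G) (functor_id D) u nat) => X; exists (v X); split; [apply: vu|apply: uv].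
pose w X : hom (Go (F X)) X := inv _ _ (u (F X)).
have nat X Y (f : hom X Y) : cmp (w Y) (fmor (functor_comp G F) f) = cmp f (w X).
  by apply: faith; rewrite !fmorM /= !invK cmpA uv cmp1m.
exists (@NatTrans _ _ (functor_comp G F) (functor_id C) w nat) => X.
exists (inv _ _ (v (F X))).
by split; apply: faith; rewrite !fmorM !invK fmor1 ?vu ?uv.
Qed.

(** * A supercommutative algebra of truncated monomials *)

Lemma linear_at0 (k : fieldType) (U V : lmodType k) (f : U -> V) : linear f -> f 0 = 0.
Proof.
move=> lf; have := lf 1 0 0; rewrite scaler0 addr0 scale1r => /eqP.
by rewrite -subr_eq0 opprD addNKr oppr_eq0 => /eqP.
Qed.

Section Grassmann.
Variables (k : fieldType) (I : finType) (par : I -> bool) (N : nat).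

Definition expo := {ffun I -> 'I_N.+1}.
Implicit Types (a b c m : expo).

Definition esum a b m := [forall i, (a i + b i)%N == m i].
(** [inord] sends an overflow to 0, so this is meaningful only under the bound of [esumP]. The
    product is therefore defined through the relation [esum], which kills overflowing monomials. *)
Definition eadd a b : expo := [ffun i => inord (a i + b i)].
Definition overlap a b := [exists i, [&& par i, 0 < a i & 0 < b i]%N].
Definition inversions a b : bool :=
  \big[addb/false]_(p : I * I | (enum_rank p.2 < enum_rank p.1)%N)
    [&& par p.1, par p.2, odd (a p.1) & odd (b p.2)].
(* The sign needed to sort the concatenation of the ordered monomials with exponents
   a and b; odd letters cannot be repeated. *)
Definition cocycle a b : k := if overlap a b then 0 else (-1) ^+ inversions a b.
Definition edeg m : nat := \sum_i m i.
Definition epar m : bool := \big[addb/false]_i (par i && odd (m i)).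
Definition e0 : expo := [ffun=> ord0].

Lemma esumP a b m : esum a b m = (eadd a b == m) && [forall i, (a i + b i <= N)%N].
Proof.
apply/forallP/andP => [h|[/eqP <- /forallP h] i]; last by rewrite ffunE inordK // ltnS.
split; last by apply/forallP => i; rewrite (eqP (h i)) -ltnS.
by apply/eqP/ffunP => i; rewrite ffunE (eqP (h i)) inord_val.
Qed.

Lemma overlapC a b : overlap a b = overlap b a.
Proof. by apply: eq_existsb => i; rewrite [(0 < a i)%N && _]andbC. Qed.

Lemma overlapDl a b c m : esum a b m -> overlap m c = overlap a c || overlap b c.
Proof.
move=> /forallP h; apply/existsP/orP.
  case=> i; rewrite -(eqP (h i)) addn_gt0 => /and3P[pi /orP[] ai ci].
    by left; apply/existsP; exists i; rewrite pi ai.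
  by right; apply/existsP; exists i; rewrite pi ai.
by case=> /existsP[i /and3P[pi ai ci]]; exists i; rewrite pi ci -(eqP (h i)) addn_gt0 ai ?orbT.
Qed.

Lemma overlapDr a b c m : esum b c m -> overlap a m = overlap a b || overlap a c.
Proof. by move=> h; rewrite overlapC (overlapDl _ h) !(overlapC a). Qed.

Lemma inversionsDl a b c m : esum a b m ->
  inversions m c = inversions a c (+) inversions b c.
Proof.
move=> /forallP h; rewrite -big_split; apply: eq_bigr => p _ /=.
by rewrite -(eqP (h p.1)) oddD; case: (par _) (par _) (odd _) (odd _) (odd _) => [] [] [] [] [].
Qed.

Lemma inversionsDr a b c m : esum b c m ->
  inversions a m = inversions a b (+) inversions a c.
Proof.
move=> /forallP h; rewrite -big_split; apply: eq_bigr => p _ /=.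
by rewrite -(eqP (h p.2)) oddD; case: (par _) (par _) (odd _) (odd _) (odd _) => [] [] [] [] [].
Qed.

(** [inversions] is bilinear mod 2 and [overlap] distributes over sums, so both sides collect the
    same pairwise terms for (a, b), (a, c) and (b, c). *)
Lemma cocycleA a b c p q : esum a b p -> esum b c q ->
  cocycle a b * cocycle p c = cocycle b c * cocycle a q.
Proof.
move=> hp hq; rewrite /cocycle (overlapDl _ hp) (overlapDr _ hq).
rewrite (inversionsDl _ hp) (inversionsDr _ hq).
case: (overlap a b) (overlap a c) (overlap b c) => [] [] []; rewrite ?mul0r ?mulr0 //=.
by rewrite -!signr_addb; congr (_ ^+ _); case: (inversions _ _) (inversions _ _) (inversions _ _) => [] [] [].
Qed.

Definition sc a b m : k := (esum a b m)%:R * cocycle a b.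

Lemma scE (F : expo -> k) a b :
  \sum_p sc a b p * F p =
  if [forall i, (a i + b i <= N)%N] then cocycle a b * F (eadd a b) else 0.
Proof.
rewrite (bigD1 (eadd a b)) //= big1 => [|p np].
  by rewrite addr0 /sc esumP eqxx /=; case: ifP => _; rewrite ?mul0r // mul1r.
by rewrite /sc esumP eq_sym (negPf np) !mul0r.
Qed.

Lemma scA a b c m : \sum_p sc a b p * sc p c m = \sum_q sc b c q * sc a q m.
Proof.
rewrite !scE.
(* If a + b + c = m, the partial sums are bounded by m and do not overflow; otherwise no
   intermediate exponent contributes on either side. *)
case: (boolP [forall i, (a i + b i + c i)%N == m i]) => [/forallP h|h].
  have hab : forall i, (a i + b i <= N)%N.
    by move=> i; rewrite -ltnS (leq_ltn_trans _ (ltn_ord (m i))) // -(eqP (h i)) leq_addr.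
  have hbc : forall i, (b i + c i <= N)%N.
    by move=> i; rewrite -ltnS (leq_ltn_trans _ (ltn_ord (m i))) // -(eqP (h i)) -addnA leq_addl.
  have p1 : esum a b (eadd a b) by rewrite esumP eqxx; apply/forallP.
  have p2 : esum b c (eadd b c) by rewrite esumP eqxx; apply/forallP.
  move: (hab) (hbc) => /forallP -> /forallP ->; rewrite /sc.
  have -> : esum (eadd a b) c m.
    by apply/forallP => i; rewrite ffunE inordK ?ltnS.
  have -> : esum a (eadd b c) m.
    by apply/forallP => i; rewrite ffunE inordK ?ltnS // addnA.
  by rewrite !mul1r (cocycleA p1 p2).
have e (P : bool) (x y : k) : (if P then x * y else 0) = P%:R * (x * y).
  by case: P; rewrite ?mul1r ?mul0r.
rewrite !e /sc.
have z1 : [forall i, (a i + b i <= N)%N] && esum (eadd a b) c m = false.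
  apply: contraNF h => /andP[/forallP h1 /forallP h2]; apply/forallP => i.
  by rewrite -(eqP (h2 i)) ffunE inordK ?ltnS.
have z2 : [forall i, (b i + c i <= N)%N] && esum a (eadd b c) m = false.
  apply: contraNF h => /andP[/forallP h1 /forallP h2]; apply/forallP => i.
  by rewrite -(eqP (h2 i)) ffunE inordK ?ltnS // addnA.
move: z1 z2; do 2 case: [forall i, _] => /=; rewrite ?mul0r //; last first.
- by move=> _ ->; rewrite !mul0r !mulr0.
- by move=> ->; rewrite !mul0r !mulr0.
by move=> -> ->; rewrite !mul0r !mulr0.
Qed.

(* par is a phantom argument: it determines the multiplication defined below. *)
Definition gras := (fun=> {ffun expo -> k^o} : Type) par.
HB.instance Definition _ := GRing.Lmodule.copy gras {ffun expo -> k^o}.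
Implicit Types f g h : gras.

Definition gmul f g : gras :=
  [ffun m => \sum_a \sum_b sc a b m * ((f a : k) * (g b : k))].
Definition gone : gras := [ffun m => (m == e0)%:R].

Lemma gmulDl : left_distributive gmul +%R.
Proof.
move=> f g h; apply/ffunP => m; rewrite !ffunE -big_split; apply: eq_bigr => a _.
by rewrite -big_split; apply: eq_bigr => b _; rewrite !ffunE mulrDl mulrDr.
Qed.

Lemma gmulDr : right_distributive gmul +%R.
Proof.
move=> f g h; apply/ffunP => m; rewrite !ffunE -big_split; apply: eq_bigr => a _.
by rewrite -big_split; apply: eq_bigr => b _; rewrite !ffunE !mulrDr.
Qed.

Lemma sc0l b m : sc e0 b m = (b == m)%:R.
Proof.
rewrite /sc; have -> : esum e0 b m = (b == m).
  apply/forallP/eqP => [h|-> i]; last by rewrite ffunE.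
  by apply/ffunP => i; apply/val_inj; rewrite /= -(eqP (h i)) ffunE.
rewrite /cocycle; have -> : overlap e0 b = false.
  by apply/existsP => -[i]; rewrite ffunE ltnn /= andbF.
by rewrite /inversions big1 ?mulr1 // => p _; rewrite ffunE /= !andbF.
Qed.

Lemma sc0r b m : sc b e0 m = (b == m)%:R.
Proof.
rewrite /sc; have -> : esum b e0 m = (b == m).
  apply/forallP/eqP => [h|-> i]; last by rewrite ffunE addn0.
  by apply/ffunP => i; apply/val_inj; rewrite /= -(eqP (h i)) ffunE addn0.
rewrite /cocycle; have -> : overlap b e0 = false.
  by apply/existsP => -[i]; rewrite ffunE ltnn /= !andbF.
by rewrite /inversions big1 ?mulr1 // => p _; rewrite ffunE /= !andbF.
Qed.

Lemma gmul1l : left_id gone gmul.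
Proof.
move=> f; apply/ffunP => m; rewrite ffunE (bigD1 e0) //= [X in _ + X]big1 => [|a na].
  rewrite (bigD1 m) //= big1 => [|b nb].
    by rewrite !addr0 ffunE sc0l !eqxx !mul1r.
  by rewrite sc0l (negPf nb) mul0r.
by rewrite big1 // => b _; rewrite ffunE (negPf na) mul0r mulr0.
Qed.

Lemma gmul1r : right_id gone gmul.
Proof.
move=> f; apply/ffunP => m; rewrite ffunE (bigD1 m) //= [X in _ + X]big1 => [|a na].
  rewrite (bigD1 e0) //= big1 => [|b nb].
    by rewrite !addr0 ffunE sc0r !eqxx mul1r mulr1.
  by rewrite ffunE (negPf nb) !mulr0.
rewrite big1 // => b _; rewrite ffunE; case: eqP => [->|_]; last by rewrite !mulr0.
by rewrite sc0r (negPf na) mul0r.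
Qed.

Lemma gmulA : associative gmul.
Proof.
move=> f g h; apply/ffunP => m; rewrite !ffunE.
transitivity (\sum_a \sum_b \sum_c
    (\sum_q sc b c q * sc a q m) * ((f a : k) * ((g b : k) * (h c : k)))).
  apply: eq_bigr => a _; under eq_bigr => q _.
    rewrite ffunE !mulr_sumr; under eq_bigr => b _ do rewrite !mulr_sumr; over.
  rewrite exchange_big /=; apply: eq_bigr => b _; rewrite exchange_big /=.
  apply: eq_bigr => c _; rewrite mulr_suml; apply: eq_bigr => q _.
  by rewrite (@mulrCA k (f a)) (@mulrCA k (sc a q m)) -[RHS]mulrA.
symmetry; transitivity (\sum_p \sum_c \sum_a \sum_b
   (sc a b p * sc p c m) * ((f a : k) * ((g b : k) * (h c : k)))).
  apply: eq_bigr => p _; apply: eq_bigr => c _; rewrite ffunE mulr_suml mulr_sumr.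
  apply: eq_bigr => a _; rewrite mulr_suml mulr_sumr; apply: eq_bigr => b _.
  by have ac (x y u v w : k) : x * (y * (u * v) * w) = y * x * (u * (v * w));
    [rewrite -!mulrA mulrCA|exact: ac].
rewrite exchange_big /=; under eq_bigr do rewrite exchange_big /=.
rewrite exchange_big /=; apply: eq_bigr => a _.
under eq_bigr do rewrite exchange_big /=.
rewrite exchange_big /=; apply: eq_bigr => b _; apply: eq_bigr => c _.
by rewrite -scA mulr_suml.
Qed.

Lemma gone_neq0 : gone != 0.
Proof.
by apply/eqP => /ffunP/(_ e0); rewrite !ffunE eqxx => /eqP; rewrite oner_eq0.
Qed.

HB.instance Definition _ := GRing.Zmodule_isNzRing.Build gras
  gmulA gmul1l gmul1r gmulDl gmulDr gone_neq0.

Lemma gscalerAl (x : k) f g : x *: (f * g) = (x *: f) * g.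
Proof.
apply/ffunP => m; rewrite !ffunE /GRing.scale /= mulr_sumr; apply: eq_bigr => a _.
by rewrite mulr_sumr; apply: eq_bigr => b _; rewrite ffunE mulrCA !mulrA.
Qed.

Lemma gscalerAr (x : k) f g : x *: (f * g) = f * (x *: g).
Proof.
apply/ffunP => m; rewrite !ffunE /GRing.scale /= mulr_sumr; apply: eq_bigr => a _.
by rewrite mulr_sumr; apply: eq_bigr => b _; rewrite ffunE mulrCA [f a * (_ * _)]mulrCA.
Qed.

HB.instance Definition _ := GRing.Lmodule_isLalgebra.Build k gras gscalerAl.
HB.instance Definition _ := GRing.Lalgebra_isAlgebra.Build k gras gscalerAr.

Lemma gmulE f g m : (f * g) m = \sum_a \sum_b sc a b m * ((f a : k) * (g b : k)).
Proof. by rewrite ffunE. Qed.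

Definition ggrade (e : bool) f : Prop := forall m, epar m != e -> f m = 0.

Lemma eparD a b m : esum a b m -> epar m = epar a (+) epar b.
Proof.
move=> /forallP h; rewrite -big_split; apply: eq_bigr => i _ /=.
by rewrite -(eqP (h i)) oddD andb_addr.
Qed.

(** The product of the parities counts all pairs of odd letters, one from each monomial. The order
    of the letters splits these pairs into [inversions a b] and [inversions b a]; a diagonal pair
    would be an overlap, and then both sides vanish. *)
Lemma cocycleC a b : cocycle a b = (-1) ^+ (epar a && epar b) * cocycle b a.
Proof.
rewrite /cocycle overlapC; case: ifP => ov; rewrite ?mulr0 // -signr_addb; congr (_ ^+ _).
suff E : epar a && epar b = inversions a b (+) inversions b a.
  by rewrite E -addbA addbb addbF.
have -> : epar a && epar b = \big[addb/false]_(p : I * I)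
    [&& par p.1, par p.2, odd (a p.1) & odd (b p.2)].
  rewrite /epar big_distrlr /= pair_big /=; apply: eq_bigr => -[i j] _ /=.
  by case: (par i) (par j) (odd _) (odd _) => [] [] [] [].
rewrite (bigID (fun p : I * I => (enum_rank p.2 < enum_rank p.1)%N)) /=; congr (_ (+) _).
rewrite (bigID (fun p : I * I => p.1 == p.2)) /= [X in X (+) _]big1 => [|[i j] /= /andP[_ /eqP <-]].
  rewrite addFb (reindex_inj (h := fun p : I * I => (p.2, p.1))) /=; last first.
    by move=> [? ?] [? ?] [-> ->].
  apply: eq_big => [[i j]|[i j] _] /=; last by case: (par i) (par j) (odd _) (odd _) => [] [] [] [].
  rewrite -leqNgt ltn_neqAle andbC; congr (_ && _); rewrite eq_sym.
  by congr negb; apply/eqP/eqP => [->//|/val_inj/enum_rank_inj].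
move/existsP: ov => /(_ (ex_intro _ i _)) ov.
case pi: (par i) => //=; apply/negP => /andP[ai bi]; apply: ov.
by rewrite pi /=; case: (nat_of_ord (a i)) ai (nat_of_ord (b i)) bi => // ? _ [].
Qed.

Program Definition grasA : csalg k :=
  @CSAlg k gras ggrade _ _ _ _ _ _ _.
Next Obligation. by move=> m _; rewrite ffunE. Qed.
Next Obligation. by move=> m hm; rewrite !ffunE H // H0 // scaler0 addr0. Qed.
Next Obligation.
exists [ffun m => if epar m then 0 else x m], [ffun m => if epar m then x m else 0].
split=> [m|m|]; rewrite ?ffunE; try by case: (epar m).
by apply/ffunP => m; rewrite !ffunE; case: (epar m); rewrite ?add0r ?addr0.
Qed.
Next Obligation.
apply/ffunP => m; rewrite ffunE; case: (boolP (epar m)) => h.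
  by rewrite H ?h.
by rewrite H0 ?(negPf h).
Qed.
Next Obligation.
move=> m hm; rewrite ffunE; case: eqP => // m0; case/negP: hm; rewrite m0.
by rewrite /epar big1 // => i _; rewrite ffunE andbF.
Qed.
Next Obligation.
move=> m hm; rewrite gmulE big1 // => a _; rewrite big1 // => b _.
have [ea|na] := eqVneq (epar a) e; last by rewrite (H _ na) mul0r mulr0.
have [eb|nb] := eqVneq (epar b) c; last by rewrite (H0 _ nb) !mulr0.
rewrite /sc; case: (boolP (esum a b m)) => [/eparD E|]; last by rewrite !mul0r.
by rewrite E ea eb eqxx in hm.
Qed.
Next Obligation.
apply/ffunP => m; rewrite -signr_odd oddb.
have -> : (-1) ^+ (e && c) * (y * x) = (-1) ^+ (e && c) *: (y * x) :> gras.
  by case: (e && c); rewrite ?mulN1r ?scaleN1r ?mul1r ?scale1r.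
rewrite [RHS]ffunE !gmulE exchange_big /= scaler_sumr; apply: eq_bigr => b _.
rewrite scaler_sumr; apply: eq_bigr => a _.
have [ea|na] := eqVneq (epar a) e; last by rewrite (H _ na) mul0r !mulr0 scaler0.
have [eb|nb] := eqVneq (epar b) c; last by rewrite (H0 _ nb) mul0r !mulr0 scaler0.
rewrite /sc; have -> : esum b a m = esum a b m.
  by apply: eq_forallb => i; rewrite addnC.
rewrite cocycleC ea eb.
have ac (s u v w z : k) : s * (u * v) * (w * z) = u * (s * v * (z * w)).
  by rewrite [z * w]mulrC -!mulrA mulrCA.
exact: ac.
Qed.

End Grassmann.

(** * Words and monomials *)

Section Words.
Variables (k : fieldType) (I : finType) (par : I -> bool).

(** The rule obeyed by words in supercommuting letters. It holds for the coefficients of [zw] and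
    for the normalised entries of elements of [GHom], and the proof compares the two. *)
Definition signsym (y : seq I -> k) : Prop := forall u a b v,
  y (u ++ a :: b :: v) = (-1) ^+ (par a && par b) * y (u ++ b :: a :: v).

Lemma signsym_cons x y : signsym y -> signsym (fun w => y (x :: w)).
Proof. by move=> h u a b v; apply: (h (x :: u)). Qed.

Lemma signsym_front x u v :
  exists e : bool, forall y, signsym y -> y (u ++ x :: v) = (-1) ^+ e * y (x :: u ++ v).
Proof.
elim: u => [|a u [e IH]]; first by exists false => y _; rewrite mul1r.
exists (e (+) (par a && par x)) => y hy.
rewrite /= (IH _ (signsym_cons a hy)) (hy [::]) /= mulrA -signr_addb.
by [].
Qed.

(** The order of the quantifiers matters: one sign serves every y, so it can be computed on one
    sign-symmetric function and cancelled on another. *)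
Lemma signsym_perm w w' : perm_eq w w' ->
  exists e : bool, forall y, signsym y -> y w' = (-1) ^+ e * y w.
Proof.
elim: w w' => [|x w IH] w' pw.
  have -> : w' = [::] by apply/perm_nilP; rewrite perm_sym.
  by exists false => y _; rewrite mul1r.
have xw' : x \in w' by rewrite -(perm_mem pw) mem_head.
case/splitPr: xw' pw => u v pw.
have /IH[e he] : perm_eq w (u ++ v).
  by rewrite -(perm_cons x) (perm_trans pw) // perm_sym -cat1s perm_catCA.
have [e' he'] := signsym_front x u v.
exists (e' (+) e) => y hy; rewrite he' // signr_addb -mulrA; congr (_ * _).
exact: he (signsym_cons x hy).
Qed.

(** Bring two equal odd letters together and exchange them: y = -y. This is where 2 has to be
    invertible. *)
Lemma signsym_repeat y w x : 2%N \notin [pchar k] ->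
  signsym y -> par x -> (1 < count_mem x w)%N -> y w = 0.
Proof.
move=> c2 hy px cx.
have xw : x \in w by rewrite -has_pred1 has_count (ltn_trans _ cx).
case/splitPr: xw cx => u v cx.
have {cx} xuv : x \in u ++ v.
  by move: cx; rewrite -has_pred1 has_count !count_cat /= eqxx addnCA add1n ltnS.
have [e ->] := signsym_front x u v; last by [].
case/splitPr: xuv => u' v'.
have [e' he'] := signsym_front x u' v'.
rewrite (he' _ (signsym_cons x hy)).
suff -> : y (x :: x :: u' ++ v') = 0 by rewrite !mulr0.
have /eqP := hy [::] x x (u' ++ v'); rewrite px /= mulN1r -subr_eq0 opprK.
rewrite -mulr2n -mulr_natl mulf_eq0 => /orP[/eqP h2|/eqP //].
by case/negP: c2; rewrite inE /= h2 eqxx.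
Qed.

End Words.

(** * Words as scalar multiples of monomials, and the filtration by degree *)

Section Monomials.
Variables (k : fieldType) (I : finType) (par : I -> bool) (N : nat).
Hypothesis N_gt0 : (0 < N)%N.
Local Notation gras := (gras k par N).
Local Notation expo := (expo I N).

Definition gX (m : expo) : gras := [ffun m' => (m' == m)%:R].

Lemma gX_mul (a b : expo) : (forall i, (a i + b i <= N)%N) ->
  gX a * gX b = cocycle k par a b *: gX (eadd a b).
Proof.
move=> h; apply/ffunP => m; rewrite gmulE (bigD1 a) //= [X in _ + X]big1 => [|a' na]; last first.
  by rewrite big1 // => b' _; rewrite ffunE (negPf na) mul0r mulr0.
rewrite addr0 (bigD1 b) //= [X in _ + X]big1 => [|b' nb]; last first.
  by rewrite [X in _ * (_ * X)]ffunE (negPf nb) !mulr0.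
rewrite addr0 !ffunE !eqxx /sc esumP.
have -> : [forall i, (a i + b i <= N)%N] by apply/forallP.
rewrite andbT eq_sym; case: eqP => _; rewrite /GRing.scale /= ?mulr1 ?mul1r ?mulr0 ?mul0r //.
Qed.

Definition delta (x : I) : expo := [ffun i => inord (i == x)].
Definition gz (x : I) : gras := gX (delta x).
Definition cnt (w : seq I) : expo := [ffun i => inord (count_mem i w)].
Definition zw (w : seq I) : gras := \prod_(x <- w) gz x.

Lemma deltaE x i : delta x i = (i == x) :> nat.
Proof. by rewrite ffunE inordK // ltnS; case: (i == x). Qed.

Lemma cntE w i : (size w <= N)%N -> cnt w i = count_mem i w :> nat.
Proof. by move=> sw; rewrite ffunE inordK // ltnS (leq_trans (count_size _ _)). Qed.

Lemma sum_count (w : seq I) : (\sum_i count_mem i w)%N = size w.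
Proof.
elim: w => [|x w IH] /=; first by rewrite big1.
rewrite big_split /= IH (bigD1 x) //= eqxx big1 // => i ni.
by rewrite eq_sym (negPf ni).
Qed.

Lemma edeg_cnt w : (size w <= N)%N -> edeg (cnt w) = size w.
Proof. by move=> sw; rewrite -[RHS]sum_count; apply: eq_bigr => i _; rewrite cntE. Qed.

Lemma cnt_perm w w' : (size w <= N)%N -> (size w' <= N)%N -> cnt w = cnt w' -> perm_eq w w'.
Proof.
move=> sw sw' E; apply/allP => x _ /=; apply/eqP.
by rewrite -(cntE x sw) E cntE.
Qed.

(** The length bound excludes truncation, so the scalar can vanish only through a repeated odd
    letter. *)
Lemma zw_monomial w : (size w <= N)%N -> exists c : k,
  zw w = c *: gX (cnt w) /\
  ((forall x, par x -> count_mem x w <= 1)%N -> c != 0).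
Proof.
elim: w => [|x w IH] sw.
  exists 1; split; last by rewrite oner_eq0.
  rewrite /zw big_nil scale1r; apply/ffunP => m; rewrite !ffunE; congr (_ == _)%:R.
  by apply/ffunP => i; apply/val_inj; rewrite /= cntE ?ffunE.
have [c [E hc]] := IH (ltnW sw); exists (c * cocycle k par (delta x) (cnt w)); split.
  rewrite /zw big_cons -/(zw w) E -scalerAr gX_mul => [|i]; last first.
    rewrite deltaE cntE ?(ltnW sw) // (leq_trans _ sw) //.
    by rewrite /= -add1n leq_add ?leq_b1 ?count_size.
  rewrite scalerA; congr (_ *: gX _); apply/ffunP => i; apply/val_inj.
  rewrite /= cntE // ffunE deltaE cntE ?(ltnW sw) //= inordK // eq_sym // ltnS.
  by rewrite (leq_trans _ sw) //= -add1n leq_add ?leq_b1 ?count_size.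
move=> h; rewrite mulf_neq0 //.
  by apply: hc => y /h /=; apply: leq_trans; apply: leq_addl.
rewrite /cocycle; case: ifP => [/existsP[y /and3P[py]]|]; last by rewrite signr_eq0.
rewrite deltaE cntE ?(ltnW sw) //; have [yx _ cy|//] := eqVneq y x.
by have := h y py; rewrite yx /= eqxx add1n ltnS leqNgt -yx cy.
Qed.

Lemma gX_grade m : ggrade (epar par m) (gX m).
Proof. by move=> m'; rewrite ffunE; case: (m' =P m) => // ->; rewrite eqxx. Qed.

Lemma gz_grade x : ca_gr (grasA k par N) (par x) (gz x).
Proof.
have -> : par x = epar par (delta x); last exact: gX_grade.
rewrite /epar (bigD1 x) //= deltaE eqxx andbT big1 ?addbF // => i ni.
by rewrite deltaE (negPf ni) andbF.
Qed.

Lemma gz_comm a b : gz a * gz b = (-1) ^+ (par a && par b) *: (gz b * gz a).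
Proof.
rewrite (@ca_comm _ (grasA k par N) _ _ _ _ (@gz_grade a) (@gz_grade b)).
by rewrite -[in RHS]mulr_algl scaler_sign; case: (_ && _); rewrite ?mulN1r ?mul1r.
Qed.

Lemma zw_signsym_cat u v m :
  signsym par (fun w => (zw (u ++ w ++ v) : gras) m : k).
Proof.
move=> s a b t; rewrite /zw -!catA !big_cat /= !big_cons.
rewrite (mulrA (gz a)) gz_comm -!scalerAl -!scalerAr -!mulrA ffunE.
by [].
Qed.

Lemma zw_signsym m : signsym par (fun w => (zw w : gras) m : k).
Proof. by move=> u a b v; have := zw_signsym_cat [::] [::] m u a b v; rewrite /= !cats0. Qed.

Lemma edegD (a b m : expo) : esum a b m -> edeg m = (edeg a + edeg b)%N.
Proof.
by move=> /forallP h; rewrite -big_split; apply: eq_bigr => i _; rewrite /= (eqP (h i)).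
Qed.

Lemma edeg_delta x : edeg (delta x) = 1%N.
Proof.
rewrite /edeg (bigD1 x) //= deltaE eqxx big1 // => i ni.
by rewrite deltaE (negPf ni).
Qed.

Lemma gz_mulE x (f : gras) m :
  (gz x * f) m = \sum_b sc k par (delta x) b m * (f b : k).
Proof.
rewrite gmulE (bigD1 (delta x)) //= [X in _ + X]big1 => [|a na].
  rewrite addr0; apply: eq_bigr => b _; congr (_ * _).
  by rewrite ffunE eqxx mul1r.
by rewrite big1 // => b _; rewrite ffunE (negPf na) mul0r mulr0.
Qed.

Lemma top_coef (u : I -> k) w m : (size w <= N)%N -> (size w <= edeg m)%N ->
  (\prod_(x <- w) ((u x)%:A + gz x) : gras) m = (zw w : gras) m.
Proof.
elim: w m => [|x w IH] m sw hm; first by rewrite /zw !big_nil.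
rewrite /zw !big_cons -/(zw w) mulrDl mulr_algl ffunE.
(* Choosing a constant leaves a shorter word; by induction its coefficient at m is that of a
   monomial of smaller degree than m, hence 0. *)
have -> : (u x *: \prod_(j <- w) ((u j)%:A + gz j) : gras) m = 0.
  rewrite ffunE (IH _ (ltnW sw) (ltnW hm)).
  have [c [-> _]] := zw_monomial (ltnW sw); rewrite !ffunE.
  case: eqP => [E|_]; last by rewrite !scaler0.
  by move: hm; rewrite E edeg_cnt ?ltnn ?(ltnW sw).
rewrite add0r !gz_mulE; apply: eq_bigr => b _; rewrite /sc.
case: (boolP (esum (delta x) b m)) => [/edegD E|_]; last by rewrite !mul0r.
by congr (_ * _); apply: IH (ltnW sw) _; move: hm; rewrite E edeg_delta.
Qed.

(** Only terms of degree at least p. [low 1] means without constant term, which is the source of all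
    nilpotency below. *)
Definition low (p : nat) (f : gras) := forall m, (edeg m < p)%N -> f m = 0.

Lemma low_mul p q f g : low p f -> low q g -> low (p + q) (f * g).
Proof.
move=> hf hg m hm; rewrite gmulE big1 // => a _; rewrite big1 // => b _.
rewrite /sc; case: (boolP (esum a b m)) => [/edegD E|]; last by rewrite !mul0r.
have [ap|pa] := ltnP (edeg a) p; first by rewrite hf // mul0r mulr0.
by rewrite hg ?mulr0 // -(ltn_add2l p) (leq_ltn_trans _ hm) // E leq_add2r.
Qed.

Lemma low_sum p (J : finType) (F : J -> gras) : (forall j, low p (F j)) -> low p (\sum_j F j).
Proof.
by move=> h; apply: big_ind => [m _|f g hf hg m hm|j _]; rewrite ?ffunE ?hf ?hg ?addr0 //; apply: h.
Qed.

Lemma low_scale p (c : k) f : low p f -> low p (c *: f).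
Proof. by move=> h m hm; rewrite ffunE h // scaler0. Qed.

Lemma low_gz x : low 1 (gz x).
Proof.
by move=> m; rewrite ffunE; case: eqP => // ->; rewrite edeg_delta.
Qed.

Lemma low_big p f : (#|I| * N < p)%N -> low p f -> f = 0.
Proof.
move=> hp h; apply/ffunP => m; rewrite ffunE h // (leq_ltn_trans _ hp) //.
by rewrite -sum_nat_const; apply: leq_sum => i _; rewrite -ltnS.
Qed.

End Monomials.

(** * A functional that evaluates words in two disjoint alphabets *)

Section TwoAlphabets.
Variables (k : fieldType) (I1 I2 : finType) (par1 : I1 -> bool) (par2 : I2 -> bool).
Variables (d1 d2 : nat) (y1 : seq I1 -> k) (y2 : seq I2 -> k) (u : I1 + I2 -> k).
Hypotheses (char_neq2 : 2%N \notin [pchar k]).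
Hypotheses (y1_sym : signsym par1 y1) (y2_sym : signsym par2 y2).

Definition spar2 (x : I1 + I2) : bool := match x with inl a => par1 a | inr b => par2 b end.
Definition scat (w1 : seq I1) (w2 : seq I2) : seq (I1 + I2) := map inl w1 ++ map inr w2.
(** At least the total length of the two words, so that nothing is truncated, and positive even for
    empty words. *)
Local Notation N := (d1 + d2).+1.
Local Notation gras2 := (gras k spar2 N).
Local Notation zw2 := (@zw k _ spar2 N).

Lemma count_scat_inl x w1 w2 : count_mem (inl x) (scat w1 w2) = count_mem x w1.
Proof.
rewrite count_cat !count_map -[RHS]addn0; congr (_ + _)%N.
by rewrite -(count_pred0 w2); apply: eq_count.
Qed.

Lemma count_scat_inr x w1 w2 : count_mem (inr x) (scat w1 w2) = count_mem x w2.
Proof.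
rewrite count_cat !count_map -[RHS]add0n; congr (_ + _)%N.
by rewrite -(count_pred0 w1); apply: eq_count.
Qed.

Lemma perm_scat w1 w2 w1' w2' : perm_eq (scat w1 w2) (scat w1' w2') ->
  perm_eq w1 w1' /\ perm_eq w2 w2'.
Proof.
move=> /seq.permP h; split; apply/allP => x _ /=; apply/eqP.
  by have := h (pred1 (inl x)); rewrite !count_scat_inl.
by have := h (pred1 (inr x)); rewrite !count_scat_inr.
Qed.

Lemma scat_signsym_l w2 m : signsym par1 (fun w1 => (zw2 (scat w1 w2) : gras2) m : k).
Proof.
move=> s a b t; rewrite /scat !map_cat /= -!catA.
exact: (@zw_signsym k _ spar2 N (ltn0Sn _) m (map inl s) (inl a) (inl b) (map inl t ++ map inr w2)).
Qed.

Lemma scat_signsym_r w1 m : signsym par2 (fun w2 => (zw2 (scat w1 w2) : gras2) m : k).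
Proof.
move=> s a b t; rewrite /scat !map_cat /= !catA.
exact: (@zw_signsym k _ spar2 N (ltn0Sn _) m (map inl w1 ++ map inr s) (inr a) (inr b) (map inr t)).
Qed.

(* A monomial is sent to y1 y2 up to the sign with which some word represents it;
   words with a repeated odd letter, for which that sign is 0, have y1 y2 = 0 since
   2 is invertible. *)
Lemma word_functional : exists mu : gras2 -> k^o, linear mu /\
  forall w1 w2, size w1 = d1 -> size w2 = d2 ->
  mu (\prod_(x <- scat w1 w2) ((u x)%:A + gz k spar2 N x)) = y1 w1 * y2 w2.
Proof.
pose good m (p : d1.-tuple I1 * d2.-tuple I2) :=
  (cnt N (scat p.1 p.2) == m) && ((zw2 (scat p.1 p.2) : gras2) m != 0).
pose yh (m : expo (I1 + I2)%type N) : k := if [pick p | good m p] is Some p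
  then ((zw2 (scat p.1 p.2) : gras2) m : k)^-1 * (y1 p.1 * y2 p.2) else 0.
exists (fun a => \sum_m yh m * ((a : gras2) m : k)); split=> [c f g|w1 w2 s1 s2].
  rewrite scaler_sumr -big_split; apply: eq_bigr => m _ /=.
  by rewrite !ffunE /GRing.scale /= mulrDr mulrCA.
have sN (v1 : seq I1) (v2 : seq I2) : size v1 = d1 -> size v2 = d2 -> (size (scat v1 v2) <= N)%N.
  by move=> h1 h2; rewrite size_cat !size_map h1 h2.
transitivity (\sum_m yh m * ((zw2 (scat w1 w2) : gras2) m : k)).
  apply: eq_bigr => m _; rewrite /yh; case: pickP => [p /andP[/eqP pm _]|_]; last by rewrite !mul0r.
  congr (_ * _); apply: top_coef => //; first exact: sN.
  rewrite -pm edeg_cnt; last by apply: sN; apply: size_tuple.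
  by rewrite !size_cat !size_map s1 s2 (size_tuple p.1) (size_tuple p.2).
have [c [E c0]] := zw_monomial k spar2 (ltn0Sn _) (sN _ _ s1 s2).
rewrite (bigD1 (cnt N (scat w1 w2))) //= big1 => [|m nm]; last first.
  by rewrite E !ffunE (negPf nm) scaler0 mulr0.
rewrite addr0.
have Em : (zw2 (scat w1 w2) : gras2) (cnt N (scat w1 w2)) = c.
  by rewrite E !ffunE eqxx /GRing.scale /= mulr1.
have [c00|c_neq0] := eqVneq c 0.
  rewrite Em c00 mulr0; case: (boolP [exists x, par1 x && (1 < count_mem x w1)%N]).
    by move=> /existsP[x /andP[px cx]]; rewrite (signsym_repeat char_neq2 y1_sym px cx) mul0r.
  move=> /existsPn h1; case: (boolP [exists x, par2 x && (1 < count_mem x w2)%N]).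
    by move=> /existsP[x /andP[px cx]]; rewrite (signsym_repeat char_neq2 y2_sym px cx) mulr0.
  move=> /existsPn h2; suff: c != 0 by rewrite c00 eqxx.
  apply: c0 => -[x|x] /= px.
    by rewrite count_scat_inl; have := h1 x; rewrite px /= -leqNgt.
  by rewrite count_scat_inr; have := h2 x; rewrite px /= -leqNgt.
rewrite /yh; case: pickP => [p /andP[/eqP pm pn]|]; last first.
  have hs1 : size w1 == d1 by apply/eqP.
  have hs2 : size w2 == d2 by apply/eqP.
  by move/(_ (Tuple hs1, Tuple hs2)); rewrite /good /= eqxx Em c_neq0.
(* The chosen words and the given ones have the same monomial, so they are rearrangements of each
   other in each alphabet. The two rearrangement signs occur both in [zw2] and in y1 y2, and
   cancel. *)
have := cnt_perm (sN _ _ s1 s2) (sN _ _ (size_tuple p.1) (size_tuple p.2)) (esym pm).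
move=> /perm_scat[/(signsym_perm k par1)[e1 h1] /(signsym_perm k par2)[e2 h2]].
rewrite (h1 _ y1_sym) (h2 _ y2_sym).
rewrite (h1 _ (@scat_signsym_l p.2 (cnt N (scat w1 w2)))) (h2 _ (@scat_signsym_r w1 (cnt N (scat w1 w2)))) Em.
rewrite !invfM !invr_sign.
have sq (e : bool) : (-1) ^+ e * (-1) ^+ e = 1 :> k by rewrite -signr_addb addbb.
have ac (a b c' v w1' w2' : k) : a * (b * c') * (a * w1' * (b * w2')) * v
   = (a * a) * (b * b) * (c' * v) * (w1' * w2') by ring.
by rewrite ac !sq mulVf // !mul1r.
Qed.

End TwoAlphabets.

(** * Koszul signs *)

Lemma odd_sum (J : finType) (P : pred J) (F : J -> nat) :
  odd (\sum_(j | P j) F j) = \big[addb/false]_(j | P j) odd (F j).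
Proof. exact: (big_morph odd oddD (erefl _)). Qed.

Section BoolForm.
Variable d : nat.
Implicit Types (S Q : 'I_d -> bool) (i j : 'I_d).

(** Mod 2, the number of pairs in which a letter of parity S_l has to cross a later letter of parity
    Q_l'. *)
Definition bform S Q : bool :=
  \big[addb/false]_(p : 'I_d * 'I_d) ((p.1 < p.2)%N && (S p.1 && Q p.2)).

Lemma bformDl S S' Q : bform (fun l => S l (+) S' l) Q = bform S Q (+) bform S' Q.
Proof.
by rewrite -big_split; apply: eq_bigr => p _ /=; rewrite andb_addl andb_addr.
Qed.

Lemma bformDr S Q Q' : bform S (fun l => Q l (+) Q' l) = bform S Q (+) bform S Q'.
Proof.
by rewrite -big_split; apply: eq_bigr => p _ /=; rewrite !andb_addr.
Qed.

Lemma eq_bform S S' Q Q' : S =1 S' -> Q =1 Q' -> bform S Q = bform S' Q'.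
Proof. by move=> h h'; apply: eq_bigr => p _; rewrite h h'. Qed.

Lemma bform_deltal e i Q : bform (fun l => e && (l == i)) Q =
  e && \big[addb/false]_(l < d | (i < l)%N) Q l.
Proof.
rewrite big_distrr /= /bform.
rewrite -(pair_big xpredT xpredT (fun a b : 'I_d => (a < b)%N && ((e && (a == i)) && Q b))) /=.
rewrite (bigD1 i) //= [X in _ (+) X]big1 => [|a ai].
  rewrite addbF [RHS]big_mkcond; apply: eq_bigr => b _ /=.
  by rewrite eqxx andbT; case: ifP.
by rewrite big1 // => b _; rewrite (negPf ai) andbF andbF.
Qed.

Lemma bform_deltar e i S : bform S (fun l => e && (l == i)) =
  e && \big[addb/false]_(l < d | (l < i)%N) S l.
Proof.
rewrite big_distrr /= /bform.
rewrite -(pair_big xpredT xpredT (fun a b : 'I_d => (a < b)%N && (S a && (e && (b == i))))) /=.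
rewrite [RHS]big_mkcond; apply: eq_bigr => a _ /=.
rewrite (bigD1 i) //= [X in _ (+) X]big1 => [|b bi].
  by rewrite addbF eqxx andbT andbC [S a && _]andbC; case: ifP => _; rewrite ?andbT ?andbF.
by rewrite (negPf bi) !andbF.
Qed.

(** Since i and j are neighbours, the transposition reverses the order of the pair (i, j) only. *)
Lemma bform_swap i j S Q : j = i.+1 :> nat ->
  bform (fun l => S (tperm i j l)) (fun l => Q (tperm i j l)) =
  bform S Q (+) (S i && Q j) (+) (S j && Q i).
Proof.
move=> ij; rewrite /bform (reindex_inj (h := fun p : 'I_d * 'I_d => (tperm i j p.1, tperm i j p.2))) /=; last first.
  by move=> [a b] [a' b'] [/perm_inj -> /perm_inj ->].
have pick1 a b : S a && Q b = \big[addb/false]_(p : 'I_d * 'I_d) ((p == (a, b)) && (S p.1 && Q p.2)).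
  rewrite (bigD1 (a, b)) //= eqxx big1 ?addbF // => p np.
  by rewrite (negPf np).
rewrite !pick1 -!big_split; apply: eq_bigr => -[a b] _ /=.
rewrite !tpermK -!andb_addl; congr (_ && _); rewrite !xpair_eqE.
have nij : i != j by rewrite -(inj_eq val_inj) /= ij neq_ltn ltnSn.
case: tpermP => [->|->|/eqP ai /eqP aj]; case: tpermP => [->|->|/eqP bi /eqP bj].
all: rewrite ?eqxx ?(negPf nij) ?[j == i]eq_sym ?(negPf nij) ?(negPf ai) ?(negPf aj) ?(negPf bi) ?(negPf bj) ?andbF ?addbF ?ltnn //=.
- by rewrite ij ltnSn ltnNge leqnSn.
- rewrite ij; move: bi bj; rewrite -!(inj_eq val_inj) /= ij => bi bj.
  by rewrite ltn_neqAle eq_sym bj.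
- by rewrite ij ltnSn ltnNge leqnSn.
- rewrite ij; move: bi bj; rewrite -!(inj_eq val_inj) /= ij => bi bj.
  by rewrite [in RHS]ltn_neqAle [_ == nat_of_ord b]eq_sym bj.
- rewrite ij; move: ai aj; rewrite -!(inj_eq val_inj) /= ij => ai aj.
  by rewrite ltnS [in LHS]leq_eqVlt (negPf ai).
- rewrite ij; move: ai aj; rewrite -!(inj_eq val_inj) /= ij => ai aj.
  by rewrite [in RHS]ltnS [in RHS]leq_eqVlt (negPf ai).
Qed.

(* The sum over l < l' of |S_l| (|T_l'| + |S_l'|): the sign of the matrix unit with row
   parities T and column parities S, as a tensor product of d matrix units. *)
Definition sgform (T S : 'I_d -> bool) : bool := bform S (fun l => T l (+) S l).

(** The three corrections are the signs of the swap on columns, of the swap on rows, and of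
    exchanging two matrix units. Hence [sgn] trades the first two for the third. *)
Lemma sgform_swap i j T S : j = i.+1 :> nat ->
  sgform (fun l => T (tperm i j l)) (fun l => S (tperm i j l)) =
  sgform T S (+) (S i && S j) (+) (T i && T j) (+)
    ((T i (+) S i) && (T j (+) S j)).
Proof.
move=> ij; rewrite /sgform.
rewrite (bform_swap S (fun l => T l (+) S l) ij) /= -!addbA; congr (_ (+) _).
by case: (S i) (S j) (T i) (T j) => [] [] [] [].
Qed.

Lemma sgform_updr i e T S :
  sgform T (fun l => S l (+) (e && (l == i))) =
  sgform T S (+) (e && (\big[addb/false]_(l < d | (i < l)%N) (T l (+) S l)
     (+) \big[addb/false]_(l < d | (l < i)%N) S l)).
Proof.
have E : (fun l => T l (+) (S l (+) (e && (l == i)))) =1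
         (fun l => (T l (+) S l) (+) (e && (l == i))) by move=> l; rewrite addbA.
rewrite /sgform bformDl !(eq_bform (frefl _) E) !bformDr !bform_deltar !bform_deltal.
rewrite big_split /= [X in _ (+) (_ (+) e && X)]big1 => [|l li].
  rewrite andbF addbF !andb_addr -!addbA; do 2 congr (_ (+) _).
  by rewrite addbC -addbA.
by move: li; case: eqP => [->|_]; rewrite ?ltnn ?andbF.
Qed.

Lemma sgform_updl i e T S :
  sgform (fun l => T l (+) (e && (l == i))) S =
  sgform T S (+) (e && \big[addb/false]_(l < d | (l < i)%N) S l).
Proof.
have E : (fun l => (T l (+) (e && (l == i))) (+) S l) =1
         (fun l => (T l (+) S l) (+) (e && (l == i))) by move=> l; rewrite addbAC.
by rewrite /sgform (eq_bform (frefl _) E) bformDr bform_deltar.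
Qed.

(** The [bform] term is the sign of interleaving two tensor products of matrix units; this makes
    [tpmx] multiplicative. *)
Lemma sgform_trans T S U :
  sgform T S (+) sgform S U (+) bform (fun l => S l (+) U l) (fun l => T l (+) S l)
  = sgform T U.
Proof.
rewrite /sgform !bformDl !bformDr.
by case: (bform S T) (bform S S) (bform U S) (bform U U) (bform U T) => [] [] [] [] [].
Qed.

End BoolForm.

Lemma enum_ord_split d (i : 'I_d) : exists A B : seq 'I_d,
  enum 'I_d = A ++ i :: B /\ (i \notin A) && (i \notin B).
Proof.
have : i \in enum 'I_d by rewrite mem_enum.
case/splitPr E: (enum 'I_d) / => [A B]; exists A, B; split=> //.
have := enum_uniq 'I_d; rewrite E cat_uniq /= => /and3P[_ h /andP[-> _]].
by rewrite andbT; move: h; rewrite negb_or => /andP[].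
Qed.

Lemma enum_ord_split2 d (i j : 'I_d) : j = i.+1 :> nat -> exists A B : seq 'I_d,
  [/\ enum 'I_d = A ++ i :: j :: B, size A = i &
      {in A ++ B, forall l, (l != i) && (l != j)}].
Proof.
move=> ij; exists (take i (enum 'I_d)), (drop j.+1 (enum 'I_d)).
have E : enum 'I_d = take i (enum 'I_d) ++ i :: j :: drop j.+1 (enum 'I_d).
  rewrite -{1}(cat_take_drop i (enum 'I_d)); congr (_ ++ _).
  rewrite (drop_nth i) ?size_enum_ord // nth_ord_enum -ij.
  by rewrite (drop_nth i) ?size_enum_ord // nth_ord_enum.
split=> //; first by rewrite size_takel // size_enum_ord ltnW.
move=> l hl; have := enum_uniq 'I_d; rewrite E.
rewrite -[i :: _]/([:: i; j] ++ _) uniq_catCA /= inE negb_or.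
move=> /and3P[/andP[_ hi] hj _].
by apply/andP; split; [apply: contraNneq hi|apply: contraNneq hj] => El; rewrite El in hl.
Qed.

Lemma codom_swap d (T : Type) (i j : 'I_d) (tau : 'I_d -> T) : j = i.+1 :> nat ->
  exists u v, [/\ size u = i, [seq tau l | l <- enum 'I_d] = u ++ tau i :: tau j :: v &
     [seq tau (tperm i j l) | l <- enum 'I_d] = u ++ tau j :: tau i :: v].
Proof.
move=> ij; have [A [B [-> sA hAB]]] := enum_ord_split2 ij.
exists (map tau A), (map tau B); rewrite !map_cat /= tpermL tpermR size_map; split=> //.
have tpid l : l \in A ++ B -> tperm i j l = l.
  by move=> /hAB/andP[li lj]; rewrite tpermD // eq_sym.
congr (_ ++ _ :: _ :: _); apply/eq_in_map => l hl; rewrite tpid //.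
  by rewrite mem_cat hl.
by rewrite mem_cat hl orbT.
Qed.

(** * Entries of linear maps between tensor powers *)

Lemma eq_sgform d (T T' S S' : 'I_d -> bool) : T =1 T' -> S =1 S' -> sgform T S = sgform T' S'.
Proof. by move=> hT hS; apply: eq_bform => // l; rewrite hT hS. Qed.

Lemma mulrACA4 (R : comNzRingType) (a b c e : R) : a * (b * c * e) = b * c * (a * e).
Proof. by ring. Qed.

Section Entries.
Variables (k : fieldType) (d : nat).
Implicit Types U V W : superspace k.

Definition tvec V (x : tpow d V) : {ffun tidx d V -> k^o} := x.

Definition ebas V (s : tidx d V) : tpow d V := [ffun t => (t == s)%:R] : tcar d V.

Lemma tvecP V (x y : tpow d V) : (forall t, tvec x t = tvec y t) -> x = y.
Proof. by move=> h; apply/ffunP. Qed.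

Lemma tvec_is_linear V : linear (@tvec V).
Proof. by []. Qed.
HB.instance Definition _ V := GRing.isLinear.Build k (tpow d V) {ffun tidx d V -> k^o} _
  (@tvec V) (@tvec_is_linear V).

Lemma ebasE V (x : tpow d V) : x = \sum_s (tvec x s : k) *: ebas s.
Proof.
apply: tvecP => t; rewrite linear_sum sum_ffunE (bigD1 t) //= big1 => [|s ns].
  by rewrite addr0 linearZ /= !ffunE eqxx /GRing.scale /= mulr1.
by rewrite linearZ /= !ffunE eq_sym (negPf ns) scaler0.
Qed.

Definition entry V W (f : 'Hom(tpow d V, tpow d W)) (t : tidx d W) (s : tidx d V) : k :=
  tvec (f (ebas s)) t.

Lemma entry_eq V W (f g : 'Hom(tpow d V, tpow d W)) :
  (forall t s, entry f t s = entry g t s) -> f = g.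
Proof.
move=> h; apply/lfunP => x; rewrite (ebasE x) !linear_sum; apply: eq_bigr => s _.
by rewrite !linearZ /=; congr (_ *: _); apply: tvecP => t; apply: h.
Qed.

Lemma entry_linear V W c (f g : 'Hom(tpow d V, tpow d W)) t s :
  entry (c *: f + g) t s = c * entry f t s + entry g t s.
Proof. by rewrite /entry add_lfunE scale_lfunE linearD linearZ !ffunE. Qed.

Lemma entryE V W (f : 'Hom(tpow d V, tpow d W)) x t :
  tvec (f x) t = \sum_s entry f t s * tvec x s.
Proof.
rewrite {1}(ebasE x) !linear_sum sum_ffunE; apply: eq_bigr => s _.
by rewrite !linearZ /= ffunE mulrC.
Qed.

Lemma entry_comp U V W (f : 'Hom(tpow d V, tpow d W)) (g : 'Hom(tpow d U, tpow d V)) t u :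
  entry (f \o g)%VF t u = \sum_s entry f t s * entry g s u.
Proof. by rewrite {1}/entry comp_lfunE entryE. Qed.

Lemma entry1 V t s : entry (\1%VF : 'End(tpow d V)) t s = (t == s)%:R.
Proof. by rewrite /entry id_lfunE ffunE. Qed.

Section MkHom.
Variables (V W : superspace k) (F : tidx d W -> tidx d V -> k).

Definition mkfun (x : tcar d V) : tcar d W := [ffun t => \sum_s F t s * (x s : k)].

Lemma mkfun_is_linear : linear mkfun.
Proof.
move=> c x y; apply/ffunP => t; rewrite !ffunE /GRing.scale /= mulr_sumr -big_split.
by apply: eq_bigr => s _; rewrite !ffunE mulrDr mulrCA.
Qed.
HB.instance Definition _ :=
  GRing.isLinear.Build k (tcar d V) (tcar d W) _ mkfun mkfun_is_linear.

Definition mkhom : 'Hom(tpow d V, tpow d W) := linfun mkfun.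

Lemma entry_mkhom t s : entry mkhom t s = F t s.
Proof.
rewrite /entry lfunE /tvec ffunE (bigD1 s) //= big1 => [|s' ns].
  by rewrite ffunE eqxx mulr1 addr0.
by rewrite ffunE (negPf ns) mulr0.
Qed.
End MkHom.

Definition sgn V W (t : tidx d W) (s : tidx d V) : k :=
  (-1) ^+ sgform (fun l => spar (t l)) (fun l => spar (s l)).

Lemma sgn_sq V W (t : tidx d W) (s : tidx d V) : sgn t s * sgn t s = 1.
Proof. by rewrite /sgn -signr_addb addbb. Qed.

Definition qpar V W (t : tidx d W) (s : tidx d V) (l : 'I_d) : bool :=
  spar (t l) (+) spar (s l).

(** Stated with values in any k-module, so as to apply both to the scalar entries of a map and to
    monomials with values in A. *)
Definition scomm V W (L : lmodType k) (F : tidx d W -> tidx d V -> L) : Prop :=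
  forall i j : 'I_d, j = i.+1 :> nat -> forall t s,
  F (swap_idx i j t) (swap_idx i j s) = (-1) ^+ (qpar t s i && qpar t s j) *: F t s.

Lemma swap_idxK V i j (t : tidx d V) : swap_idx i j (swap_idx i j t) = t.
Proof. by apply/ffunP => l; rewrite !ffunE tpermK. Qed.

Lemma sgn_swap V W (i j : 'I_d) (t : tidx d W) (s : tidx d V) : j = i.+1 :> nat ->
  sgn (swap_idx i j t) (swap_idx i j s) =
  (-1) ^+ (spar (s i) && spar (s j)) * (-1) ^+ (spar (t i) && spar (t j)) *
  (-1) ^+ (qpar t s i && qpar t s j) * sgn t s.
Proof.
move=> ij; rewrite /sgn /qpar -!signr_addb; congr (_ ^+ nat_of_bool _).
have := sgform_swap (fun l => spar (t l)) (fun l => spar (s l)) ij.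
rewrite (@eq_sgform _ _ (fun l => spar (swap_idx i j t l)) _ (fun l => spar (swap_idx i j s l))).
- move=> ->; rewrite [RHS]addbC -!addbA; do 2 congr (_ (+) _).
- by move=> l; rewrite ffunE.
- by move=> l; rewrite ffunE.
Qed.

Lemma swapT_ebas V (i j : 'I_d) (s : tidx d V) :
  swapT V i j (ebas s) = (-1) ^+ (spar (s i) && spar (s j)) *: ebas (swap_idx i j s).
Proof.
apply: tvecP => t; rewrite linearZ lfunE /tvec /= !ffunE /GRing.scale /=.
have -> : (swap_idx i j t == s) = (t == swap_idx i j s).
  by apply/eqP/eqP => [<-|->]; rewrite swap_idxK.
case: eqP => [->|_]; last by rewrite !mulr0.
by rewrite !ffunE tpermL tpermR andbC.
Qed.

(** The row and column signs of [swapT] are absorbed by [sgn]; what remains is the sign for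
    exchanging the two entries at i and j. *)
Lemma swap_comm_entries V W (i j : 'I_d) (f : 'Hom(tpow d V, tpow d W)) : j = i.+1 :> nat ->
  ((f \o swapT V i j)%VF = (swapT W i j \o f)%VF) <->
  forall t s, sgn (swap_idx i j t) (swap_idx i j s) * entry f (swap_idx i j t) (swap_idx i j s)
    = (-1) ^+ (qpar t s i && qpar t s j) * (sgn t s * entry f t s).
Proof.
move=> ij.
have El (t : tidx d _) (s : tidx d _) : entry (f \o swapT V i j)%VF t s =
    (-1) ^+ (spar (s i) && spar (s j)) * entry f t (swap_idx i j s).
  by rewrite /entry comp_lfunE swapT_ebas linearZ linearZ ffunE.
have Er (t : tidx d _) (s : tidx d _) : entry (swapT W i j \o f)%VF t s =
    (-1) ^+ (spar (t i) && spar (t j)) * entry f (swap_idx i j t) s.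
  by rewrite /entry comp_lfunE [X in tvec X]lfunE /tvec ffunE.
have key t s : sgn (swap_idx i j t) (swap_idx i j s) * entry f (swap_idx i j t) (swap_idx i j s)
    = (-1) ^+ (qpar t s i && qpar t s j) * (sgn t s * entry f t s) <->
   entry (f \o swapT V i j)%VF t (swap_idx i j s) = entry (swapT W i j \o f)%VF t (swap_idx i j s).
  rewrite El Er sgn_swap // swap_idxK !ffunE tpermL tpermR [_ && spar (s i)]andbC.
  set a := (-1) ^+ (spar (s i) && _); set b := (-1) ^+ (spar (t i) && _).
  set c := (-1) ^+ (qpar _ _ _ && _).
  have aa : a * a = 1 by rewrite /a -signr_addb addbb.
  have cc : c * c = 1 by rewrite /c -signr_addb addbb.
  have ss := sgn_sq t s; split=> [h|h].
    have := congr1 (fun z => a * c * sgn t s * z) h.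
    have -> : a * c * sgn t s * (a * b * c * sgn t s * entry f (swap_idx i j t) (swap_idx i j s))
      = (a * a) * (c * c) * (sgn t s * sgn t s) * (b * entry f (swap_idx i j t) (swap_idx i j s)) by ring.
    have -> : a * c * sgn t s * (c * (sgn t s * entry f t s)) =
      (c * c) * (sgn t s * sgn t s) * (a * entry f t s) by ring.
    by rewrite aa cc ss !mul1r.
  have -> : a * b * c * sgn t s * entry f (swap_idx i j t) (swap_idx i j s) =
    a * c * sgn t s * (b * entry f (swap_idx i j t) (swap_idx i j s)) by ring.
  rewrite -h; transitivity ((a * a) * (c * (sgn t s * entry f t s))); first by ring.
  by rewrite aa mul1r.
split=> [h t s|h]; first by apply/key; rewrite h.
by apply: entry_eq => t s; rewrite -[s](swap_idxK i j); apply/key/h.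
Qed.

Section Act.
Variable B : superalg k.
Implicit Types X Y : rsmod B.

Definition rmat X (b : B) (u v : 'I_(sdim X)) : k := scoord u (ract X b (sbasis v)).

Lemma rmat_gr X e b (u v : 'I_(sdim X)) : b \in gr B e -> spar u != spar v (+) e -> rmat b u v = 0 :> k.
Proof.
move=> hb huv; apply: scoord_gr; last by rewrite eq_sym; exact: huv.
by have /hgrP := ract_gr X hb; apply; apply: sbasis_gr.
Qed.

(** No sign occurs: for scalar F this says that the slice of F in position i, all other indices
    being fixed, is a matrix commuting with the action of b. *)
Definition acomm X Y (L : lmodType k) (F : tidx d Y -> tidx d X -> L) : Prop :=
  forall e b, b \in gr B e -> forall (i : 'I_d) (t : tidx d Y) (s : tidx d X),
  \sum_u rmat b u (s i) *: F t (upd s i u) = \sum_u rmat b (t i) u *: F (upd t i u) s.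

Lemma upd_spar V (t : tidx d V) i u e : spar u = spar (t i) (+) e ->
  (fun l => spar (upd t i u l)) =1 (fun l => spar (t l) (+) (e && (l == i))).
Proof. by move=> hu l; rewrite ffunE; case: eqP => [->|_]; rewrite ?andbT ?andbF ?addbF. Qed.

Definition sgt V (i : 'I_d) (t : tidx d V) : bool := \big[addb/false]_(l < d | (i < l)%N) spar (t l).
Definition slt V (i : 'I_d) (t : tidx d V) : bool := \big[addb/false]_(l < d | (l < i)%N) spar (t l).

Lemma sgn_updr V W (t : tidx d W) (s : tidx d V) i u e : spar u = spar (s i) (+) e ->
  sgn t (upd s i u) = sgn t s * (-1) ^+ (e && (sgt i t (+) sgt i s (+) slt i s)).
Proof.
move=> hu; rewrite /sgn (eq_sgform (frefl _) (upd_spar hu)) sgform_updr -signr_addb.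
by rewrite big_split.
Qed.

Lemma sgn_updl V W (t : tidx d W) (s : tidx d V) i u e : spar u = spar (t i) (+) e ->
  sgn (upd t i u) s = sgn t s * (-1) ^+ (e && slt i s).
Proof.
by move=> hu; rewrite /sgn (eq_sgform (upd_spar hu) (frefl _)) sgform_updl -signr_addb.
Qed.

Lemma act_sign V (e : bool) (i : 'I_d) (t : tidx d V) :
  (-1) ^+ (e * \sum_(j < d | (i < j)%N) spar (t j))%N = (-1) ^+ (e && sgt i t) :> k.
Proof.
rewrite -signr_odd oddM odd_sum oddb /sgt; congr (_ ^+ (_ && _)).
by apply: eq_bigr => l _; rewrite oddb.
Qed.

Lemma actT_ebas X e (i : 'I_d) b (s : tidx d X) : actT X e i b (ebas s) =
  (-1) ^+ (e && sgt i s) *: \sum_u rmat b u (s i) *: ebas (upd s i u).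
Proof.
apply: tvecP => t; rewrite linearZ lfunE /tvec /= !ffunE sum_ffunE act_sign /GRing.scale /=.
have [ts|nts] := eqVneq (upd t i (s i)) s; last first.
  rewrite big1 ?mulr0 => [|u _]; last first.
    rewrite ffunE; case: eqP => [E|_]; last by rewrite mul0r.
    by case/eqP: nts; have -> : s i = u by rewrite -E ffunE eqxx.
  rewrite big1 ?mulr0 // => u _; rewrite !ffunE; case: eqP => [E|_]; last by rewrite scaler0.
  by case/eqP: nts; apply/ffunP => l; rewrite E !ffunE; case: eqP => [->|].
have -> : sgt i s = sgt i t.
  by rewrite -ts; apply: eq_bigr => l il; rewrite ffunE; case: eqP il => // ->; rewrite ltnn.
congr (_ * _).
rewrite (bigD1 (s i)) //= big1 => [|u nu]; last first.
  rewrite ffunE; case: eqP => [E|_]; last by rewrite mul0r.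
  by case/eqP: nu; rewrite -E ffunE eqxx.
rewrite (bigD1 (t i)) //= [X in _ = _ + X]big1 => [|u nu]; last first.
  rewrite !ffunE; case: eqP => [E|_]; last by rewrite scaler0.
  by case/eqP: nu; rewrite E ffunE eqxx.
rewrite !addr0 !ffunE ts eqxx mul1r.
have -> : (t == upd s i (t i)) = true.
  apply/eqP/ffunP => l; rewrite ffunE; case: eqP => [->//|/eqP li].
  by rewrite -ts ffunE (negPf li).
by rewrite /GRing.scale /= mulr1.
Qed.

(** The position signs of the action cancel against the changes of [sgn]. These are known only for u
    of the parity shifted by e, and [rmat_gr] kills all other u. *)
Lemma act_comm_entries X Y e (i : 'I_d) b (f : 'Hom(tpow d X, tpow d Y)) : b \in gr B e ->
  ((f \o actT X e i b)%VF = (actT Y e i b \o f)%VF) <->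
  forall (t : tidx d Y) (s : tidx d X), \sum_u rmat b u (s i) * (sgn t (upd s i u) * entry f t (upd s i u))
    = \sum_u rmat b (t i) u * (sgn (upd t i u) s * entry f (upd t i u) s).
Proof.
move=> hb.
have El (t : tidx d _) (s : tidx d _) : entry (f \o actT X e i b)%VF t s =
    (-1) ^+ (e && sgt i s) * \sum_u rmat b u (s i) * entry f t (upd s i u).
  rewrite /entry comp_lfunE actT_ebas linearZ linearZ ffunE; congr (_ * _).
  rewrite !linear_sum sum_ffunE; apply: eq_bigr => u _.
  by rewrite !linearZ ffunE.
have Er (t : tidx d _) (s : tidx d _) : entry (actT Y e i b \o f)%VF t s =
    (-1) ^+ (e && sgt i t) * \sum_u rmat b (t i) u * entry f (upd t i u) s.
  rewrite /entry comp_lfunE [X in tvec X]lfunE /tvec ffunE act_sign; congr (_ * _).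
  by apply: eq_bigr => u _; rewrite mulrC.
have key (t : tidx d Y) (s : tidx d X) : \sum_u rmat b u (s i) * (sgn t (upd s i u) * entry f t (upd s i u))
    = \sum_u rmat b (t i) u * (sgn (upd t i u) s * entry f (upd t i u) s) <->
   entry (f \o actT X e i b)%VF t s = entry (actT Y e i b \o f)%VF t s.
  have -> : \sum_u rmat b u (s i) * (sgn t (upd s i u) * entry f t (upd s i u)) =
     sgn t s * (-1) ^+ (e && (sgt i t (+) sgt i s (+) slt i s)) *
     \sum_u rmat b u (s i) * entry f t (upd s i u).
    rewrite mulr_sumr; apply: eq_bigr => u _.
    have [hu|hu] := eqVneq (spar u) (spar (s i) (+) e).
      by rewrite (sgn_updr _ hu); apply: mulrACA4.
    by rewrite (rmat_gr hb hu) !mul0r mulr0.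
  have -> : \sum_u rmat b (t i) u * (sgn (upd t i u) s * entry f (upd t i u) s) =
     sgn t s * (-1) ^+ (e && slt i s) *
     \sum_u rmat b (t i) u * entry f (upd t i u) s.
    rewrite mulr_sumr; apply: eq_bigr => u _.
    have [hu|hu] := eqVneq (spar u) (spar (t i) (+) e).
      by rewrite (sgn_updl _ hu); apply: mulrACA4.
    rewrite (rmat_gr hb) ?mul0r ?mulr0 //; apply: contra_neq hu => ->.
    by rewrite addbK.
  rewrite El Er; move: (\sum_u _) (\sum_u _) => Q P.
  rewrite !andb_addr !signr_addb.
  set x := (-1) ^+ (e && sgt i t); set y := (-1) ^+ (e && sgt i s); set z := (-1) ^+ (e && slt i s).
  have xx : x * x = 1 by rewrite /x -signr_addb addbb.
  have yy : y * y = 1 by rewrite /y -signr_addb addbb.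
  have zz : z * z = 1 by rewrite /z -signr_addb addbb.
  have ss := sgn_sq t s; clearbody x y z; move: (sgn t s) ss => g ss; split=> h.
    transitivity ((x * x) * (z * z) * (g * g) * (y * P)); first by rewrite xx zz ss !mul1r.
    transitivity (x * z * g * (g * (x * y * z) * P)); first by ring.
    rewrite h; transitivity ((z * z) * (g * g) * (x * Q)); first by ring.
    by rewrite zz ss !mul1r.
  transitivity (g * x * z * (y * P)); first by ring.
  rewrite h; transitivity ((x * x) * (g * z * Q)); first by ring.
  by rewrite xx mul1r.
split=> [h t s|h]; first by apply/key; rewrite h.
by apply: entry_eq => t s; apply/key/h.
Qed.

Definition yent X Y (f : 'Hom(tpow d X, tpow d Y)) (t : tidx d Y) (s : tidx d X) : k^o :=
  sgn t s * entry f t s.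

(** So membership in [GHom] is the system of linear relations that monomials in the entries of an
    even B-linear point satisfy. *)
Lemma GHom_yent X Y (f : 'Hom(tpow d X, tpow d Y)) :
  f \in GHom d X Y <-> scomm (yent f) /\ acomm (yent f).
Proof.
split=> [/GHomP[hs ha]|[hs ha]].
  split=> [i j ij|e b hb i]; first exact/(swap_comm_entries f ij)/hs.
  exact/(act_comm_entries i f hb)/ha.
apply/GHomP; split=> [i j ij|e i b hb]; first by apply/(swap_comm_entries f ij)/hs.
by apply/(act_comm_entries i f hb) => t s; exact: (ha e b hb i t s).
Qed.
End Act.
End Entries.

(** * Tensor powers of matrices *)

(** Take an expansion with the fewest vectors: a linear relation would eliminate one of them. This
    replaces a basis of A, which may be infinite dimensional, when relations over A are read off on
    coefficients. *)
Lemma independent_decomposition (k : fieldType) (L : lmodType k) (T : finType) (X : T -> L) :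
  exists R (f : 'I_R -> T -> k) (a : 'I_R -> L),
    (forall t, X t = \sum_r f r t *: a r) /\
    (forall c : 'I_R -> k, \sum_r c r *: a r = 0 -> forall r, c r = 0).
Proof.
pose P R := `[< exists (f : 'I_R -> T -> k) (a : 'I_R -> L), forall t, X t = \sum_r f r t *: a r >].
have exP : exists R, P R.
  exists #|T|; apply/asboolP; exists (fun r t => (r == enum_rank t)%:R), (fun r => X (enum_val r)) => t.
  rewrite (bigD1 (enum_rank t)) //= eqxx scale1r enum_rankK big1 ?addr0 // => r nr.
  by rewrite (negPf nr) scale0r.
case: (ex_minnP exP) => R /asboolP[f [a E]] minR; exists R, f, a; split=> // c c0 r0.
apply/eqP; apply: contraT => cr0; case: R f a E minR c c0 r0 cr0 => [|R] f a E minR c c0 r0 cr0.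
  by case: r0 {cr0}.
have ar0 : a r0 = - \sum_r (c (lift r0 r) / c r0) *: a (lift r0 r).
  apply/eqP; rewrite -addr_eq0 -(inj_eq (scalerI cr0)) scaler0 scalerDr scaler_sumr.
  rewrite -[X in _ == X]c0 [X in _ == X](bigD1_ord r0) //=; apply/eqP; congr (_ + _).
  by apply: eq_bigr => r _; rewrite scalerA mulrCA divff // mulr1.
suff : (R.+1 <= R)%N by rewrite ltnn.
apply: minR; apply/asboolP.
exists (fun r t => f (lift r0 r) t - f r0 t * (c (lift r0 r) / c r0)), (fun r => a (lift r0 r)) => t.
rewrite E (bigD1_ord r0) //= {1}ar0 scalerN scaler_sumr addrC -sumrB.
by apply: eq_bigr => r _; rewrite scalerBl scalerA.
Qed.

Lemma prod_enum (R : nzRingType) (I : finType) (F : I -> R) :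
  \prod_(i <- enum I) F i = \prod_i F i.
Proof. by rewrite big_filter. Qed.

Section CsalgFacts.
Variables (k : fieldType) (A : csalg k).

Lemma signA (e : bool) (x : A) : (-1) ^+ e * x = (-1) ^+ e *: x.
Proof. by case: e; rewrite ?mulN1r ?scaleN1r ?mul1r ?scale1r. Qed.

Lemma ca_commZ e c (x y : A) : ca_gr A e x -> ca_gr A c y ->
  x * y = (-1) ^+ (e && c) *: (y * x).
Proof. by move=> hx hy; rewrite (ca_comm hx hy) signA. Qed.

Lemma ca_grZ e c (x : A) : ca_gr A e x -> ca_gr A e (c *: x).
Proof. by move=> hx; rewrite -[_ *: _]addr0; apply: ca_grP => //; apply: ca_gr0. Qed.

Lemma ca_grD e (x y : A) : ca_gr A e x -> ca_gr A e y -> ca_gr A e (x + y).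
Proof. by move=> hx hy; rewrite -[x]scale1r; apply: ca_grP. Qed.

Lemma ca_prod n (p : 'I_n -> bool) (a : 'I_n -> A) : (forall l, ca_gr A (p l) (a l)) ->
  ca_gr A (\big[addb/false]_l p l) (\prod_l a l).
Proof.
elim: n p a => [|n IH] p a h; first by rewrite !big_ord0; apply: ca_gr1.
by rewrite !big_ord_recl; apply: ca_grM => //; apply: IH.
Qed.

Lemma bform_recl n (S Q : 'I_n.+1 -> bool) : bform S Q =
  (S ord0 && \big[addb/false]_l Q (lift ord0 l)) (+)
  bform (fun l => S (lift ord0 l)) (fun l => Q (lift ord0 l)).
Proof.
rewrite /bform.
rewrite -(pair_big xpredT xpredT (fun a b : 'I_n.+1 => (a < b)%N && (S a && Q b))) /=.
rewrite -(pair_big xpredT xpredT (fun a b : 'I_n => (a < b)%N && (S (lift ord0 a) && Q (lift ord0 b)))) /=.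
rewrite big_ord_recl; congr (_ (+) _).
  by rewrite big_ord_recl /= big_distrr.
by apply: eq_bigr => a _; rewrite big_ord_recl.
Qed.

(** Each b_l has to cross every a_l' with l < l'. *)
Lemma prod_interleave n (p q : 'I_n -> bool) (a b : 'I_n -> A) :
  (forall l, ca_gr A (p l) (a l)) -> (forall l, ca_gr A (q l) (b l)) ->
  \prod_l (a l * b l) = (-1) ^+ bform q p *: (\prod_l a l * \prod_l b l).
Proof.
elim: n p q a b => [|n IH] p q a b ha hb.
  by rewrite !big_ord0 /bform big1 ?mulr1 ?scale1r // => -[[]].
rewrite !big_ord_recl (IH (fun l => p (lift ord0 l)) (fun l => q (lift ord0 l))) //.
set Pa := \prod_l a _; set Pb := \prod_l b _.
have -> : a ord0 * b ord0 * ((-1) ^+ bform (fun l => q (lift ord0 l)) (fun l => p (lift ord0 l)) *: (Pa * Pb))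
    = (-1) ^+ bform (fun l => q (lift ord0 l)) (fun l => p (lift ord0 l)) *: (a ord0 * (b ord0 * Pa) * Pb).
  by rewrite -scalerAr !mulrA.
rewrite (ca_commZ (hb ord0) (ca_prod (fun l => ha (lift ord0 l)))).
rewrite -scalerAr -scalerAl scalerA -signr_addb bform_recl addbC.
by rewrite !mulrA.
Qed.
End CsalgFacts.

Section Xmatrix.
Variables (k : fieldType) (d : nat) (A : csalg k).
Implicit Types U V W : superspace k.

Definition evenmx V W (g : 'M[A]_(sdim W, sdim V)) : Prop :=
  forall i j, ca_gr A (spar i (+) spar j) (g i j).

Definition monomx V W (g : 'M[A]_(sdim W, sdim V)) (t : tidx d W) (s : tidx d V) : A :=
  \prod_(l < d) g (t l) (s l).

(* The sign is that of the k-linear convention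
   (f (x) f')(v (x) w) = (-1)^(|f'||v|) f(v) (x) f'(w), not that of moving the entries
   of g past basis vectors: only the former commutes with actT. *)
Definition tpmx V W (g : 'M[A]_(sdim W, sdim V)) (t : tidx d W) (s : tidx d V) : A :=
  sgn t s *: monomx g t s.

Lemma monomx_codom V W (g : 'M[A]_(sdim W, sdim V)) t s :
  monomx g t s = \prod_(x <- [seq (t l, s l) | l <- enum 'I_d]) g x.1 x.2.
Proof. by rewrite big_map prod_enum. Qed.

Lemma monomx_scomm V W (g : 'M[A]_(sdim W, sdim V)) : evenmx g -> scomm (monomx g).
Proof.
move=> hg i j ij t s; rewrite !monomx_codom.
have [u [v [_ -> E]]] := codom_swap (fun l => (t l, s l)) ij.
have -> : [seq (swap_idx i j t l, swap_idx i j s l) | l <- enum 'I_d] =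
    u ++ (t j, s j) :: (t i, s i) :: v.
  by rewrite -E; apply: eq_map => l; rewrite !ffunE.
rewrite !big_cat !big_cons /= !mulrA -[_ * g (t j) (s j) * _]mulrA.
rewrite (ca_commZ (hg (t j) (s j)) (hg (t i) (s i))) -scalerAr -!scalerAl !mulrA.
by rewrite /qpar andbC.
Qed.

(** P and Q are the products of the factors before and after position i, which no update at i
    touches. *)
Lemma monomx_split V W (g : 'M[A]_(sdim W, sdim V)) i t s : exists P Q : A,
  (forall u, monomx g t (upd s i u) = P * g (t i) u * Q) /\
  (forall u, monomx g (upd t i u) s = P * g u (s i) * Q).
Proof.
have [a [b [E /andP[ia ib]]]] := enum_ord_split i.
exists (\prod_(l <- a) g (t l) (s l)), (\prod_(l <- b) g (t l) (s l)).
have nl (c : seq 'I_d) : i \notin c -> forall l, l \in c -> l == i = false.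
  by move=> ic l lc; apply: contraNF ic => /eqP <-.
split=> u; rewrite /monomx -prod_enum E big_cat big_cons /= !mulrA ffunE eqxx;
  congr (_ * _ * _); apply: eq_big_seq => l hl; by rewrite ffunE (nl _ _ _ hl).
Qed.

Lemma monomx_acomm (B : superalg k) (V W : rsmod B) (g : 'M[A]_(sdim W, sdim V)) :
  (forall b, g *m mxA A (ract V b) = mxA A (ract W b) *m g) -> acomm (monomx g).
Proof.
move=> hg e b _ i t s; have [P [Q [hs ht]]] := monomx_split g i t s.
have gc (x : A) (c : k) : x * in_alg A c = c *: x by rewrite /= mulr_algr.
transitivity (P * (g *m mxA A (ract V b)) (t i) (s i) * Q).
  rewrite mxE mulr_sumr mulr_suml; apply: eq_bigr => u _.
  by rewrite hs !mxE gc -scalerAr -scalerAl.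
rewrite hg mxE mulr_sumr mulr_suml; apply: eq_bigr => u _.
by rewrite ht !mxE /= mulr_algl -scalerAr -scalerAl.
Qed.

Lemma tpmxM U V W (g : 'M[A]_(sdim W, sdim V)) (h : 'M[A]_(sdim V, sdim U)) t u :
  evenmx g -> evenmx h ->
  tpmx (g *m h) t u = \sum_s tpmx g t s * tpmx h s u.
Proof.
move=> hg hh; rewrite /tpmx /monomx; under eq_bigr do rewrite mxE.
rewrite bigA_distr_bigA scaler_sumr; apply: eq_bigr => s _.
rewrite (prod_interleave (fun l => hg (t l) (s l)) (fun l => hh (s l) (u l))).
rewrite -scalerAl -scalerAr !scalerA /sgn -!signr_addb; congr (_ ^+ nat_of_bool _ *: _).
rewrite -(sgform_trans _ (fun l => spar (s l))).
by rewrite addbK.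
Qed.

Lemma tpmx1 V t s : tpmx (1%:M : 'M[A]_(sdim V)) t s = (t == s)%:R.
Proof.
rewrite /tpmx /monomx; case: eqP => [->|/eqP ts].
  rewrite big1 => [|l _]; last by rewrite mxE eqxx.
  rewrite /sgn /sgform /bform big1 ?scale1r // => p _; by rewrite addbb !andbF.
have [l tl] : exists l, t l != s l.
  apply/existsP; apply: contraNT ts; rewrite negb_exists => /forallP h.
  by apply/eqP/ffunP => l; apply/eqP; move: (h l); rewrite negbK.
have [a [b [E _]]] := enum_ord_split l.
by rewrite -prod_enum E big_cat big_cons /= mxE (negPf tl) mul0r mulr0 scaler0.
Qed.

Lemma tpmx_gr V W (g : 'M[A]_(sdim W, sdim V)) t s : evenmx g ->
  ca_gr A (tpar t (+) tpar s) (tpmx g t s).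
Proof.
move=> hg; apply: ca_grZ.
have -> : tpar t (+) tpar s = \big[addb/false]_l (spar (t l) (+) spar (s l)).
  by rewrite /tpar !odd_sum big_split; congr (_ (+) _); apply: eq_bigr => l _; rewrite oddb.
exact: ca_prod.
Qed.

Lemma tpmx_map (A' : csalg k) (u : csmor A A') V W (g : 'M[A]_(sdim W, sdim V)) t s :
  csfun u (tpmx g t s) = sgn t s *: \prod_(l < d) csfun u (g (t l) (s l)).
Proof. by rewrite linearZ /= rmorph_prod. Qed.

(** X(g) lies in GHom tensor A: expand the monomials over independent elements of A; the relations
    [scomm] and [acomm] then hold for each coefficient separately, and [GHom_yent] applies. *)
Lemma tpmx_decomposition (B : superalg k) (V W : rsmod B) (g : 'M[A]_(sdim W, sdim V)) :
  evenmx g -> (forall b, g *m mxA A (ract V b) = mxA A (ract W b) *m g) ->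
  exists R (f : 'I_R -> 'Hom(tpow d V, tpow d W)) (a : 'I_R -> A),
    (forall r, f r \in GHom d V W) /\
    (forall t s, tpmx g t s = \sum_r entry (f r) t s *: a r).
Proof.
move=> g0 gB.
have [R [f [a [E li]]]] := independent_decomposition (fun p : tidx d W * tidx d V => monomx g p.1 p.2).
pose fr r := mkhom (fun t s => sgn t s * f r (t, s)).
have yfr r t s : yent (fr r) t s = f r (t, s).
  by rewrite /yent entry_mkhom mulrA sgn_sq mul1r.
exists R, fr, a; split=> [r|t s]; last first.
  rewrite /tpmx (E (t, s)) scaler_sumr; apply: eq_bigr => r _.
  by rewrite entry_mkhom scalerA.
apply/GHom_yent; split=> [i j ij t s|e b hb i t s]; rewrite ?yfr.
  apply/eqP; rewrite -subr_eq0; apply/eqP.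
  apply: (li (fun r => f r (swap_idx i j t, swap_idx i j s) - (-1) ^+ (qpar t s i && qpar t s j) *: (f r (t, s) : k^o))).
  under eq_bigr do rewrite scalerBl -[X in _ - X]scalerA.
  rewrite sumrB -scaler_sumr -(E (_, _)) -(E (t, s)) /=.
  by rewrite (monomx_scomm g0 ij) subrr.
under eq_bigr do rewrite yfr; under [RHS]eq_bigr do rewrite yfr.
apply/eqP; rewrite -subr_eq0; apply/eqP.
apply: (li (fun r => \sum_u rmat b u (s i) *: (f r (t, upd s i u) : k^o) -
   \sum_u rmat b (t i) u *: (f r (upd t i u, s) : k^o))).
under eq_bigr do rewrite scalerBl !scaler_suml.
rewrite sumrB exchange_big /= [X in _ - X]exchange_big /=.
have h := monomx_acomm gB hb i t s.
under eq_bigr => u _.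
  under eq_bigr do rewrite -scalerA.
  rewrite -scaler_sumr -(E (t, upd s i u)) /=; over.
rewrite h; apply/eqP; rewrite subr_eq0; apply/eqP; apply: eq_bigr => u _.
rewrite (E (upd t i u, s)) /= scaler_sumr; apply: eq_bigr => r0 _.
by rewrite scalerA.
Qed.

End Xmatrix.

(** * Slices and the projection onto B-linear maps *)

Section Slices.
Variables (k : fieldType) (d : nat) (Q : finType) (P : Q -> Q -> k).
Variable F : {ffun 'I_d -> Q} -> k.

Definition fupd (tau : {ffun 'I_d -> Q}) i q : {ffun 'I_d -> Q} :=
  [ffun l => if l == i then q else tau l].

Hypothesis F_slice : forall (tau : {ffun 'I_d -> Q}) i, \sum_q P (tau i) q * F (fupd tau i q) = F tau.

(** The kernel P reproduces F in one slot at a time. The list r of the proof records the slots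
    already treated; the others carry a Kronecker delta. *)
Lemma slices_reproduce (tau : {ffun 'I_d -> Q}) :
  \sum_(tau' : {ffun 'I_d -> Q}) (\prod_l P (tau l) (tau' l)) * F tau' = F tau.
Proof.
suff H (r : seq 'I_d) (ta : {ffun 'I_d -> Q}) : \sum_(tau' : {ffun 'I_d -> Q}) (\prod_l (if l \in r then P (ta l) (tau' l)
      else (ta l == tau' l)%:R)) * F tau' = F ta.
  rewrite -[RHS](H (enum 'I_d)); apply: eq_bigr => tau' _; congr (_ * _).
  by apply: eq_bigr => l _; rewrite mem_enum.
elim: r ta => [|i r IH] ta.
  rewrite (bigD1 ta) //= [X in _ + X]big1 => [|tau' nt].
    by rewrite addr0 big1 ?mul1r // => l _; rewrite eqxx.
  have [l tl] : exists l, ta l != tau' l.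
    apply/existsP; apply: contraNT nt; rewrite negb_exists => /forallP h.
    by apply/eqP/ffunP => l; apply/esym/eqP; move: (h l); rewrite negbK.
  by rewrite (bigD1 l) //= (negPf tl) mul0r mul0r.
have [ir|ir] := boolP (i \in r).
  rewrite -[RHS]IH; apply: eq_bigr => tau' _; congr (_ * _); apply: eq_bigr => l _.
  by rewrite inE; case: eqP => // ->; rewrite ir.
rewrite -[RHS](F_slice _ i).
under [RHS]eq_bigr => q _ do rewrite -IH mulr_sumr.
rewrite exchange_big /=; apply: eq_bigr => tau' _.
under [RHS]eq_bigr do rewrite mulrA.
rewrite -mulr_suml; congr (_ * _).
rewrite (bigD1 i) //= mem_head.
transitivity (P (ta i) (tau' i) * \prod_(l | l != i) (if l \in r then P (ta l) (tau' l)
      else (ta l == tau' l)%:R)).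
  by congr (_ * _); apply: eq_bigr => l li; rewrite inE (negPf li).
rewrite (bigD1 (tau' i)) //= [X in _ + X]big1 ?addr0 => [|q nq].
  rewrite [in RHS](bigD1 i) //= (negPf ir) ffunE !eqxx mul1r; congr (_ * _).
  by apply: eq_bigr => l li; rewrite ffunE (negPf li).
by rewrite (bigD1 i) //= (negPf ir) ffunE eqxx (negPf nq) mul0r mulr0.
Qed.
End Slices.

Section Projector.
Variables (k : fieldType) (B : superalg k) (V W : rsmod B).
Local Notation MM := 'M[k]_(sdim W, sdim V).

Definition bcomm (phi : MM) : Prop :=
  forall b, phi *m lmx (ract V b) = lmx (ract W b) *m phi.

Definition commmx (b : B) (phi : MM) : MM := phi *m lmx (ract V b) - lmx (ract W b) *m phi.

Lemma commmx_is_linear b : linear (commmx b).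
Proof.
move=> c x y; rewrite /commmx mulmxDl mulmxDr -scalemxAl -scalemxAr.
by rewrite scalerBr opprD addrACA.
Qed.
HB.instance Definition _ b := GRing.isLinear.Build k MM MM _ (commmx b) (commmx_is_linear b).

Lemma lmx_ract_linear (X : rsmod B) (c : k) (a b : B) :
  lmx (ract X (c *: a + b)) = c *: lmx (ract X a) + lmx (ract X b).
Proof.
by apply/matrixP => i j; rewrite !mxE ract_lin add_lfunE scale_lfunE scoord_is_linear.
Qed.

Lemma commmx_linear_b c a b phi : commmx (c *: a + b) phi = c *: commmx a phi + commmx b phi.
Proof.
rewrite /commmx !lmx_ract_linear mulmxDl mulmxDr -scalemxAl -scalemxAr.
by rewrite scalerBr opprD addrACA.
Qed.

Definition bcommv : {vspace MM} := (\bigcap_(e : bool) \bigcap_(a < \dim (gr B e))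
  lker (linfun (commmx (vbasis (gr B e))`_a)))%VS.

Lemma bcommvP phi : reflect (bcomm phi) (phi \in bcommv).
Proof.
apply: (iffP idP) => [h b|h]; last first.
  apply/memv_bigcap => e _; apply/memv_bigcap => a _.
  by rewrite memv_ker lfunE /= /commmx h subrr.
have hom e c : c \in gr B e -> commmx c phi = 0.
  move=> /coord_vbasis ->.
  have z : commmx 0 phi = 0.
    by apply: (linear_at0 (f := fun x => commmx x phi)) => x y y'; apply: commmx_linear_b.
  apply: (big_ind (fun c => commmx c phi = 0)) => // [x y hx hy|a _].
    by rewrite -[x]scale1r commmx_linear_b hx hy scaler0 addr0.
  rewrite -[X in commmx X]addr0 commmx_linear_b z addr0.
  have /memv_bigcap/(_ e isT)/memv_bigcap/(_ a isT) := h.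
  by rewrite memv_ker lfunE /= => /eqP ->; rewrite scaler0.
apply/eqP; rewrite -subr_eq0; apply/eqP; rewrite -/(commmx b phi) -(proj_add false b).
by rewrite -[proj _ false _]scale1r commmx_linear_b !(hom _ _ (proj_mem _ _)) scaler0 addr0.
Qed.

Definition mxpart (e : bool) (phi : MM) : MM :=
  \matrix_(i, j) if spar i (+) spar j == e then phi i j else 0.

Lemma mxpart_is_linear e : linear (mxpart e).
Proof.
move=> c x y; apply/matrixP => i j; rewrite !mxE.
by case: ifP; rewrite ?mulr0 ?addr0.
Qed.
HB.instance Definition _ e := GRing.isLinear.Build k MM MM _ (mxpart e) (mxpart_is_linear e).

Lemma mxpart_add phi : mxpart false phi + mxpart true phi = phi.
Proof. by apply/matrixP => i j; rewrite !mxE; case: (_ (+) _); rewrite ?add0r ?addr0. Qed.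

Lemma mxpart_id e phi : mxpart e (mxpart e phi) = mxpart e phi.
Proof. by apply/matrixP => i j; rewrite !mxE; case: (_ == e). Qed.

Lemma mxpart_bcomm e phi : phi \in bcommv -> mxpart e phi \in bcommv.
Proof.
move=> /bcommvP h; apply/memv_bigcap => c _; apply/memv_bigcap => a _.
have hb : (vbasis (gr B c))`_a \in gr B c by apply: vbasis_mem; rewrite mem_nth ?size_tuple.
move: (_`_a) hb => b hb; rewrite memv_ker lfunE /= /commmx subr_eq0; apply/eqP.
transitivity (mxpart (e (+) c) (phi *m lmx (ract V b))); last rewrite h.
  apply/matrixP => i j; rewrite !mxE -[RHS]/(if _ then _ else _).
  rewrite (_ : (if _ then _ else _) = \sum_l (if spar i (+) spar j == e (+) c then phi i l * lmx (ract V b) l j else 0)); last first.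
    by case: ifP => // _; rewrite big1.
  apply: eq_bigr => l _; rewrite !mxE.
  have [lj|lj] := eqVneq (spar l) (spar j (+) c); last first.
    by have z : scoord l (ract V b (sbasis j)) = 0 := rmat_gr hb lj; rewrite z !mulr0 if_same.
  have -> : (spar i (+) spar l == e) = (spar i (+) spar j == e (+) c).
    by rewrite lj; case: (spar i) (spar j) (e) (c) => [] [] [] [].
  by case: ifP; rewrite ?mul0r.
apply/matrixP => i j; rewrite !mxE.
rewrite (_ : (if _ then _ else _) = \sum_l (if spar i (+) spar j == e (+) c then lmx (ract W b) i l * phi l j else 0)); last first.
  by case: ifP => // _; rewrite big1.
apply: eq_bigr => l _; rewrite !mxE.
have [lj|lj] := eqVneq (spar i) (spar l (+) c); last first.
  by have z : scoord i (ract W b (sbasis l)) = 0 := rmat_gr hb lj; rewrite z !mul0r if_same.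
have -> : (spar l (+) spar j == e) = (spar i (+) spar j == e (+) c).
  by rewrite lj; case: (spar l) (spar j) (e) (c) => [] [] [] [].
by case: ifP; rewrite ?mulr0.
Qed.

(** P is the matrix of a parity-preserving projection of all matrices onto those commuting with B.
    Applied to a matrix of free variables it yields a B-linear point, without choosing a basis of
    the B-linear maps. *)
Lemma bcomm_projector : exists P : 'I_(sdim W) * 'I_(sdim V) -> 'I_(sdim W) * 'I_(sdim V) -> k,
  [/\ forall q q', spar q.1 (+) spar q.2 != spar q'.1 (+) spar q'.2 -> P q q' = 0,
      forall q', bcomm (\matrix_(i, j) P (i, j) q')
    & forall phi, bcomm phi -> forall i j, \sum_q P (i, j) q * phi q.1 q.2 = phi i j].
Proof.
(* An arbitrary projection need not respect parity, so it is cut between homogeneous parts;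
   [mxpart_bcomm] keeps the result inside [bcommv]. *)
pose pr (phi : MM) : MM := \sum_(e : bool) mxpart e (projv bcommv (mxpart e phi)).
have pr_lin : linear pr.
  move=> c x y; rewrite scaler_sumr -big_split; apply: eq_bigr => e _ /=.
  by rewrite !linearP.
pose prl := GRing.isLinear.Build k MM MM _ pr pr_lin.
pose PR : {linear MM -> MM} := HB.pack pr prl.
have prE phi : pr phi = PR phi by [].
exists (fun q q' => pr (delta_mx q'.1 q'.2) q.1 q.2); split=> [q q' hq|q'|phi hphi i j].
- rewrite /pr summxE big1 // => e _; rewrite mxE; case: eqP => // he.
  have -> : mxpart e (delta_mx q'.1 q'.2) = 0.
    apply/matrixP => i j; rewrite !mxE; case: eqP => // hij; case: andP => // -[/eqP ei /eqP ej].
    by move: hq; rewrite he -hij ei ej eqxx.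
  by rewrite linear0 mxE.
- have -> : \matrix_(i, j) pr (delta_mx q'.1 q'.2) (i, j).1 (i, j).2 = pr (delta_mx q'.1 q'.2).
    by apply/matrixP => i j; rewrite mxE.
  apply/bcommvP; rewrite /pr; apply: memv_suml => e _.
  by apply: mxpart_bcomm; apply: memv_proj.
have fix_phi : pr phi = phi.
  rewrite /pr -[RHS]mxpart_add addrC big_bool /=; congr (_ + _);
    by rewrite projv_id ?mxpart_id // mxpart_bcomm //; apply/bcommvP.
transitivity (PR phi i j); last by rewrite -prE fix_phi.
have -> : PR phi = \sum_q phi q.1 q.2 *: PR (delta_mx q.1 q.2).
  rewrite [X in PR X](matrix_sum_delta phi) pair_bigA (raddf_sum PR).
  by apply: eq_bigr => q _; exact: (linearZ_LR PR).
by rewrite summxE; apply: eq_bigr => q _; rewrite mxE mulrC.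
Qed.
End Projector.

(** * Generic points *)

Lemma linear_lincomb (k : fieldType) (U V : lmodType k) (f : U -> V) (I : finType)
  (c : I -> k) (x : I -> U) : linear f -> f (\sum_i c i *: x i) = \sum_i c i *: f (x i).
Proof.
move=> lf; apply: (big_rec2 (fun a b => f b = a)); first exact: linear_at0.
by move=> i y1 y2 _ <-; apply: lf.
Qed.

Section YWord.
Variables (k : fieldType) (d : nat) (V W : superspace k).
Local Notation Q := ('I_(sdim W) * 'I_(sdim V))%type.
Implicit Types (tau : {ffun 'I_d -> Q}).

Definition tfst tau : tidx d W := [ffun l => (tau l).1].
Definition tsnd tau : tidx d V := [ffun l => (tau l).2].
Definition tword tau : seq Q := [seq tau l | l <- enum 'I_d].
Definition tpair (t : tidx d W) (s : tidx d V) : {ffun 'I_d -> Q} := [ffun l => (t l, s l)].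
Definition qdeg (q : Q) : bool := spar q.1 (+) spar q.2.

Lemma tfst_pair t s : tfst (tpair t s) = t.
Proof. by apply/ffunP => l; rewrite !ffunE. Qed.

Lemma tsnd_pair t s : tsnd (tpair t s) = s.
Proof. by apply/ffunP => l; rewrite !ffunE. Qed.

Lemma tpairK tau : tpair (tfst tau) (tsnd tau) = tau.
Proof. by apply/ffunP => l; rewrite !ffunE; case: (tau l). Qed.

Lemma tword_inj : injective tword.
Proof. by move=> tau tau' /eq_in_map h; apply/ffunP => l; apply: h; rewrite mem_enum. Qed.

Lemma size_tword tau : size (tword tau) = d.
Proof. by rewrite size_map size_enum_ord. Qed.

(** The sum has at most one term, [tword] being injective: y is carried over to words and extended
    by 0 to words of length other than d. *)
Definition yword (y : tidx d W -> tidx d V -> k^o) (w : seq Q) : k :=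
  \sum_(tau : {ffun 'I_d -> Q} | tword tau == w) y (tfst tau) (tsnd tau).

Lemma yword_tword y tau : yword y (tword tau) = y (tfst tau) (tsnd tau).
Proof.
rewrite /yword (bigD1 tau) //= big1 ?addr0 // => tau' /andP[/eqP/tword_inj ->].
by rewrite eqxx.
Qed.

Lemma yword_signsym y : scomm y -> signsym qdeg (yword y).
Proof.
move=> hy u a b v; have [du|du] := ltnP (size u).+1 d; last first.
  have z (w : seq Q) : size w = (size u + (size v).+2)%N -> yword y w = 0.
    move=> sw; apply: big1 => tau /eqP E.
    by have := size_tword tau; rewrite E sw => D; move: du; rewrite -D !addnS ltnS ltnNge leq_addr.
  by rewrite !z ?mulr0 // size_cat.
pose i := Ordinal (ltnW du); pose j := Ordinal du.
have ij : j = i.+1 :> nat by [].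
pose sw (tau : {ffun 'I_d -> Q}) : {ffun 'I_d -> Q} := [ffun l => tau (tperm i j l)].
have swK : involutive sw by move=> tau; apply/ffunP => l; rewrite !ffunE tpermK.
rewrite /yword [RHS]mulr_sumr (reindex_inj (can_inj swK)) /=.
have Ew tau : exists u' v', [/\ size u' = size u, tword tau = u' ++ tau i :: tau j :: v' &
    tword (sw tau) = u' ++ tau j :: tau i :: v'].
  have [u' [v' [su E E']]] := codom_swap tau ij; exists u', v'; split=> //.
  by rewrite -E'; apply: eq_map => l; rewrite ffunE.
apply: eq_big => tau; have [u' [v' [su E0 E]]] := Ew tau.
  rewrite E0 E !eqseq_cat // !eqseq_cons; congr (_ && _).
  by rewrite andbCA.
rewrite E eqseq_cat // !eqseq_cons => /and4P[_ /eqP <- /eqP <- _].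
have -> : tfst (sw tau) = swap_idx i j (tfst tau) by apply/ffunP => l; rewrite !ffunE.
have -> : tsnd (sw tau) = swap_idx i j (tsnd tau) by apply/ffunP => l; rewrite !ffunE.
rewrite (hy i j ij) /qpar !ffunE andbC.
by [].
Qed.

Lemma tpmx_expand (A : csalg k) (P : Q -> Q -> k) (z : Q -> A) (t : tidx d W) (s : tidx d V) :
  monomx (\matrix_(i, j) \sum_q P (i, j) q *: z q : 'M[A]_(sdim W, sdim V)) t s =
  \sum_(tau : {ffun 'I_d -> Q}) (\prod_l P (t l, s l) (tau l)) *: \prod_(x <- tword tau) z x.
Proof.
rewrite /monomx; under eq_bigr do rewrite mxE.
rewrite bigA_distr_bigA; apply: eq_bigr => tau _.
by rewrite scaler_prod big_map prod_enum.
Qed.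
End YWord.

Section SliceGHom.
Variables (k : fieldType) (d : nat) (B : superalg k) (V W : rsmod B).
Local Notation Q := ('I_(sdim W) * 'I_(sdim V))%type.

(** By [acomm] each slice of f is a B-linear matrix, which P fixes; [slices_reproduce] then treats
    all d slots. *)
Lemma yent_reproduce (P : Q -> Q -> k) (f : 'Hom(tpow d V, tpow d W)) (t : tidx d W) (s : tidx d V) :
  (forall phi : 'M_(sdim W, sdim V), bcomm phi ->
     forall i j, \sum_q P (i, j) q * phi q.1 q.2 = phi i j) ->
  f \in GHom d V W ->
  \sum_(tau : {ffun 'I_d -> Q}) (\prod_l P (t l, s l) (tau l)) * (yent f (tfst tau) (tsnd tau) : k)
    = yent f t s.
Proof.
move=> hP /GHom_yent[_ ha].
have H (tau : {ffun 'I_d -> Q}) (i : 'I_d) : \sum_q P (tau i) q *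
    (yent f (tfst (fupd tau i q)) (tsnd (fupd tau i q)) : k) = yent f (tfst tau) (tsnd tau).
  have E1 q : tfst (fupd tau i q) = upd (tfst tau) i q.1.
    by apply/ffunP => l; rewrite !ffunE; case: eqP.
  have E2 q : tsnd (fupd tau i q) = upd (tsnd tau) i q.2.
    by apply/ffunP => l; rewrite !ffunE; case: eqP.
  have updK (X : superspace k) (x : tidx d X) u v : upd (upd x i u) i v = upd x i v.
    by apply/ffunP => l; rewrite !ffunE; case: eqP.
  have updE (X : superspace k) (x : tidx d X) u : upd x i u i = u by rewrite ffunE eqxx.
  have updI (X : superspace k) (x : tidx d X) : upd x i (x i) = x.
    by apply/ffunP => l; rewrite ffunE; case: eqP => [->|].
  pose phi : 'M[k]_(sdim W, sdim V) :=
    \matrix_(a, b) yent f (upd (tfst tau) i a) (upd (tsnd tau) i b).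
  have hphi : bcomm phi.
    apply/bcommvP/memv_bigcap => e _; apply/memv_bigcap => a _.
    have hb : (vbasis (gr B e))`_a \in gr B e by apply: vbasis_mem; rewrite mem_nth ?size_tuple.
    rewrite memv_ker lfunE /= /commmx subr_eq0; apply/eqP/matrixP => x y; rewrite !mxE.
    have := ha e _ hb i (upd (tfst tau) i x) (upd (tsnd tau) i y); rewrite !updE => h.
    transitivity (\sum_u rmat (vbasis (gr B e))`_a u y *: yent f (upd (tfst tau) i x) (upd (upd (tsnd tau) i y) i u)).
      by apply: eq_bigr => u _; rewrite !mxE updK mulrC.
    by rewrite h; apply: eq_bigr => u _; rewrite !mxE updK.
  transitivity (phi (tau i).1 (tau i).2).
    rewrite -(hP _ hphi); apply: eq_bigr => q _; rewrite E1 E2 mxE.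
    by case: (tau i).
  have t1 : (tau i).1 = tfst tau i by rewrite ffunE.
  have t2 : (tau i).2 = tsnd tau i by rewrite ffunE.
  by rewrite mxE t1 t2 !updI.
have := slices_reproduce (F := fun tau => yent f (tfst tau) (tsnd tau) : k) H (tpair t s).
rewrite tfst_pair tsnd_pair => <-; apply: eq_bigr => tau _; congr (_ * _).
by apply: eq_bigr => l _; rewrite ffunE.
Qed.
End SliceGHom.

Section Generic.
Variables (k : fieldType) (d : nat) (B : superalg k).
Hypothesis char_neq2 : 2%N \notin [pchar k].

Definition bcommA (A : csalg k) (V W : rsmod B) (g : 'M[A]_(sdim W, sdim V)) : Prop :=
  forall b, g *m mxA A (ract V b) = mxA A (ract W b) *m g.

Definition evenk (V W : superspace k) (u : 'M[k]_(sdim W, sdim V)) : Prop :=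
  forall i j, spar i != spar j -> u i j = 0.

Section GenericPoint.
Variables (V W : rsmod B) (u : 'M[k]_(sdim W, sdim V)).
Hypotheses (u0 : evenk u) (uB : bcomm u).
Local Notation Q := ('I_(sdim W) * 'I_(sdim V))%type.
Variable (P : Q -> Q -> k).
Hypothesis P0 : forall q q', spar q.1 (+) spar q.2 != spar q'.1 (+) spar q'.2 -> P q q' = 0.
Hypothesis P1 : forall q', bcomm (\matrix_(i, j) P (i, j) q').
Hypothesis P2 : forall phi : 'M_(sdim W, sdim V), bcomm phi ->
  forall i j, \sum_q P (i, j) q * phi q.1 q.2 = phi i j.
Variables (A : csalg k) (z : Q -> A).
Hypothesis z_gr : forall q, ca_gr A (spar q.1 (+) spar q.2) (z q).

(** The projection of a matrix of independent variables shifted by u. It is B-linear by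
    construction, and its constant part is u because P fixes u. *)
Definition gen_point : 'M[A]_(sdim W, sdim V) :=
  \matrix_(i, j) \sum_q P (i, j) q *: ((u q.1 q.2)%:A + z q).

Lemma gen_point_even : evenmx gen_point.
Proof.
move=> i j; rewrite mxE; apply: ca_sum => q.
have [E|E] := eqVneq (spar i (+) spar j) (spar q.1 (+) spar q.2); last first.
  by rewrite (P0 (q := (i, j)) E) scale0r; apply: ca_gr0.
apply: ca_grZ; rewrite E; apply: ca_grD => //.
have [q12|q12] := eqVneq (spar q.1) (spar q.2).
  by rewrite q12 addbb; apply: ca_grZ; apply: ca_gr1.
by rewrite u0 // scale0r; apply: ca_gr0.
Qed.

Lemma gen_point_bcomm : bcommA gen_point.
Proof.
move=> b; apply/matrixP => i j; rewrite !mxE.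
transitivity (\sum_q (\sum_l P (i, l) q * lmx (ract V b) l j) *: ((u q.1 q.2)%:A + z q)).
  transitivity (\sum_l \sum_q (P (i, l) q * lmx (ract V b) l j) *: ((u q.1 q.2)%:A + z q)).
    apply: eq_bigr => l _; rewrite !mxE mulr_suml; apply: eq_bigr => q _.
    by rewrite /= mulr_algr scalerA mulrC.
  by rewrite exchange_big /=; apply: eq_bigr => q _; rewrite scaler_suml.
transitivity (\sum_l \sum_q (lmx (ract W b) i l * P (l, j) q) *: ((u q.1 q.2)%:A + z q)).
  rewrite exchange_big /=; apply: eq_bigr => q _; rewrite -scaler_suml; congr (_ *: _).
  have /matrixP/(_ i j) := P1 q b; rewrite !mxE => h.
  transitivity (\sum_l (\matrix_(i, j) P (i, j) q) i l * lmx (ract V b) l j).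
    by apply: eq_bigr => l _; rewrite !mxE.
  by rewrite h; apply: eq_bigr => l _; rewrite !mxE.
apply: eq_bigr => l _; rewrite !mxE mulr_sumr; apply: eq_bigr => q _.
by rewrite /= mulr_algl scalerA.
Qed.

Lemma gen_pointE i j : gen_point i j = (u i j)%:A + \sum_q P (i, j) q *: z q.
Proof.
rewrite mxE; under eq_bigr do rewrite scalerDr scalerA.
by rewrite big_split /= -scaler_suml P2.
Qed.
End GenericPoint.

(** Expanded in words, X(g) and X(g') carry the coefficients P; mu replaces the words by the
    normalised entries of f and f', and [yent_reproduce] sums these back to the entries. The
    functional depends on f and f', and the two sets of variables are disjoint. *)
Lemma generic_pair (U V W : rsmod B) (f : 'Hom(tpow d V, tpow d W))
    (f' : 'Hom(tpow d U, tpow d V)) (u : 'M[k]_(sdim W, sdim V)) (u' : 'M[k]_(sdim V, sdim U)) :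
  f \in GHom d V W -> f' \in GHom d U V ->
  evenk u -> bcomm u -> evenk u' -> bcomm u' ->
  exists (I : finType) (par : I -> bool) (N : nat)
    (g : 'M[grasA k par N]_(sdim W, sdim V)) (g' : 'M[grasA k par N]_(sdim V, sdim U))
    (mu : gras k par N -> k^o),
  [/\ linear mu, evenmx g /\ bcommA g, evenmx g' /\ bcommA g',
      (forall i j, low 1 (g i j - (u i j)%:A)) /\ (forall i j, low 1 (g' i j - (u' i j)%:A))
    & forall t s t' s', mu (tpmx g t s * tpmx g' t' s') = entry f t s * entry f' t' s'].
Proof.
move=> hf hf' u0 uB u0' uB'.
have [P [P0 P1 P2]] := bcomm_projector V W.
have [P' [P0' P1' P2']] := bcomm_projector U V.
pose uu (x : ('I_(sdim W) * 'I_(sdim V)) + ('I_(sdim V) * 'I_(sdim U))) : k :=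
  match x with inl q => u q.1 q.2 | inr q => u' q.1 q.2 end.
have /GHom_yent[y1 _] := hf; have /GHom_yent[y2 _] := hf'.
have [mu [mu_lin mu_eq]] := word_functional d d uu char_neq2 (yword_signsym y1) (yword_signsym y2).
pose par := spar2 (@qdeg k V W) (@qdeg k U V); pose N := (d + d).+1.
pose z x : grasA k par N := gz k par N x.
have z_gr x : ca_gr (grasA k par N) (par x) (z x) by apply: gz_grade.
pose g := gen_point u P (fun q => z (inl q)); pose g' := gen_point u' P' (fun q => z (inr q)).
exists _, par, N, g, g', mu; split=> //.
- split; first exact: (gen_point_even u0 P0 (fun q => z_gr (inl q))).
  by apply: gen_point_bcomm.
- split; first exact: (gen_point_even u0' P0' (fun q => z_gr (inr q))).
  by apply: gen_point_bcomm.
- split=> i j.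
    rewrite [g i j](gen_pointE uB P2) addrAC subrr add0r.
    by apply: low_sum => q; apply: low_scale; apply: low_gz.
  rewrite [g' i j](gen_pointE uB' P2') addrAC subrr add0r.
  by apply: low_sum => q; apply: low_scale; apply: low_gz.
move=> t s t' s'; rewrite /tpmx -scalerAl -scalerAr !tpmx_expand.
rewrite mulr_suml.
have E : \sum_(i : {ffun 'I_d -> 'I_(sdim W) * 'I_(sdim V)})
     ((\prod_l P (t l, s l) (i l)) *: \prod_(x <- tword i) ((u x.1 x.2)%:A + z (inl x))) *
     (\sum_(tau : {ffun 'I_d -> 'I_(sdim V) * 'I_(sdim U)}) (\prod_l P' (t' l, s' l) (tau l)) *:
        \prod_(x <- tword tau) ((u' x.1 x.2)%:A + z (inr x)))
   = \sum_(p : {ffun 'I_d -> 'I_(sdim W) * 'I_(sdim V)} * {ffun 'I_d -> 'I_(sdim V) * 'I_(sdim U)})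
      ((\prod_l P (t l, s l) (p.1 l)) * (\prod_l P' (t' l, s' l) (p.2 l))) *:
      \prod_(x <- scat (tword p.1) (tword p.2)) ((uu x)%:A + z x).
  rewrite -(pair_bigA _ (fun (tau : {ffun 'I_d -> 'I_(sdim W) * 'I_(sdim V)}) (tau' : {ffun 'I_d -> 'I_(sdim V) * 'I_(sdim U)}) =>
    ((\prod_l P (t l, s l) (tau l)) * (\prod_l P' (t' l, s' l) (tau' l))) *:
      \prod_(x <- scat (tword tau) (tword tau')) ((uu x)%:A + z x))) /=.
  apply: eq_bigr => tau _; rewrite mulr_sumr; apply: eq_bigr => tau' _.
  by rewrite -scalerAl -scalerAr scalerA /scat big_cat !big_map.
rewrite E scaler_sumr; under eq_bigr do rewrite !scalerA.
rewrite scaler_sumr; under eq_bigr do rewrite !scalerA.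
rewrite linear_lincomb //.
transitivity (\sum_(p : {ffun 'I_d -> 'I_(sdim W) * 'I_(sdim V)} * {ffun 'I_d -> 'I_(sdim V) * 'I_(sdim U)})
   (sgn t s * ((\prod_l P (t l, s l) (p.1 l)) * (yent f (tfst p.1) (tsnd p.1) : k))) *
   (sgn t' s' * ((\prod_l P' (t' l, s' l) (p.2 l)) * (yent f' (tfst p.2) (tsnd p.2) : k)))).
  apply: eq_bigr => p _; rewrite mu_eq ?size_tword // !yword_tword.
  have ac (x y a b c e : k) : (x * (y * (a * b))) * (c * e) = (x * (a * c)) * (y * (b * e)) by ring.
  exact: ac.
rewrite -(pair_bigA _ (fun (tau : {ffun 'I_d -> 'I_(sdim W) * 'I_(sdim V)}) (tau' : {ffun 'I_d -> 'I_(sdim V) * 'I_(sdim U)}) => (sgn t s * ((\prod_l P (t l, s l) (tau l)) * (yent f (tfst tau) (tsnd tau) : k))) *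
   (sgn t' s' * ((\prod_l P' (t' l, s' l) (tau' l)) * (yent f' (tfst tau') (tsnd tau') : k))))) /=.
have Eent (X Y : superspace k) (h : 'Hom(tpow d X, tpow d Y)) (a : tidx d Y) (b : tidx d X) :
    entry h a b = sgn a b * (sgn a b * entry h a b) by rewrite mulrA sgn_sq mul1r.
rewrite [entry f t s]Eent [entry f' t' s']Eent -/(yent f t s) -/(yent f' t' s').
rewrite -(yent_reproduce t s P2 hf) -(yent_reproduce t' s' P2' hf').
rewrite [sgn t s * \sum_(_ | _) _]mulr_sumr [sgn t' s' * \sum_(_ | _) _]mulr_sumr mulr_suml.
by apply: eq_bigr => tau _; rewrite mulr_sumr.
Qed.
End Generic.

(** * Laws and linear maps *)

Section LmxInverse.
Variables (k : fieldType) (M N : superspace k).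

Lemma lmx_is_linear c (f g : 'Hom(M, N)) : lmx (c *: f + g) = c *: lmx f + lmx g.
Proof. by apply/matrixP => i j; rewrite !mxE add_lfunE scale_lfunE scoord_is_linear. Qed.

Lemma lmx_inj : injective (@lmx k M N).
Proof.
move=> f g fg; apply/lfunP => v; rewrite (scoordK v) !linear_sum; apply: eq_bigr => j _.
rewrite !linearZ /=; congr (_ *: _); rewrite (scoordK (f _)) (scoordK (g _)).
by apply: eq_bigr => i _; have /matrixP/(_ i j) := fg; rewrite !mxE => ->.
Qed.

Definition mxhom_fun (m : 'M[k]_(sdim N, sdim M)) (v : M) : N :=
  \sum_i (\sum_j m i j * scoord j v) *: sbasis i.

Lemma mxhom_fun_is_linear m : linear (mxhom_fun m).
Proof.
move=> c u v; rewrite /mxhom_fun scaler_sumr -big_split; apply: eq_bigr => i _ /=.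
rewrite scalerA -scalerDl mulr_sumr -big_split; congr (_ *: _); apply: eq_bigr => j _ /=.
by rewrite scoord_is_linear mulrDr mulrCA.
Qed.
HB.instance Definition _ m := GRing.isLinear.Build k M N _ (mxhom_fun m) (mxhom_fun_is_linear m).

Definition mxhom m : 'Hom(M, N) := linfun (mxhom_fun m).

Lemma mxhomK m : lmx (mxhom m) = m.
Proof.
apply/matrixP => i j; rewrite mxE lfunE /= /mxhom_fun.
rewrite (linear_lincomb _ _ (@scoord_is_linear k N i)).
rewrite (bigD1 i) //= [X in _ + X]big1 => [|i' ni]; last first.
  by rewrite scoord_sbasis eq_sym (negPf ni) scaler0.
rewrite addr0 scoord_sbasis eqxx (bigD1 j) //= [X in _ + X]big1 => [|j' nj].
  by rewrite scoord_sbasis eqxx addr0 /GRing.scale /= !mulr1.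
by rewrite scoord_sbasis (negPf nj) mulr0.
Qed.

Lemma hgr_lmx e (f : 'Hom(M, N)) :
  (forall i j, spar i (+) spar j != e -> lmx f i j = 0) <-> f \in hgr M N e.
Proof.
split=> [h|/hgrP h i j hij]; last first.
  rewrite mxE; apply: scoord_gr (h _ _ (sbasis_gr j)) _.
  by apply: contraNneq hij => <-; rewrite addbAC addbb.
apply/hgrP => c v hv; rewrite (scoordK v) linear_sum; apply: rpred_sum => j _.
have [jc|jc] := eqVneq (spar j) c; last first.
  by rewrite linearZ /= (scoord_gr hv) ?scale0r ?mem0v // eq_sym.
rewrite linearZ /= rpredZ // (scoordK (f _)); apply: rpred_sum => i _.
have [ij|ij] := eqVneq (spar i (+) spar j) e.
  by apply: rpredZ; rewrite -jc -ij addbCA addbb addbF; apply: sbasis_gr.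
by have := h i j ij; rewrite mxE => ->; rewrite scale0r mem0v.
Qed.
End LmxInverse.

(** * Parity and matrix units for maps between tensor powers *)

Section TensorGrading.
Variables (k : fieldType) (d : nat).
Implicit Types V W : superspace k.

Lemma tpow_proj V e (x : tpow d V) t :
  tvec (proj (tpow d V) e x) t = if tpar t == e then tvec x t else 0.
Proof.
case: eqP => [te|/eqP te]; last by have /tpowP := proj_mem e x; apply.
rewrite -[in RHS](proj_add e x) linearD ffunE.
have /tpowP -> := proj_mem (~~ e) x; last by rewrite te; case: (e).
by rewrite addr0.
Qed.

Lemma ebas_gr V (s : tidx d V) : ebas s \in gr (tpow d V) (tpar s).
Proof. by apply/tpowP => t; rewrite ffunE; have [->|//] := eqVneq t s; rewrite eqxx. Qed.

Lemma entry_hpart V W e (f : 'Hom(tpow d V, tpow d W)) t s :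
  entry (hpart e f) t s = if tpar t (+) tpar s == e then entry f t s else 0.
Proof.
rewrite /entry (hpartE _ _ (ebas_gr s)) tpow_proj.
have -> // : (tpar t == tpar s (+) e) = (tpar t (+) tpar s == e).
by case: (tpar t) (tpar s) (e) => [] [] [].
Qed.

Definition edelta V W (p : tidx d W * tidx d V) : 'Hom(tpow d V, tpow d W) :=
  mkhom (fun t s => ((t, s) == p)%:R).

Lemma edeltaE V W (f : 'Hom(tpow d V, tpow d W)) : f = \sum_p entry f p.1 p.2 *: edelta p.
Proof.
have lin (c : tidx d W * tidx d V -> k) (F : tidx d W * tidx d V -> 'Hom(tpow d V, tpow d W)) t s :
    entry (\sum_p c p *: F p) t s = \sum_p c p * entry (F p) t s.
  apply: (big_rec2 (fun a b => entry b t s = a)) => [|p a b _ <-]; last exact: entry_linear.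
  by rewrite /entry zero_lfunE linear0 ffunE.
apply: entry_eq => t s; rewrite lin (bigD1 (t, s)) //= big1 ?addr0 => [|p np].
  by rewrite entry_mkhom eqxx mulr1.
by rewrite entry_mkhom eq_sym (negPf np) mulr0.
Qed.

Lemma entryZ V W c (f : 'Hom(tpow d V, tpow d W)) t s : entry (c *: f) t s = c * entry f t s.
Proof. by rewrite /entry scale_lfunE linearZ ffunE. Qed.

Lemma edelta_comp U V W (t : tidx d W) (s s' : tidx d V) (u : tidx d U) :
  (edelta (t, s) \o edelta (s', u))%VF = (s == s')%:R *: edelta (t, u).
Proof.
apply: entry_eq => a b; rewrite entry_comp entryZ entry_mkhom.
under eq_bigr do rewrite !entry_mkhom !xpair_eqE.
have [<-|ss] := eqVneq s s'; last first.
  rewrite mul0r big1 // => c _; case: (c =P s) => [->|_]; last by rewrite andbF mul0r.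
  by rewrite (negPf ss) mulr0.
rewrite (bigD1 s) //= big1 => [|c cs]; last by rewrite (negPf cs) andbF mul0r.
by rewrite eqxx andbT addr0 mul1r xpair_eqE -natrM mulnb.
Qed.
End TensorGrading.

(** * From linear maps on GHom to laws on points, and back *)

Section Dictionary.
Variables (k : fieldType) (d : nat) (B : superalg k).
Implicit Types (U V W : rsmod B) (M N P : superspace k).

(** Matrix units need not lie in [GHom], so G is first extended to all maps of tensor powers along
    [vsproj]; on [GHom] the extension agrees with G. *)
Definition gcoef V W M N (G : ghom d V W -> 'Hom(M, N)) i j (f : 'Hom(tpow d V, tpow d W)) : k :=
  lmx (G (vsproj (GHom d V W) f)) i j.

Lemma gcoef_linear V W M N (G : ghom d V W -> 'Hom(M, N)) i j c f g : linear G ->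
  gcoef G i j (c *: f + g) = c * gcoef G i j f + gcoef G i j g.
Proof. by move=> lG; rewrite /gcoef linearP lG lmx_is_linear !mxE. Qed.

Lemma gcoef_lincomb V W M N (G : ghom d V W -> 'Hom(M, N)) i j (I : finType) (c : I -> k) F :
  linear G -> gcoef G i j (\sum_x c x *: F x) = \sum_x c x * gcoef G i j (F x).
Proof.
move=> lG; have lin : linear (gcoef G i j : _ -> k^o) by move=> x f g; apply: gcoef_linear.
exact: (linear_lincomb c F lin).
Qed.

Lemma gcoefE V W M N (G : ghom d V W -> 'Hom(M, N)) i j f : linear G ->
  gcoef G i j f = \sum_p entry f p.1 p.2 * gcoef G i j (edelta p).
Proof. by move=> lG; rewrite {1}(edeltaE f) gcoef_lincomb. Qed.

Section Ext.
Variable A : csalg k.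

(* The A-linear extension of G, evaluated at the element of GHom (x) A with entries X. *)
Definition extm V W M N (G : ghom d V W -> 'Hom(M, N))
    (X : tidx d W -> tidx d V -> A) : 'M[A]_(sdim N, sdim M) :=
  \matrix_(i, j) \sum_p gcoef G i j (edelta p) *: X p.1 p.2.

Lemma eq_extm V W M N (G : ghom d V W -> 'Hom(M, N)) X Y :
  (forall t s, X t s = Y t s) -> extm G X = extm G Y.
Proof. by move=> h; apply/matrixP => i j; rewrite !mxE; apply: eq_bigr => p _; rewrite h. Qed.

Lemma extm_lincomb V W M N (G : ghom d V W -> 'Hom(M, N)) (R : finType)
    (f : R -> 'Hom(tpow d V, tpow d W)) (a : R -> A) i j : linear G ->
  extm G (fun t s => \sum_r entry (f r) t s *: a r) i j = \sum_r gcoef G i j (f r) *: a r.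
Proof.
move=> lG; rewrite mxE; under eq_bigr do rewrite scaler_sumr.
rewrite exchange_big /=; apply: eq_bigr => r _; rewrite (gcoefE _ _ (f r) lG) scaler_suml.
by apply: eq_bigr => p _; rewrite scalerA mulrC.
Qed.

Lemma mul_mxA_extm V W M N P (G : ghom d V W -> 'Hom(M, N)) (f : 'Hom(N, P)) X :
  mxA A f *m extm G X = extm (fun x => (f \o G x)%VF) X.
Proof.
apply/matrixP => i j; rewrite !mxE; under eq_bigr do rewrite !mxE mulr_sumr.
rewrite exchange_big /=; apply: eq_bigr => p _.
rewrite /gcoef lmxM mxE scaler_suml; apply: eq_bigr => l _.
by rewrite /= mulr_algl scalerA [lmx f i l]mxE.
Qed.

Lemma mul_extm_mxA V W M N P (G : ghom d V W -> 'Hom(N, P)) (f : 'Hom(M, N)) X :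
  extm G X *m mxA A f = extm (fun x => (G x \o f)%VF) X.
Proof.
apply/matrixP => i j; rewrite !mxE; under eq_bigr do rewrite !mxE mulr_suml.
rewrite exchange_big /=; apply: eq_bigr => p _.
rewrite /gcoef lmxM mxE scaler_suml; apply: eq_bigr => l _.
by rewrite /= mulr_algr scalerA [lmx f l j]mxE mulrC.
Qed.

Lemma extm1 V M (G : ghom d V V -> 'End(M)) : linear G -> G (gid d V) = \1%VF ->
  extm G (tpmx (1%:M : 'M[A]_(sdim V))) = 1%:M.
Proof.
move=> lG G1; rewrite -(mxA1 A M) -G1; apply/matrixP => i j.
rewrite (@eq_extm _ _ _ _ _ _ (fun t s => \sum_(r : 'I_1) entry (\1%VF : 'End(tpow d V)) t s *: (1 : A))).
  rewrite (extm_lincomb (fun=> \1%VF) (fun=> 1)) // big_ord1 !mxE /gcoef.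
  have -> : vsproj (GHom d V V) \1%VF = gid d V.
    by apply: subvs_inj; rewrite vsprojK // GHom1.
  by rewrite mxE.
by move=> t s; rewrite big_ord1 tpmx1 entry1; case: eqP; rewrite ?scale1r ?scale0r.
Qed.

(** The extension of G along [vsproj] is known to be multiplicative on [GHom] only, so X(g) and X(h)
    are first decomposed over elements of [GHom]. *)
Lemma extmM U V W M N P (G1 : ghom d U W -> 'Hom(M, P)) (G2 : ghom d V W -> 'Hom(N, P))
    (G3 : ghom d U V -> 'Hom(M, N)) (g : 'M[A]_(sdim W, sdim V)) (h : 'M[A]_(sdim V, sdim U)) :
  linear G1 -> linear G2 -> linear G3 ->
  (forall x y, G1 (gcomp x y) = (G2 x \o G3 y)%VF) ->
  evenmx g -> bcommA g -> evenmx h -> bcommA h ->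
  extm G1 (tpmx (g *m h)) = extm G2 (tpmx g) *m extm G3 (tpmx h).
Proof.
move=> l1 l2 l3 GM g0 gB h0 hB; have [R [f [a [fG E]]]] := tpmx_decomposition d g0 gB.
have [S [f' [b [fG' E']]]] := tpmx_decomposition d h0 hB.
apply/matrixP => i j; rewrite !mxE.
transitivity (extm G1 (fun t u => \sum_(p : 'I_R * 'I_S) entry (f p.1 \o f' p.2)%VF t u *: (a p.1 * b p.2)) i j).
  rewrite mxE; apply: eq_bigr => -[t u] _ /=; congr (_ *: _).
  rewrite tpmxM //; under [LHS]eq_bigr do rewrite E E' big_distrlr /= pair_bigA.
  rewrite exchange_big /=; apply: eq_bigr => p _; rewrite entry_comp scaler_suml.
  by apply: eq_bigr => s _; rewrite -scalerAl -scalerAr scalerA.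
rewrite extm_lincomb //.
transitivity (\sum_l (\sum_r gcoef G2 i l (f r) *: a r) * (\sum_s gcoef G3 l j (f' s) *: b s)).
  under [RHS]eq_bigr do rewrite big_distrlr /= pair_bigA.
  rewrite exchange_big /=; apply: eq_bigr => p _.
  have -> : gcoef G1 i j (f p.1 \o f' p.2)%VF = \sum_l gcoef G2 i l (f p.1) * gcoef G3 l j (f' p.2).
    rewrite /gcoef.
    have -> : vsproj (GHom d U W) (f p.1 \o f' p.2)%VF =
       gcomp (vsproj (GHom d V W) (f p.1)) (vsproj (GHom d U V) (f' p.2)).
      by apply: subvs_inj; rewrite /= !vsprojK // GHom_comp.
    by rewrite GM lmxM mxE.
  rewrite scaler_suml; apply: eq_bigr => l _.
  by rewrite -scalerAl -scalerAr scalerA.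
apply: eq_bigr => l _.
by rewrite (eq_extm G2 E) (eq_extm G3 E') !extm_lincomb.
Qed.

Lemma extm_even V W M N (G : ghom d V W -> 'Hom(M, N)) (g : 'M[A]_(sdim W, sdim V)) :
  linear G -> (forall e x, x \in gr (ghom d V W) e -> G x \in hgr M N e) ->
  evenmx g -> bcommA g -> evenmx (extm G (tpmx g)).
Proof.
move=> lG G0 g0 gB i j; set e := _ (+) _.
have [R [f [a [fG E]]]] := tpmx_decomposition d g0 gB.
rewrite mxE (bigID (fun p : tidx d W * tidx d V => tpar p.1 (+) tpar p.2 == e)) /=.
(* The matrix units of the wrong parity add up to the extension of G on homogeneous parts of the f
   r. These parts stay in [GHom], where G respects parity, so the entry (i, j) vanishes. *)
rewrite [X in _ + X](_ : _ = 0); last first.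
  transitivity (extm G (fun t s => \sum_r entry (hpart (~~ e) (f r)) t s *: a r) i j).
    rewrite mxE big_mkcond; apply: eq_bigr => p _ /=; rewrite E.
    have -> : (tpar p.1 (+) tpar p.2 != e) = (tpar p.1 (+) tpar p.2 == ~~ e) by case: (_ (+) _) (e) => [] [].
    case: ifP => h; last first.
      by rewrite big1 ?scaler0 // => r _; rewrite entry_hpart h scale0r.
    by congr (_ *: _); apply: eq_bigr => r _; rewrite entry_hpart h.
  rewrite extm_lincomb // big1 // => r _; rewrite /gcoef.
  have hx : vsproj (GHom d V W) (hpart (~~ e) (f r)) \in gr (ghom d V W) (~~ e).
    by rewrite (mem_ggr (~~ e)) vsprojK ?hpart_GHom // hpart_hgr.
  have /hgr_lmx -> := G0 _ _ hx; rewrite ?scale0r //.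
  by rewrite /e; case: (_ (+) _).
rewrite addr0; apply: big_ind => [|x y hx hy|p /eqP <-]; [exact: ca_gr0|exact: ca_grD|].
by apply: ca_grZ; apply: tpmx_gr.
Qed.
End Ext.

Lemma extm_map (A A' : csalg k) (u : csmor A A') V W M N (G : ghom d V W -> 'Hom(M, N))
    (g : 'M[A]_(sdim W, sdim V)) :
  map_mx (csfun u) (extm G (tpmx g)) = extm G (tpmx (map_mx (csfun u) g)).
Proof.
apply/matrixP => i j; rewrite !mxE linear_sum; apply: eq_bigr => p _.
rewrite linearZ /= tpmx_map; congr (_ *: (_ *: _)).
by apply: eq_bigr => l _; rewrite mxE.
Qed.

Lemma polyeval_monomx (A : csalg k) V W r s (c : 'I_r -> 'I_s -> {ffun 'I_d -> 'I_(sdim W) * 'I_(sdim V)} -> k)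
    (g : 'M[A]_(sdim W, sdim V)) i j :
  polyeval c g i j = \sum_(p : tidx d W * tidx d V) c i j (tpair p.1 p.2) *: monomx g p.1 p.2.
Proof.
rewrite mxE (reindex (fun p : tidx d W * tidx d V => tpair p.1 p.2)) /=; last first.
  exists (fun tau => (tfst tau, tsnd tau)) => [[t' s'] _|tau _]; last exact: tpairK.
  by rewrite tfst_pair tsnd_pair.
apply: eq_bigr => p _; congr (_ *: _); apply: eq_bigr => l _.
by rewrite !ffunE.
Qed.

Lemma extm_homogeneous V W M N (G : ghom d V W -> 'Hom(M, N)) :
  exists c : 'I_(sdim N) -> 'I_(sdim M) -> {ffun 'I_d -> 'I_(sdim W) * 'I_(sdim V)} -> k,
    forall (A : csalg k) (g : 'M[A]_(sdim W, sdim V)), extm G (tpmx g) = polyeval c g.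
Proof.
exists (fun i j tau => gcoef G i j (edelta (tfst tau, tsnd tau)) * sgn (tfst tau) (tsnd tau)) => A g.
apply/matrixP => i j; rewrite polyeval_monomx mxE; apply: eq_bigr => p _.
by rewrite tfst_pair tsnd_pair /tpmx scalerA; case: p.
Qed.

Lemma polyeval_extm V W M N
    (c : 'I_(sdim N) -> 'I_(sdim M) -> {ffun 'I_d -> 'I_(sdim W) * 'I_(sdim V)} -> k) :
  exists G : ghom d V W -> 'Hom(M, N), linear G /\
    forall (A : csalg k) (g : 'M[A]_(sdim W, sdim V)), evenmx g -> bcommA g ->
      polyeval c g = extm G (tpmx g).
Proof.
pose G (x : ghom d V W) : 'Hom(M, N) := mxhom (\matrix_(i, j)
  \sum_(p : tidx d W * tidx d V) c i j (tpair p.1 p.2) * (sgn p.1 p.2 * entry (vsval x) p.1 p.2)).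
have lG : linear G.
  move=> x f g; apply: lmx_inj; rewrite lmx_is_linear !mxhomK; apply/matrixP => i j.
  rewrite !mxE mulr_sumr -big_split; apply: eq_bigr => p _ /=; rewrite entry_linear.
  by move: (c _ _ _) (sgn _ _) (entry _ _ _) (entry _ _ _) => a b e h; ring.
exists G; split=> // A g g0 gB; have [R [f [a [fG E]]]] := tpmx_decomposition d g0 gB.
apply/matrixP => i j; rewrite polyeval_monomx.
rewrite (eq_extm G E) extm_lincomb //.
transitivity (\sum_r (\sum_(p : tidx d W * tidx d V) c i j (tpair p.1 p.2) * (sgn p.1 p.2 * entry (f r) p.1 p.2)) *: a r).
  under [RHS]eq_bigr do rewrite scaler_suml.
  rewrite exchange_big /=; apply: eq_bigr => p _.
  under [RHS]eq_bigr do rewrite mulrA -scalerA.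
  rewrite -scaler_sumr -E /tpmx scalerA -mulrA sgn_sq mulr1.
  by [].
apply: eq_bigr => r _; rewrite /gcoef mxhomK mxE; congr (_ *: _); apply: eq_bigr => p _.
by rewrite vsprojK.
Qed.
End Dictionary.

(** * Separation by generic points *)

Lemma comp_lfun_lincomb (k : fieldType) (U V W : vectType k) (I J : finType)
    (a : I -> k) (b : J -> k) (f : I -> 'Hom(V, W)) (g : J -> 'Hom(U, V)) :
  ((\sum_i a i *: f i) \o (\sum_j b j *: g j))%VF =
  \sum_(p : I * J) (a p.1 * b p.2) *: (f p.1 \o g p.2)%VF.
Proof.
apply/lfunP => v; rewrite comp_lfunE !sum_lfunE.
transitivity (\sum_i \sum_j (a i * b j) *: f i (g j v)).
  apply: eq_bigr => i _; rewrite scale_lfunE linear_sum scaler_sumr.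
  by apply: eq_bigr => j _; rewrite scale_lfunE linearZ scalerA.
by rewrite pair_bigA; apply: eq_bigr => p _; rewrite scale_lfunE comp_lfunE.
Qed.

Section Separation.
Variables (k : fieldType) (d : nat) (B : superalg k).
Hypothesis char_neq2 : 2%N \notin [pchar k].
Implicit Types (U V W : rsmod B) (M N P : superspace k).

(* The last condition says that g is congruent to u modulo the variables. *)
Definition generic V W (u : 'M[k]_(sdim W, sdim V)) (I : finType) (par : I -> bool) (n : nat)
    (g : 'M[grasA k par n]_(sdim W, sdim V)) : Prop :=
  [/\ evenmx g, bcommA g & forall i j, low 1 (g i j - (u i j)%:A)].

Lemma pair_separation U V W (u : 'M[k]_(sdim W, sdim V)) (u' : 'M[k]_(sdim V, sdim U))
    (beta : tidx d W * tidx d V -> tidx d V * tidx d U -> k) f f' :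
  evenk u -> bcomm u -> evenk u' -> bcomm u' ->
  f \in GHom d V W -> f' \in GHom d U V ->
  (forall (I : finType) (par : I -> bool) n (g : 'M[grasA k par n]_(sdim W, sdim V))
     (g' : 'M[grasA k par n]_(sdim V, sdim U)), generic u g -> generic u' g' ->
     \sum_p \sum_p' beta p p' *: (tpmx g p.1 p.2 * tpmx g' p'.1 p'.2) = 0) ->
  \sum_p \sum_p' beta p p' * (entry f p.1 p.2 * entry f' p'.1 p'.2) = 0.
Proof.
move=> u0 uB u0' uB' hf hf' h.
have [I [par [n [g [g' [mu [lmu [g0 gB] [g0' gB'] [gu gu'] E]]]]]]] :=
  generic_pair char_neq2 hf hf' u0 uB u0' uB'.
have := congr1 mu (h _ _ _ g g' (And3 g0 gB gu) (And3 g0' gB' gu')).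
rewrite pair_bigA (linear_lincomb _ _ lmu) => {}h; rewrite pair_bigA.
transitivity (mu 0); last exact: (linear_at0 lmu).
by rewrite -h; apply: eq_bigr => p _; rewrite E.
Qed.

(** The case of a pair whose second member is the identity of the tensor power of V, read at one
    diagonal entry, where it is 1. If there is no column index at all, the sum is empty. *)
Lemma single_separation V W (u : 'M[k]_(sdim W, sdim V)) (gamma : tidx d W * tidx d V -> k) f :
  evenk u -> bcomm u -> f \in GHom d V W ->
  (forall (I : finType) (par : I -> bool) n (g : 'M[grasA k par n]_(sdim W, sdim V)),
     generic u g -> \sum_p gamma p *: tpmx g p.1 p.2 = 0) ->
  \sum_p gamma p * entry f p.1 p.2 = 0.
Proof.
move=> u0 uB hf h.
case: (pickP (fun _ : tidx d V => true)) => [s0 _|no]; last first.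
  by rewrite big1 // => -[t s]; have := no s.
have z0 : evenk (0 : 'M[k]_(sdim V)) by move=> i j _; rewrite mxE.
have zB : bcomm (0 : 'M[k]_(sdim V)) by move=> b; rewrite mul0mx mulmx0.
have := @pair_separation V V W u 0 (fun p p' => gamma p * (p' == (s0, s0))%:R) f \1%VF
  u0 uB z0 zB hf (GHom1 d V).
have col (R : lmodType k) (F : tidx d V * tidx d V -> R) (c : k) :
    \sum_p' (c * (p' == (s0, s0))%:R) *: F p' = c *: F (s0, s0).
  rewrite (bigD1 (s0, s0)) //= eqxx mulr1 big1 ?addr0 // => p np.
  by rewrite (negPf np) mulr0 scale0r.
move=> H; rewrite -[RHS]H => [|I par n g g' hg hg'].
  apply: eq_bigr => p _.
  have := col k^o (fun p' => entry f p.1 p.2 * entry (\1%VF : 'End(tpow d V)) p'.1 p'.2) (gamma p).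
  by rewrite /GRing.scale /= => ->; rewrite entry1 eqxx mulr1.
under eq_bigr do rewrite col.
under eq_bigr do rewrite scalerAl.
by rewrite -mulr_suml h // mul0r.
Qed.

Lemma extm_injective V W M N (u : 'M[k]_(sdim W, sdim V)) (G G' : ghom d V W -> 'Hom(M, N)) :
  evenk u -> bcomm u -> linear G -> linear G' ->
  (forall (I : finType) (par : I -> bool) n (g : 'M[grasA k par n]_(sdim W, sdim V)),
     generic u g -> extm G (tpmx g) = extm G' (tpmx g)) ->
  forall x, G x = G' x.
Proof.
move=> u0 uB lG lG' h x; apply: lmx_inj; apply/matrixP => i j; apply/eqP.
have Ex : x = vsproj (GHom d V W) (vsval x) by rewrite vsvalK.
rewrite Ex -/(gcoef G i j (vsval x)) -/(gcoef G' i j (vsval x)) -subr_eq0.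
rewrite !(gcoefE i j (vsval x)) // -sumrB.
have := @single_separation V W u (fun p => gcoef G i j (edelta p) - gcoef G' i j (edelta p))
  (vsval x) u0 uB (subvsP x).
move=> H; rewrite -[X in _ == X]H => [|I par n g hg].
  by apply/eqP; apply: eq_bigr => p _; rewrite mulrBl ![_ * entry _ _ _]mulrC.
have /matrixP/(_ i j) := h _ _ _ g hg; rewrite !mxE => hij.
by under eq_bigr do rewrite scalerBl; rewrite sumrB hij subrr.
Qed.

Lemma extm_multiplicative U V W M N P (u : 'M[k]_(sdim W, sdim V)) (u' : 'M[k]_(sdim V, sdim U))
    (G1 : ghom d U W -> 'Hom(M, P)) (G2 : ghom d V W -> 'Hom(N, P)) (G3 : ghom d U V -> 'Hom(M, N)) :
  evenk u -> bcomm u -> evenk u' -> bcomm u' -> linear G1 -> linear G2 -> linear G3 ->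
  (forall (I : finType) (par : I -> bool) n (g : 'M[grasA k par n]_(sdim W, sdim V))
     (g' : 'M[grasA k par n]_(sdim V, sdim U)), generic u g -> generic u' g' ->
     extm G1 (tpmx (g *m g')) = extm G2 (tpmx g) *m extm G3 (tpmx g')) ->
  forall x y, G1 (gcomp x y) = (G2 x \o G3 y)%VF.
Proof.
move=> u0 uB u0' uB' l1 l2 l3 h x y; apply: lmx_inj; apply/matrixP => i j; apply/eqP.
have E1 : lmx (G1 (gcomp x y)) i j =
    \sum_p \sum_p' gcoef G1 i j (edelta p \o edelta p')%VF *
       (entry (vsval x) p.1 p.2 * entry (vsval y) p'.1 p'.2).
  have -> : gcomp x y = vsproj (GHom d U W) (vsval x \o vsval y)%VF.
    by apply: subvs_inj; rewrite vsprojK // GHom_comp // subvsP.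
  rewrite -/(gcoef G1 i j _) [X in (X \o _)%VF](edeltaE (vsval x)) [X in (_ \o X)%VF](edeltaE (vsval y)).
  rewrite comp_lfun_lincomb gcoef_lincomb // pair_bigA.
  by apply: eq_bigr => q _; rewrite mulrC.
have E2 : lmx (G2 x \o G3 y)%VF i j =
    \sum_p \sum_p' (\sum_l gcoef G2 i l (edelta p) * gcoef G3 l j (edelta p')) *
       (entry (vsval x) p.1 p.2 * entry (vsval y) p'.1 p'.2).
  rewrite lmxM mxE.
  transitivity (\sum_l (\sum_p entry (vsval x) p.1 p.2 * gcoef G2 i l (edelta p)) *
     (\sum_p entry (vsval y) p.1 p.2 * gcoef G3 l j (edelta p))).
    by apply: eq_bigr => l _; rewrite -!gcoefE // /gcoef !vsvalK.
  under eq_bigr do rewrite big_distrlr /= pair_bigA.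
  rewrite exchange_big [RHS]pair_bigA /=; apply: eq_bigr => q _; rewrite mulr_suml.
  by apply: eq_bigr => l _; rewrite mulrACA mulrC.
rewrite E1 E2 -subr_eq0 -sumrB; apply/eqP.
under eq_bigr do rewrite -sumrB.
have := @pair_separation U V W u u' (fun p p' => gcoef G1 i j (edelta p \o edelta p')%VF -
   \sum_l gcoef G2 i l (edelta p) * gcoef G3 l j (edelta p')) (vsval x) (vsval y)
   u0 uB u0' uB' (subvsP x) (subvsP y).
move=> H; rewrite -[RHS]H => [|I par n g g' hg hg'].
  by apply: eq_bigr => p _; apply: eq_bigr => p' _; rewrite mulrBl.
have [g0 gB _] := hg; have [g0' gB' _] := hg'.
under eq_bigr do under eq_bigr do rewrite scalerBl.
under eq_bigr do rewrite sumrB.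
rewrite sumrB; apply/eqP; rewrite subr_eq0; apply/eqP.
have /matrixP/(_ i j) := h _ _ _ g g' hg hg'; rewrite !mxE => hij.
transitivity (\sum_p gcoef G1 i j (edelta p) *: tpmx (g *m g') p.1 p.2).
  (* The matrix units (t, s) and (s', w) compose to 0 unless s = s', so the fourfold sum reduces to
     the entries of X(g g'). *)
  transitivity (\sum_(t : tidx d W) \sum_(s : tidx d V) \sum_(s' : tidx d V) \sum_(w : tidx d U)
     gcoef G1 i j (edelta (t, s) \o edelta (s', w))%VF *: (tpmx g t s * tpmx g' s' w)).
    rewrite [RHS]pair_bigA /=; apply: eq_bigr => -[t s] _ /=.
    by rewrite [RHS]pair_bigA; apply: eq_bigr => -[s' w] _.
  transitivity (\sum_(t : tidx d W) \sum_(w : tidx d U) gcoef G1 i j (edelta (t, w)) *: tpmx (g *m g') t w).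
    apply: eq_bigr => t _.
    transitivity (\sum_(s : tidx d V) \sum_(w : tidx d U) gcoef G1 i j (edelta (t, w)) *: (tpmx g t s * tpmx g' s w)).
      apply: eq_bigr => s _; rewrite (bigD1 s) //= [X in _ + X]big1 ?addr0 => [|s' ns].
        by apply: eq_bigr => w _; rewrite edelta_comp eqxx scale1r.
      rewrite big1 // => w _; rewrite edelta_comp eq_sym (negPf ns) scale0r.
      have gz : gcoef G1 i j 0 = 0.
        have lin : linear (gcoef G1 i j : _ -> k^o) by move=> c a b; exact (gcoef_linear i j c a b l1).
        exact: (linear_at0 lin).
      by rewrite gz scale0r.
    rewrite exchange_big /=; apply: eq_bigr => w _.
    by rewrite tpmxM // scaler_sumr.
  by rewrite pair_bigA; apply: eq_bigr => -[t w] _.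
rewrite hij; under eq_bigr do rewrite !mxE big_distrlr /= pair_bigA.
rewrite exchange_big [RHS]pair_bigA /=; apply: eq_bigr => q _; rewrite scaler_suml.
by apply: eq_bigr => l _; rewrite -scalerAl -scalerAr scalerA.
Qed.

(** X(1) is the identity with entries in k, and k embeds in A because 1 is nonzero there. *)
Lemma extm_unital V M (G : ghom d V V -> 'End(M)) (A : csalg k) : linear G ->
  extm G (tpmx (1%:M : 'M[A]_(sdim V))) = 1%:M -> G (gid d V) = \1%VF.
Proof.
move=> lG h; apply: lmx_inj; rewrite lmx1; apply/matrixP => i j.
have /matrixP/(_ i j) := h.
rewrite (@eq_extm _ _ _ _ _ _ _ _ _ _ (fun t s => \sum_(r : 'I_1) entry (\1%VF : 'End(tpow d V)) t s *: (1 : A))); last first.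
  by move=> t s; rewrite big_ord1 tpmx1 entry1; case: eqP; rewrite ?scale1r ?scale0r.
rewrite (extm_lincomb (fun=> \1%VF) (fun=> 1)) // big_ord1 !mxE /gcoef.
have -> : vsproj (GHom d V V) \1%VF = gid d V by apply: subvs_inj; rewrite vsprojK // GHom1.
have -> : (i == j)%:R = (i == j)%:R *: 1 :> A by rewrite scaler_nat.
move=> /eqP; rewrite -subr_eq0 -scalerBl scaler_eq0 oner_eq0 orbF subr_eq0 mxE => /eqP.
by [].
Qed.

(** The terms of the wrong parity in an entry of [extm G (tpmx g)] sum to an element of both
    parities, hence to 0; separation turns this into a statement about x. *)
Lemma extm_even_converse V W M N (u : 'M[k]_(sdim W, sdim V)) (G : ghom d V W -> 'Hom(M, N)) :
  evenk u -> bcomm u -> linear G ->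
  (forall (I : finType) (par : I -> bool) n (g : 'M[grasA k par n]_(sdim W, sdim V)),
     generic u g -> evenmx (extm G (tpmx g))) ->
  forall e x, x \in gr (ghom d V W) e -> G x \in hgr M N e.
Proof.
move=> u0 uB lG h e x hx; apply/hgr_lmx => i j ij.
have Ex : x = vsproj (GHom d V W) (vsval x) by rewrite vsvalK.
rewrite Ex -/(gcoef G i j (vsval x)) gcoefE //.
pose c := spar i (+) spar j.
have := @single_separation V W u (fun p => if tpar p.1 (+) tpar p.2 == c then 0 else gcoef G i j (edelta p))
  (vsval x) u0 uB (subvsP x).
move=> H; rewrite -[RHS]H => [|I par n g hg].
  apply: eq_bigr => p _; case: eqP => [pc|_]; last by rewrite mulrC.
  have xe : vsval x \in hgr (tpow d V) (tpow d W) e by rewrite -(mem_ggr e).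
  by rewrite -(hpart_id xe) entry_hpart pc (negPf ij) !mul0r.
have [g0 gB _] := hg.
set x0 := \sum_p _.
have hc : ca_gr (grasA k par n) c x0.
  have -> : x0 = extm G (tpmx g) i j -
      \sum_p (if tpar p.1 (+) tpar p.2 == c then gcoef G i j (edelta p) else 0) *: tpmx g p.1 p.2.
    rewrite mxE -sumrB; apply: eq_bigr => p _; rewrite -scalerBl.
    by case: ifP; rewrite ?subrr ?subr0.
  apply: ca_grD; first exact: (h _ _ _ _ hg).
  rewrite -scaleN1r; apply/ca_grZ/ca_sum => p.
  case: eqP => [<-|_]; last by rewrite scale0r; apply: ca_gr0.
  by apply/ca_grZ/tpmx_gr.
have hn : ca_gr (grasA k par n) (~~ c) x0.
  apply: ca_sum => p; case: eqP => [_|/eqP pc]; first by rewrite scale0r; apply: ca_gr0.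
  have -> : ~~ c = tpar p.1 (+) tpar p.2 by move: pc; case: (_ (+) _) (c) => [] [].
  by apply/ca_grZ/tpmx_gr.
by case: (c) hc hn => hc hn; apply: (@ca_cap _ (grasA k par n)).
Qed.
End Separation.

(** * Polynomial functors *)

Lemma equivalent_sym (C D : category) : equivalent C D -> equivalent D C.
Proof. by case=> F [G [h1 h2]]; exists G, F. Qed.

Section Sides.
Variables (k : fieldType) (B : superalg k).
Hypothesis sa_mulC : forall a b : B, sa_mul a b = sa_mul b a.

(* The matrix of an even B (x) A-linear map commutes with that of the action of b
   without any sign, like a morphism of right supermodules.  So the two sides are
   matched by letting b act by the same operator, not by v b = (-1)^(|v||b|) b v. *)
Lemma lmod_of_subproof (V : rsmod B) a b : ract V (sa_mul a b) = (ract V a \o ract V b)%VF.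
Proof. by rewrite sa_mulC ractM. Qed.

Lemma rmod_of_subproof (V : lsmod B) a b : lact V (sa_mul a b) = (lact V b \o lact V a)%VF.
Proof. by rewrite sa_mulC lactM. Qed.

Definition lmod_of (V : rsmod B) : lsmod B :=
  LSMod (ract_lin V) (ract1 V) (lmod_of_subproof V) (@ract_gr k B V).

Definition rmod_of (V : lsmod B) : rsmod B :=
  RSMod (lact_lin V) (lact1 V) (rmod_of_subproof V) (@lact_gr k B V).

Lemma lsmod_eq (U : superspace k) (a b : B -> 'End(U)) a1 a2 a3 a4 b1 b2 b3 b4 : a = b ->
  @LSMod k B U a a1 a2 a3 a4 = @LSMod k B U b b1 b2 b3 b4.
Proof.
move=> E; move: a1 a2 a3 a4; rewrite E => a1 a2 a3 a4.
by congr LSMod; apply: Prop_irrelevance.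
Qed.

Lemma rsmod_eq (U : superspace k) (a b : B -> 'End(U)) a1 a2 a3 a4 b1 b2 b3 b4 : a = b ->
  @RSMod k B U a a1 a2 a3 a4 = @RSMod k B U b b1 b2 b3 b4.
Proof.
move=> E; move: a1 a2 a3 a4; rewrite E => a1 a2 a3 a4.
by congr RSMod; apply: Prop_irrelevance.
Qed.

Lemma lmod_ofK V : lmod_of (rmod_of V) = V.
Proof. by case: V => *; apply: lsmod_eq. Qed.

Lemma rmod_ofK V : rmod_of (lmod_of V) = V.
Proof. by case: V => *; apply: rsmod_eq. Qed.

(** Scalars of k are central in A, so every matrix meets the linearity condition of [is_point]
    between trivial supermodules. *)
Lemma mxA_kact (A : csalg k) (M N : superspace k) (g : 'M[A]_(sdim N, sdim M)) b :
  g *m mxA A (lact (klmod M) b) = mxA A (lact (klmod N) b) *m g.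
Proof.
have E (P : superspace k) : mxA A (lact (klmod P) b) = ((b : k)%:A)%:M.
  apply/matrixP => i j; rewrite !mxE scale_lfunE id_lfunE.
  have := @scoord_is_linear k P i (b : k) (sbasis j) 0; rewrite !addr0 => ->.
  have -> : scoord i (0 : P)  = 0 := linear_at0 (@scoord_is_linear k P i).
  rewrite addr0 scoord_sbasis; case: eqP => _.
    by rewrite mulr1n; congr (_ *: _); apply: mulr1.
  by rewrite mulr0n; transitivity ((0 : k)%:A : A); [congr (_ *: _); apply: mulr0|apply: scale0r].
rewrite !E; apply/matrixP => i j; rewrite mul_scalar_mx !mxE mulr_algl.
rewrite (bigD1 j) //= big1 => [|l lj]; last by rewrite mxE (negPf lj) mulr0.
by rewrite mxE eqxx addr0 mulr_algr.
Qed.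

Section Functor.
Variable d : nat.
Hypothesis char_neq2 : 2%N \notin [pchar k].

Section Object.
Variable T : polfun d B.

Lemma ext_is_point (A : csalg k) (V W : lsmod B) (g : point A V W) :
  is_point (V := klmod (pf_ob T (rmod_of V))) (W := klmod (pf_ob T (rmod_of W)))
    (extm (@pf_mor k d B T (rmod_of V) (rmod_of W)) (tpmx (sval g))).
Proof.
case: g => g [g0 gB]; split=> [|b] /=; last exact: mxA_kact.
by apply: extm_even => //; [exact: pf_lin | exact: pf_even].
Qed.

Definition ext_point (A : csalg k) (V W : lsmod B) (g : point A V W) :
  point A (klmod (pf_ob T (rmod_of V))) (klmod (pf_ob T (rmod_of W))) :=
  exist _ _ (ext_is_point g).

Lemma ext_point_nat (V W : lsmod B) (A A' : csalg k) (u : @hom (salg k) A A') :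
  @cmp typeCat _ _ _ (@ext_point A' V W) (fmor (Hom_a V W) u) =
  @cmp typeCat _ _ _ (fmor (Hom_a (klmod (pf_ob T (rmod_of V))) (klmod (pf_ob T (rmod_of W)))) u)
    (@ext_point A V W).
Proof.
apply: functional_extensionality_dep => g; apply: sval_eq; rewrite /=.
by rewrite (extm_map u (V := rmod_of V) (W := rmod_of W)).
Qed.

Definition ssch_of : sschfun B.
Proof.
refine (@SschFun k B (fun V => pf_ob T (rmod_of V))
  (fun V W => @NatTrans _ _ (Hom_a V W) (Hom_a (klmod (pf_ob T (rmod_of V))) (klmod (pf_ob T (rmod_of W))))
     (fun A => @ext_point A V W) (@ext_point_nat V W)) _ _).
- move=> V A; apply: sval_eq; rewrite /=; apply: extm1; [exact: pf_lin|exact: pf_id].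
move=> U V W A [g [g0 gB]] [h [h0 hB]]; apply: sval_eq; rewrite /=.
by apply: (extmM (V := rmod_of V)); rewrite ?pf_lin //; [exact: pf_lin..|exact: pf_comp].
Defined.

Lemma ssch_of_homogeneous V W :
  @homogeneous k d _ _ _ _ (fun A => point A V W) (fun A g => sval g)
    (fun A g => sf_mx ssch_of g).
Proof.
have [c hc] := extm_homogeneous (@pf_mor k d B T (rmod_of V) (rmod_of W)).
by exists c => A g; apply: hc.
Qed.
End Object.

Lemma ssch_of_nat (S T : polfun d B) (eta : forall V, 'Hom(pf_ob S V, pf_ob T V)) :
  pol_natural eta -> (forall V, eta V \in hgr (pf_ob S V) (pf_ob T V) false) ->
  @ssch_natural k B (ssch_of S) (ssch_of T) (fun V => eta (rmod_of V)).
Proof.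
move=> nat ev; split=> [V|V W A g]; first exact: ev.
rewrite /sf_mx /= mul_mxA_extm mul_extm_mxA; congr extm.
by apply: functional_extensionality_dep => x; apply: nat.
Qed.

Definition ssch_functor : functor (Pol_even d B) (sschPol B d).
Proof.
refine (@Functor (Pol_even d B) (sschPol B d)
  (fun T => exist _ (ssch_of T) (@ssch_of_homogeneous T))
  (fun S T eta => exist _ (fun V => sval (sval eta) (rmod_of V))
     (ssch_of_nat (svalP (sval eta)) (svalP eta))) _ _).
- by move=> T; apply: sval_eq.
by move=> S T U f g; apply: sval_eq.
Defined.

Lemma zero_evenk (V W : superspace k) : evenk (0 : 'M[k]_(sdim W, sdim V)).
Proof. by move=> i j _; rewrite mxE. Qed.

Lemma zero_bcomm (V W : rsmod B) : bcomm (0 : 'M[k]_(sdim W, sdim V)).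
Proof. by move=> b; rewrite mul0mx mulmx0. Qed.

Lemma ssch_functor_faithful (S T : Pol_even d B) (f g : hom S T) :
  fmor ssch_functor f = fmor ssch_functor g -> f = g.
Proof.
move=> /(congr1 sval) /= E; do 2 apply: sval_eq.
apply: functional_extensionality_dep => V; rewrite -(rmod_ofK V).
exact: (congr1 (fun h => h (lmod_of V)) E).
Qed.

(** [rmod_of] and [lmod_of] are inverse only up to propositional equality, so a family over left
    supermodules is transported; proof irrelevance removes the cast. *)
Lemma rmod_cast (P : rsmod B -> Type) (a : forall V : lsmod B, P (rmod_of V)) :
  exists b : forall V, P V, forall V, b (rmod_of V) = a V.
Proof.
exists (fun V => eq_rect _ P (a (lmod_of V)) _ (rmod_ofK V)) => V.
move: (rmod_ofK (rmod_of V)); rewrite lmod_ofK => e.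
by rewrite (Prop_irrelevance e erefl).
Qed.

Lemma ssch_functor_full (S T : Pol_even d B) (h : hom (ssch_functor S) (ssch_functor T)) :
  exists f : hom S T, fmor ssch_functor f = h.
Proof.
case: h => a [a0 ha].
have [eta Eeta] := @rmod_cast (fun V => 'Hom(pf_ob S V, pf_ob T V)) a.
have nat : pol_natural eta.
  move=> V W; rewrite -(rmod_ofK V) -(rmod_ofK W); move: (lmod_of V) (lmod_of W) => {}V {}W f.
  rewrite !Eeta; move: f.
  (* Points of the whole superspace of maps are allowed here, so the generic point may have constant
     part 0. *)
  apply: (@extm_injective k d B char_neq2 (rmod_of V) (rmod_of W) _ _ 0
    (fun f => a W \o @pf_mor k d B S _ _ f)%VF (fun f => @pf_mor k d B T _ _ f \o a V)%VF).
  - exact: zero_evenk.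
  - exact: zero_bcomm.
  - by move=> c x y; rewrite pf_lin comp_lfunDr comp_lfunZr.
  - by move=> c x y; rewrite pf_lin comp_lfunDl comp_lfunZl.
  move=> I par n g [g0 gB _]; rewrite -mul_mxA_extm -mul_extm_mxA.
  exact: (ha V W _ (exist _ g (conj g0 gB))).
have ev V : eta V \in hgr (pf_ob S V) (pf_ob T V) false.
  by rewrite -(rmod_ofK V) Eeta; apply: a0.
exists (exist _ (exist _ eta nat) ev); apply: sval_eq.
by apply: functional_extensionality_dep => V; apply: Eeta.
Qed.

Lemma csalg_exists : exists A : csalg k, True.
Proof. by exists (grasA k (fun _ : 'I_0 => false) 0). Qed.

Section EssSurj.
Variable S : sschPol B d.
Local Notation S0 := (sval S).

Lemma law_exists (V W : rsmod B) : exists G : ghom d V W -> 'Hom(sf_ob S0 (lmod_of V), sf_ob S0 (lmod_of W)),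
  linear G /\ forall (A : csalg k) (g : point A (lmod_of V) (lmod_of W)),
    sf_mx S0 g = extm G (tpmx (sval g)).
Proof.
have [c hc] := svalP S (lmod_of V) (lmod_of W).
have [G [lG hG]] := @polyeval_extm k d B V W (sf_ob S0 (lmod_of V)) (sf_ob S0 (lmod_of W)) c.
exists G; split=> // A g; rewrite hc; case: g => g [g0 gB]; exact: hG.
Qed.

Definition law V W := sval (cid (law_exists V W)).

Lemma law_lin V W : linear (@law V W).
Proof. by case: (svalP (cid (law_exists V W))). Qed.

Lemma lawE V W A (g : point A (lmod_of V) (lmod_of W)) : sf_mx S0 g = extm (@law V W) (tpmx (sval g)).
Proof. by case: (svalP (cid (law_exists V W))). Qed.

Lemma law_even V W e f : f \in gr (ghom d V W) e ->
  @law V W f \in hgr (sf_ob S0 (lmod_of V)) (sf_ob S0 (lmod_of W)) e.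
Proof.
apply: (extm_even_converse char_neq2 (u := 0)); rewrite ?law_lin //.
- exact: zero_evenk.
- exact: zero_bcomm.
- exact: law_lin.
move=> I par n g [g0 gB _].
rewrite -(lawE (exist _ g (conj g0 gB) : point _ (lmod_of V) (lmod_of W))).
by case: (svalP (sf_mor S0 (lmod_of V) (lmod_of W) _ (exist _ g (conj g0 gB)))).
Qed.

Lemma law_id V : law (gid d V) = \1%VF.
Proof.
have [A _] := csalg_exists; apply: (extm_unital (A := A)); first exact: law_lin.
by rewrite -(lawE (pt1 A (lmod_of V))) /sf_mx sf_id.
Qed.

Lemma law_comp U V W (f : ghom d V W) (g : ghom d U V) :
  law (gcomp f g) = (law f \o law g)%VF.
Proof.
move: f g; apply: (extm_multiplicative char_neq2 (u := 0) (u' := 0)); try exact: law_lin;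
  try exact: zero_evenk; try exact: zero_bcomm.
move=> I par n g g' [g0 gB _] [g0' gB' _].
pose x : point _ (lmod_of V) (lmod_of W) := exist _ g (conj g0 gB).
pose y : point _ (lmod_of U) (lmod_of V) := exist _ g' (conj g0' gB').
by rewrite -(lawE x) -(lawE y) -(lawE (ptM x y)) /sf_mx sf_comp.
Qed.

Definition pol_of : polfun d B :=
  @PolFun k d B (fun V => sf_ob S0 (lmod_of V)) law law_lin law_even law_id law_comp.

End EssSurj.

Section Transport.
Variable S : sschfun B.

(** The identity, seen along an equality of supermodules that is not a conversion; these maps are
    the components of the isomorphism in [ssch_functor_ess]. *)
Definition eqhom V V' (e : V = V') : 'Hom(sf_ob S V, sf_ob S V') :=
  eq_rect _ (fun X => 'Hom(sf_ob S V, sf_ob S X)) \1%VF _ e.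

Lemma eqhom_gr V V' (e : V = V') : eqhom e \in hgr (sf_ob S V) (sf_ob S V') false.
Proof. by case: V' / e; apply: hgr1. Qed.

Lemma eqhomK V V' (e : V = V') : (eqhom (esym e) \o eqhom e = \1)%VF.
Proof. by case: V' / e; apply: comp_lfun1l. Qed.

Lemma eqhomKV V V' (e : V = V') : (eqhom e \o eqhom (esym e) = \1)%VF.
Proof. by case: V' / e; apply: comp_lfun1l. Qed.

(** Entries are compared through numerical indices because the two matrix types are only
    propositionally equal. *)
Lemma eqhom_natural (V V' W W' : lsmod B) (eV : V = V') (eW : W = W') (A : csalg k)
    (g : point A V W) (g' : point A V' W') :
  (forall (i : 'I_(sdim W)) (j : 'I_(sdim V)) (i' : 'I_(sdim W')) (j' : 'I_(sdim V')), i = i' :> nat -> j = j' :> nat -> sval g i j = sval g' i' j') ->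
  mxA A (eqhom eW) *m sf_mx S g = sf_mx S g' *m mxA A (eqhom eV).
Proof.
case: V' / eV g'; case: W' / eW => g' gg'; rewrite !mxA1 mul1mx mulmx1; congr (sf_mx S _).
by apply: sval_eq; apply/matrixP => i j; apply: gg'.
Qed.
End Transport.

Lemma ssch_functor_ess (S : sschPol B d) :
  exists (T : Pol_even d B) (f : hom (ssch_functor T) S), is_iso f.
Proof.
exists (pol_of S); pose S0 := sval S.
have E V W A (g : point A V W) : sf_mx (ssch_of (pol_of S)) g =
    sf_mx S0 (exist _ (sval g) (svalP g) : point A (lmod_of (rmod_of V)) (lmod_of (rmod_of W))).
  by rewrite lawE.
have nat1 : @ssch_natural k B (ssch_of (pol_of S)) S0 (fun V => eqhom S0 (lmod_ofK V)).
  split=> [V|V W A g]; first exact: (eqhom_gr S0).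
  by rewrite E; apply: (@eqhom_natural S0 _ _ _ _ (lmod_ofK V) (lmod_ofK W)) => i j i' j' /val_inj -> /val_inj ->.
have nat2 : @ssch_natural k B S0 (ssch_of (pol_of S)) (fun V => eqhom S0 (esym (lmod_ofK V))).
  split=> [V|V W A g]; first exact: (eqhom_gr S0).
  by rewrite E; apply: (@eqhom_natural S0 _ _ _ _ (esym (lmod_ofK V)) (esym (lmod_ofK W))) => i j i' j' /val_inj -> /val_inj ->.
exists (exist _ _ nat1), (exist _ _ nat2); split; apply: sval_eq;
  apply: functional_extensionality_dep => V; [exact (eqhomK S0 (lmod_ofK V))|exact (eqhomKV S0 (lmod_ofK V))].
Qed.

Lemma sschPol_equivalent : equivalent (sschPol B d) (Pol_even d B).
Proof.
apply: equivalent_sym; apply: (equivalent_of_ff_es (F := ssch_functor)).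
- exact: ssch_functor_full.
- exact: ssch_functor_faithful.
- exact: ssch_functor_ess.
Qed.
End Functor.
End Sides.

(** * Polynomial representations *)

Lemma geometric_sum (R : pzRingType) (x : R) n :
  \sum_(i < n) (x ^+ i - x ^+ i.+1) = 1 - x ^+ n.
Proof.
elim: n => [|n IH]; first by rewrite big_ord0 expr0 subrr.
by rewrite big_ord_recr /= IH addrA subrK.
Qed.

(** * Invertibility of generic points congruent to 1 *)

Section Invertible.
Variables (k : fieldType) (B : superalg k) (V : rsmod B).
Variables (I : finType) (par : I -> bool) (n : nat).
Local Notation A := (grasA k par n).

(** Entries of the m-th power have degree at least m, while no exponent exceeds n, so that #|I| n is
    the top degree. *)
Lemma nilpotent_matrix (x : 'M[A]_(sdim V)) : (forall i j, low 1 (x i j)) ->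
  x ^+ (#|I| * n).+1 = 0.
Proof.
move=> hx.
have lowX m i j : low m ((x ^+ m) i j).
  elim: m i j => [|m IH] i j; first by move=> ?; rewrite ltn0.
  by rewrite exprSr mxE -addn1; apply: low_sum => l; apply: low_mul.
by apply/matrixP => i j; rewrite [RHS]mxE; apply: (low_big (ltnSn _)).
Qed.

(** The inverse is the finite geometric series in the nilpotent matrix 1 - g; even and B-linear
    matrices are stable under powers and sums, so it is again a point. *)
Lemma generic_invertible (g : 'M[A]_(sdim V)) : generic (B := B) (V := V) (W := V) 1%:M g ->
  exists h : 'M[A]_(sdim V), [/\ evenmx h, bcommA (V := V) (W := V) h,
    g *m h = 1%:M & h *m g = 1%:M].
Proof.
move=> [g0 gB gu]; pose x : 'M[A]_(sdim V) := 1%:M - g.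
have one0 : evenmx (1%:M : 'M[A]_(sdim V)).
  by move=> i j; rewrite mxE; case: eqP => [->|_]; rewrite ?addbb; [exact: ca_gr1|exact: ca_gr0].
have oneB : bcommA (V := V) (W := V) (1%:M : 'M[A]_(sdim V)).
  by move=> b; rewrite mul1mx mulmx1.
have x0 : evenmx x.
  by move=> i j; rewrite !mxE -scaleN1r; apply: ca_grD; [have := one0 i j; rewrite mxE|apply: ca_grZ].
have xB : bcommA (V := V) (W := V) x by move=> b; rewrite mulmxBl mulmxBr gB oneB.
have xlow i j : low 1 (x i j).
  have -> : x i j = (-1) *: (g i j - ((1%:M : 'M[k]_(sdim V)) i j)%:A).
    by rewrite !mxE scaleN1r opprB scaler_nat.
  exact: low_scale.
have gx : g = 1 - x by rewrite /x opprB addrCA subrr addr0.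
pose K := (#|I| * n).+1.
have xK : x ^+ K = 0 by apply: nilpotent_matrix.
have pw m : evenmx (x ^+ m) /\ bcommA (V := V) (W := V) (x ^+ m).
  elim: m => [|m [e0 eB]]; first by rewrite expr0.
  rewrite exprS; split=> [i j|b]; last by rewrite -mulmxA eB !mulmxA xB.
  rewrite mxE; apply: ca_sum => l.
  have -> : spar i (+) spar j = (spar i (+) spar l) (+) (spar l (+) spar j).
    by rewrite addbA addbK.
  exact: ca_grM.
exists (\sum_(i < K) x ^+ i); split.
- apply: (big_ind (fun m : 'M[A]_(sdim V) => evenmx m)) => [i j|a b ha hb i j|i _]; last by case: (pw i).
    by rewrite mxE; apply: ca_gr0.
  by rewrite mxE; apply: ca_grD.
- apply: (big_ind (fun m : 'M[A]_(sdim V) => bcommA (V := V) (W := V) m)) => [b|a b ha hb c|i _]; last by case: (pw i).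
    by rewrite mul0mx mulmx0.
  by rewrite mulmxDl mulmxDr ha hb.
- rewrite gx -[LHS]/((1 - x) * _) mulr_sumr.
  under eq_bigr do rewrite mulrBl mul1r -exprS.
  by rewrite geometric_sum xK subr0.
rewrite gx -[LHS]/(_ * (1 - x)) mulr_suml.
under eq_bigr do rewrite mulrBr mulr1 -exprSr.
by rewrite geometric_sum xK subr0.
Qed.
End Invertible.

(** * The parity operator and composition of twisted maps *)

Section Parity.
Variable k : fieldType.
Implicit Types M N : superspace k.

Definition parity M : 'End(M) := proj M false - proj M true.

Lemma parityE M c v : v \in gr M c -> parity M v = (-1) ^+ c *: v.
Proof.
move=> hv; rewrite /parity add_lfunE opp_lfunE; case: c hv => hv.
  by rewrite (@proj_neg _ _ false _ hv) (proj_id hv) sub0r scaleN1r.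
by rewrite (@proj_neg _ _ true _ hv) (proj_id hv) subr0 scale1r.
Qed.

Lemma parity_gr M : parity M \in hgr M M false.
Proof. by apply/hgrP => c v hv; rewrite (parityE hv) addbF rpredZ. Qed.

Lemma parity_comm M N e (f : 'Hom(M, N)) : f \in hgr M N e ->
  (parity N \o f = (-1) ^+ e *: (f \o parity M))%VF.
Proof.
move=> /hgrP hf; apply: eq_on_gr => c v hv; rewrite scale_lfunE !comp_lfunE.
rewrite (parityE (hf _ _ hv)) (parityE hv) linearZ scalerA -signr_addb.
by rewrite addbC.
Qed.

Lemma parity_sq M : (parity M \o parity M = \1)%VF.
Proof.
apply: eq_on_gr => c v hv; rewrite comp_lfunE id_lfunE (parityE hv) linearZ /= (parityE hv) scalerA.
by rewrite -signr_addb addbb scale1r.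
Qed.
End Parity.

(** The left side is the twist of the composite, with even and odd parts already separated: passing
    j through g0 and cancelling it around g1 makes f0 + f1 j multiplicative. *)
Lemma twisted_comp (k : fieldType) (M N P : vectType k) (f0 f1 : 'Hom(N, P))
    (g0 g1 : 'Hom(M, N)) (jM : 'End(M)) (jN : 'End(N)) :
  (jN \o g0 = g0 \o jM)%VF -> (jN \o g1 \o jM = g1)%VF ->
  (((f0 \o g0) + (f1 \o g1)) + (((f1 \o g0) + (f0 \o g1)) \o jM) =
   (f0 + (f1 \o jN)) \o (g0 + (g1 \o jM)))%VF.
Proof.
move=> /lfunP h0 /lfunP h1; apply/lfunP => v.
have {}h0 := h0 v; have {}h1 := h1 v; rewrite !comp_lfunE in h0 h1.
rewrite !(add_lfunE, comp_lfunE) !linearD /= h0 h1.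
by rewrite [X in _ + X = _]addrC addrACA [X in _ + X = _]addrC.
Qed.

Section Representations.
Variables (k : fieldType) (B : superalg k) (d : nat).
Hypothesis sa_mulC : forall a b : B, sa_mul a b = sa_mul b a.
Hypothesis char_neq2 : 2%N \notin [pchar k].
Variable V : rsmod B.
Local Notation L := (lmod_of sa_mulC V).
Local Notation S := (schur d V).

Section Object.
Variable M : lsmod S.
Local Notation G := (@lact k S M : ghom d V V -> 'End(M)).

Lemma sact_is_point (A : csalg k) (g : point A L L) :
  is_point (V := klmod M) (W := klmod M) (extm G (tpmx (sval g))).
Proof.
case: g => g [g0 gB]; split=> [|b] /=; last exact: mxA_kact.
by apply: (extm_even (V := V) (W := V)) => //; [exact (@lact_lin k S M) | exact (@lact_gr k S M)].
Qed.

Definition sact_point (A : csalg k) (g : point A L L) : point A (klmod M) (klmod M) :=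
  exist _ _ (sact_is_point g).

Lemma sact_pointM (A : csalg k) (g h : point A L L) :
  sact_point (ptM g h) = ptM (sact_point g) (sact_point h).
Proof.
case: g h => g [g0 gB] [h [h0 hB]]; apply: sval_eq; rewrite /=.
by apply: (extmM (V := V)) => //; [exact (@lact_lin k S M)..|exact (@lactM k S M)].
Qed.

Lemma sact_point1 (A : csalg k) : sact_point (pt1 A L) = pt1 A (klmod M).
Proof. by apply: sval_eq; apply: (extm1); [exact (@lact_lin k S M)|exact (@lact1 k S M)]. Qed.

Lemma sact_gl_subproof (A : csalg k) (g : gl A L) :
  exists h, ptM (sact_point (sval g)) h = pt1 A (klmod M) /\ ptM h (sact_point (sval g)) = pt1 A (klmod M).
Proof.
have [h [h1 h2]] := svalP g; exists (sact_point h).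
by rewrite -!sact_pointM h1 h2 sact_point1.
Qed.

Definition sact_gl (A : csalg k) (g : gl A L) : gl A (klmod M) :=
  exist _ _ (sact_gl_subproof g).

Lemma sact_gl_nat (A A' : csalg k) (u : @hom (salg k) A A') :
  @cmp typeCat _ _ _ (@sact_gl A') (fmor (GL L) u) =
  @cmp typeCat _ _ _ (fmor (GL (klmod M)) u) (@sact_gl A).
Proof.
apply: functional_extensionality_dep => g; do 2 apply: sval_eq.
by rewrite /= (extm_map u (V := V) (W := V)).
Qed.

Lemma sact_glM (A : csalg k) (g h : gl A L) : sact_gl (glM g h) = glM (sact_gl g) (sact_gl h).
Proof. by apply: sval_eq; apply: sact_pointM. Qed.

Definition rep_of : rep L :=
  @Rep k B L M (@NatTrans _ _ (GL L) (GL (klmod M)) sact_gl sact_gl_nat) sact_glM.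

Lemma rep_of_homogeneous : @homogeneous k d _ _ _ _ (fun A => gl A L)
  (fun A g => sval (sval g)) (fun A g => rp_mx rep_of g).
Proof. by have [c hc] := extm_homogeneous G; exists c => A g; apply: hc. Qed.

Definition polrep_of : polrep L d := exist _ rep_of rep_of_homogeneous.
End Object.

Lemma one_evenk : evenk (1%:M : 'M[k]_(sdim V)).
Proof. by move=> i j; rewrite mxE; have [->|//] := eqVneq i j; rewrite eqxx. Qed.

Lemma one_bcomm : bcomm (B := B) (V := V) (W := V) 1%:M.
Proof. by move=> b; rewrite mul1mx mulmx1. Qed.

Lemma generic_gl (I : finType) (par : I -> bool) n (g : 'M[grasA k par n]_(sdim V)) :
  generic (B := B) (V := V) (W := V) 1%:M g ->
  exists x : gl (grasA k par n) L, sval (sval x) = g.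
Proof.
move=> hg; have [h [h0 hB gh hg1]] := generic_invertible hg.
have [g0 gB _] := hg.
pose x : point _ L L := exist _ g (conj g0 gB); pose y : point _ L L := exist _ h (conj h0 hB).
have xP : exists h', ptM x h' = pt1 _ L /\ ptM h' x = pt1 _ L.
  by exists y; split; apply: sval_eq.
by exists (exist _ x xP).
Qed.

(** Morphisms of representations commute with the action without sign, whatever their parity; this
    is the mismatch with [smod_hom]. Separation uses generic points of constant part 1, which lie in
    GL. *)
Lemma rep_hom_of (M N : lsmod S) (f : 'Hom(M, N)) :
  @rep_hom k B L (rep_of M) (rep_of N) f <-> forall b : S, (f \o lact M b = lact N b \o f)%VF.
Proof.
split=> [h|h A g].
  apply: (@extm_injective k d B char_neq2 V V M N 1%:M (fun b => f \o lact M b)%VF (fun b => lact N b \o f)%VF).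
  - exact: one_evenk.
  - exact: one_bcomm.
  - by move=> c x y; rewrite lact_lin comp_lfunDr comp_lfunZr.
  - by move=> c x y; rewrite lact_lin comp_lfunDl comp_lfunZl.
  move=> I par n g /generic_gl[x <-].
  by rewrite -mul_mxA_extm -mul_extm_mxA; apply: (h _ x).
rewrite /rp_mx /= mul_mxA_extm mul_extm_mxA; congr extm.
by apply: functional_extensionality_dep => x; apply: h.
Qed.

Lemma schur_commP (M N : lsmod S) (f : 'Hom(M, N)) :
  (forall c (b : S), b \in gr S c -> (f \o lact M b = lact N b \o f)%VF) ->
  forall b : S, (f \o lact M b = lact N b \o f)%VF.
Proof.
move=> h b; have eb : 1 *: proj S false b + proj S true b = b.
  by rewrite scale1r; apply: (@proj_add k S false b).
have E (N' : lsmod S) : lact N' b = lact N' (proj S false b) + lact N' (proj S true b).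
  by have := lact_lin N' 1 (proj S false b) (proj S true b); rewrite eb => ->; rewrite scale1r.
rewrite !E comp_lfunDr comp_lfunDl.
congr (_ + _); [exact (h _ _ (@proj_mem k S false b))|exact (h _ _ (@proj_mem k S true b))].
Qed.

Section EssSurj.
Variable X : polrep L d.
Local Notation X0 := (sval X).
Local Notation M := (rp_ss X0).

Lemma rlaw_exists : exists G : ghom d V V -> 'End(M),
  linear G /\ forall (A : csalg k) (g : gl A L), rp_mx X0 g = extm G (tpmx (sval (sval g))).
Proof.
have [c hc] := svalP X; have [G [lG hG]] := @polyeval_extm k d B V V M M c.
exists G; split=> // A g; rewrite hc; case: g => [[g [g0 gB]] ?]; exact: hG.
Qed.

Definition rlaw := sval (cid rlaw_exists).

Lemma rlaw_lin : linear rlaw.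
Proof. by case: (svalP (cid rlaw_exists)). Qed.

Lemma rlawE (A : csalg k) (g : gl A L) : rp_mx X0 g = extm rlaw (tpmx (sval (sval g))).
Proof. by case: (svalP (cid rlaw_exists)). Qed.

Lemma gl1_subproof (A : csalg k) :
  exists h, ptM (pt1 A L) h = pt1 A L /\ ptM h (pt1 A L) = pt1 A L.
Proof. by exists (pt1 A L); rewrite ptM1. Qed.

Definition gl1 (A : csalg k) : gl A L := exist _ (pt1 A L) (gl1_subproof A).

Lemma rlaw1 : rlaw (gid d V) = \1%VF.
Proof.
have [A _] := csalg_exists k; apply: (extm_unital (A := A)); first exact: rlaw_lin.
rewrite -(rlawE (gl1 A)).
(* A [rep] is only asked to be multiplicative: the image of 1 is an invertible idempotent, hence
   1. *)
have E : glM (gl1 A) (gl1 A) = gl1 A by apply: sval_eq; apply: ptM1.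
have := rp_mul X0 (gl1 A) (gl1 A); rewrite E => Ey.
have [h [h1 h2]] := svalP (rp_mor X0 A (gl1 A)).
have : ptM (sval (rp_mor X0 A (gl1 A))) h = ptM (ptM (sval (rp_mor X0 A (gl1 A))) (sval (rp_mor X0 A (gl1 A)))) h.
  by congr (ptM _ h); rewrite {1}Ey.
by rewrite -ptMA h1 ptM1 => /(congr1 sval) E1; apply: esym E1.
Qed.

Lemma rlawM (a b : S) : rlaw (sa_mul a b) = (rlaw a \o rlaw b)%VF.
Proof.
move: a b; apply: (extm_multiplicative char_neq2 (u := 1%:M) (u' := 1%:M)); try exact: rlaw_lin;
  try exact: one_evenk; try exact: one_bcomm.
move=> I par n g g' /generic_gl[x <-] /generic_gl[y <-].
by rewrite -!rlawE -(rlawE (glM x y)) /rp_mx rp_mul.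
Qed.

Lemma rlaw_gr e (b : S) : b \in gr S e -> rlaw b \in hgr M M e.
Proof.
apply: (extm_even_converse char_neq2 (u := 1%:M)); first exact: one_evenk.
- exact: one_bcomm.
- exact: rlaw_lin.
move=> I par n g /generic_gl[x <-]; rewrite -rlawE.
by case: (svalP (sval (rp_mor X0 _ x))).
Qed.

Definition smod_of : lsmod S := @LSMod k S M rlaw rlaw_lin rlaw1 rlawM rlaw_gr.

Lemma smod_of_rep : exists f : @hom (polrep L d) (polrep_of smod_of) X,
  is_iso f /\ sval f = \1%VF :> 'End(M).
Proof.
have h1 : @rep_hom k B L (rep_of smod_of) X0 \1%VF.
  by move=> A g; rewrite !mxA1 mul1mx mulmx1 rlawE.
have h2 : @rep_hom k B L X0 (rep_of smod_of) \1%VF.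
  by move=> A g; rewrite !mxA1 mul1mx mulmx1 rlawE.
exists (exist _ _ h1); split=> //; exists (exist _ _ h2).
by split; apply: sval_eq; apply: comp_lfun1l.
Qed.
End EssSurj.

Section Even.
Lemma even_rep_hom (M N : smod_even S) (f : hom M N) :
  @rep_hom k B L (rep_of M) (rep_of N) (sval (sval f)).
Proof.
case: f => [[f hf] f0]; apply/rep_hom_of/schur_commP => c b hb.
by have := hf false c b hb; rewrite (hpart_id f0) scale1r.
Qed.

(** Even morphisms carry no sign, so the underlying linear map is kept as it is. *)
Definition even_functor : functor (smod_even S) (polrep_even L d).
Proof.
refine (@Functor (smod_even S) (polrep_even L d) (fun M => polrep_of M)
  (fun M N f => exist _ (exist _ (sval (sval f)) (even_rep_hom f)) (svalP f)) _ _).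
- by move=> M; do 2 apply: sval_eq.
by move=> M N P f g; do 2 apply: sval_eq.
Defined.

Lemma polrep_even_equivalent : equivalent (polrep_even L d) (smod_even S).
Proof.
apply: equivalent_sym; apply: (equivalent_of_ff_es (F := even_functor)).
- move=> M N [[f hf] f0].
  have hs : @smod_hom k S M N f.
    move=> e c b hb; case: e; last first.
      by rewrite (hpart_id f0) scale1r; exact (proj1 (@rep_hom_of M N f) hf b).
    by rewrite (@hpart_neg _ _ _ true _ f0) comp_lfun0l comp_lfun0r scaler0.
  by exists (exist _ (exist _ f hs) f0); do 2 apply: sval_eq.
- move=> M N f g E; do 2 apply: sval_eq.
  exact: (congr1 (fun h => sval (sval h)) E).
move=> X; exists (smod_of X); have [f [[g [fg gf]] E]] := smod_of_rep X.
have h1 : sval f \in hgr (rp_ss (sval X)) (rp_ss (sval X)) false by rewrite E hgr1.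
have E' : sval g = \1%VF :> 'End(rp_ss (sval X)).
  have := congr1 sval fg; rewrite /= E => <-; by rewrite comp_lfun1r.
have h2 : sval g \in hgr (rp_ss (sval X)) (rp_ss (sval X)) false by rewrite E' hgr1.
by exists (exist _ f h1), (exist _ g h2); split; apply: sval_eq.
Qed.
End Even.

Section Full.
(** In type I, j is the action of the parity element of the Schur superalgebra and kappa = 1; in
    type II, j is i times the parity of M and kappa = i^2 = -1. *)
Variable j : forall M : lsmod S, 'End(M).
Variable kappa : k.
Hypothesis kappa_sq : kappa * kappa = 1.
Hypothesis j_gr : forall M, j M \in hgr M M false.
Hypothesis j_act : forall M c (b : S), b \in gr S c ->
  (j M \o lact M b = (-1) ^+ c *: (lact M b \o j M))%VF.
Hypothesis j_sq : forall M, (j M \o j M = kappa *: \1)%VF.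
Hypothesis j_even : forall (M N : lsmod S) (f : 'Hom(M, N)), smod_hom f ->
  (j N \o hpart false f = hpart false f \o j M)%VF.
Hypothesis j_odd : forall (M N : lsmod S) (f : 'Hom(M, N)), smod_hom f ->
  (j N \o hpart true f \o j M = hpart true f)%VF.

(* Turns the sign rule for odd morphisms into plain commutation with the action. *)
Definition twist (M N : lsmod S) (f : 'Hom(M, N)) : 'Hom(M, N) :=
  (hpart false f + (hpart true f \o j M))%VF.

Lemma twist_rep_hom (M N : lsmod S) (f : 'Hom(M, N)) : smod_hom f ->
  @rep_hom k B L (rep_of M) (rep_of N) (twist f).
Proof.
move=> hf; apply/rep_hom_of/schur_commP => c b hb.
rewrite /twist comp_lfunDl comp_lfunDr (hf false _ _ hb) scale1r; congr (_ + _).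
rewrite -comp_lfunA (j_act _ hb) -comp_lfunZr (comp_lfunA (hpart true f)) (hf true _ _ hb).
by rewrite -comp_lfunZl scalerA -signr_addb addbb scale1r comp_lfunA.
Qed.

Lemma odd_comp_j (M N : lsmod S) (f : 'Hom(M, N)) : (hpart true f \o j M)%VF \in hgr M N true.
Proof. exact: (hgr_comp (hpart_hgr true f) (j_gr M)). Qed.

Lemma hpart_twist_even (M N : lsmod S) (f : 'Hom(M, N)) : hpart false (twist f) = hpart false f.
Proof.
rewrite /twist linearD /= (hpart_id (hpart_hgr false f)).
by rewrite (@hpart_neg _ _ _ false _ (odd_comp_j f)) addr0.
Qed.

Lemma hpart_twist_odd (M N : lsmod S) (f : 'Hom(M, N)) :
  hpart true (twist f) = (hpart true f \o j M)%VF.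
Proof.
rewrite /twist linearD /= (@hpart_neg _ _ _ true _ (hpart_hgr false f)) add0r.
by rewrite (hpart_id (odd_comp_j f)).
Qed.

Lemma twist1 (M : lsmod S) : twist (\1%VF : 'End(M)) = \1%VF.
Proof.
rewrite /twist (hpart_id (hgr1 M)) (@hpart_neg _ _ _ true _ (hgr1 M)).
by rewrite comp_lfun0l addr0.
Qed.

Lemma twistM (M N P : lsmod S) (f : 'Hom(N, P)) (g : 'Hom(M, N)) : smod_hom g ->
  twist (f \o g)%VF = (twist f \o twist g)%VF.
Proof.
by move=> hg; rewrite /twist !hpart_comp; apply: twisted_comp; [apply: j_even|apply: j_odd].
Qed.

Definition twist_functor : functor (smod S) (polrep L d).
Proof.
refine (@Functor (smod S) (polrep L d) (fun M => polrep_of M)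
  (fun M N f => exist _ (twist (sval f)) (twist_rep_hom (svalP f))) _ _).
- by move=> M; apply: sval_eq; apply: twist1.
by move=> M N P f g; apply: sval_eq; apply: twistM (svalP g).
Defined.

Lemma polrep_equivalent : equivalent (polrep L d) (smod S).
Proof.
apply: equivalent_sym; apply: (equivalent_of_ff_es (F := twist_functor)).
- move=> M N [f hf']; have hf := proj1 (@rep_hom_of M N f) hf'.
  have comm e c b : b \in gr S c -> (hpart e f \o lact M b = lact N b \o hpart e f)%VF.
    by move=> hb; exact (hpart_commute e (lact_gr M hb) (lact_gr N hb) (hf b)).
  (* The preimage of f under [twist]: as j j = kappa and kappa^2 = 1, the factor kappa j undoes
     composition with j. *)
  pose h : 'Hom(M, N) := (hpart false f + kappa *: (hpart true f \o j M))%VF.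
  have h0 : hpart false h = hpart false f.
    rewrite linearD linearZ /= (hpart_id (hpart_hgr false f)).
    by rewrite (@hpart_neg _ _ _ false _ (odd_comp_j f)) scaler0 addr0.
  have h1 : hpart true h = kappa *: (hpart true f \o j M)%VF.
    rewrite linearD linearZ /= (@hpart_neg _ _ _ true _ (hpart_hgr false f)) add0r.
    by rewrite (hpart_id (odd_comp_j f)).
  have hh : smod_hom h.
    move=> [] c b hb; last by rewrite h0 scale1r; apply: comm hb.
    rewrite h1 /= -comp_lfunZl -comp_lfunA (j_act _ hb) -comp_lfunZr comp_lfunA (comm _ _ _ hb).
    by rewrite -comp_lfunZr scalerA mulrC -scalerA comp_lfunA.
  exists (exist _ h hh); apply: sval_eq; rewrite /= /twist h0 h1.
  by rewrite -comp_lfunZl -comp_lfunA j_sq -comp_lfunZr scalerA kappa_sq scale1r comp_lfun1r hpart_add.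
- move=> M N [f hf] [g hg] /(congr1 sval) /= E; apply: sval_eq => /=.
  rewrite -(hpart_add false f) -(hpart_add false g).
  have := congr1 (hpart false) E; rewrite !hpart_twist_even => ->; congr (_ + _).
  have := congr1 (hpart true) E; rewrite !hpart_twist_odd => /(congr1 (fun x => x \o j M)%VF).
  rewrite -!comp_lfunA j_sq -!comp_lfunZr !comp_lfun1r => /(congr1 (fun x => kappa *: x)).
  by rewrite !scalerA kappa_sq !scale1r.
move=> X; exists (smod_of X); have [f [fi _]] := smod_of_rep X; by exists f.
Qed.
End Full.
End Representations.

(** * The two types *)

Section TypeI.
Variables (k : fieldType) (d : nat) (U : superspace k).
Hypothesis char_neq2 : 2%N \notin [pchar k].

Lemma kalg_mulC (a b : kalg k) : sa_mul a b = sa_mul b a.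
Proof. exact: mulrC. Qed.

Lemma klmod_lmod_of : klmod U = lmod_of kalg_mulC (krmod U).
Proof. exact: lsmod_eq. Qed.

Local Notation V := (krmod U).
Local Notation S := (schur d V).

(** Swaps are even, and k has no odd element but 0, so nothing anticommutes with the parity. Over
    C(1) the odd generator does, and type II needs another operator. *)
Lemma parity_GHom : parity (tpow d V) \in GHom d V V.
Proof.
apply/GHomP; split=> [i j _|e i b hb].
  by rewrite (parity_comm (swapT_gr V i j)) scale1r.
case: e hb => hb; last first.
  by rewrite (parity_comm (actT_gr V i hb)) scale1r.
have -> : b = 0 by apply/eqP; move: hb; rewrite kssP.
by rewrite linear0 comp_lfun0l comp_lfun0r.
Qed.

Definition schur_parity : S := Subvs parity_GHom.

Lemma schur_parity_gr : schur_parity \in gr S false.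
Proof. by rewrite (mem_ggr false); apply: parity_gr. Qed.

Lemma schur_parity_comm c (b : S) : b \in gr S c ->
  sa_mul schur_parity b = (-1) ^+ c *: sa_mul b schur_parity.
Proof.
move=> hb; have hb' := etrans (esym (mem_ggr c b)) hb.
by apply: subvs_inj; apply: etrans (parity_comm hb') _; rewrite linearZ.
Qed.

Lemma schur_parity_sq : sa_mul schur_parity schur_parity = sa_one S.
Proof. by apply: subvs_inj; apply: parity_sq. Qed.

Lemma polrep_I : equivalent (polrep (klmod U) d) (smod S).
Proof.
rewrite klmod_lmod_of.
apply: (@polrep_equivalent _ _ d _ char_neq2 V (fun M => lact M schur_parity) 1).
- exact: mulr1.
- by move=> M; apply: lact_gr schur_parity_gr.
- move=> M c b hb; rewrite -!lactM (schur_parity_comm hb).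
  have := lact_lin M ((-1) ^+ c) (sa_mul b schur_parity) 0.
  by rewrite (linear_at0 (lact_lin M)) !addr0.
- by move=> M; rewrite -lactM schur_parity_sq lact1 scale1r.
- by move=> M N f hf; rewrite (hf false _ _ schur_parity_gr) scale1r.
(* The parity element is even, so odd f commutes with it too, and its square 1 is left over. *)
move=> M N f hf; rewrite -comp_lfunA (hf true _ _ schur_parity_gr) scale1r comp_lfunA.
by rewrite -lactM schur_parity_sq lact1 comp_lfun1l.
Qed.
End TypeI.

Section TypeII.
Variables (k : fieldType) (d n : nat).
Hypothesis char_neq2 : 2%N \notin [pchar k].

(** C(1) is commutative as a plain algebra, generated by the single c, although it is not
    supercommutative. *)
Lemma C1_mulC (a b : C1 k) : sa_mul a b = sa_mul b a.
Proof.
rewrite /=; congr pair; first by congr (_ + _); apply: mulrC.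
by rewrite addrC; congr (_ + _); apply: mulrC.
Qed.

Lemma lreg_lmod_of : lreg (C1 k) n = lmod_of C1_mulC (rreg (C1 k) n).
Proof.
apply: lsmod_eq; apply: functional_extensionality_dep => b; apply/lfunP => f.
by rewrite !lfunE; apply/ffunP => i; rewrite !ffunE; apply: C1_mulC.
Qed.

Lemma polrep_even_II :
  equivalent (polrep_even (lreg (C1 k) n) d) (smod_even (schur d (rreg (C1 k) n))).
Proof. by rewrite lreg_lmod_of; apply: polrep_even_equivalent. Qed.

Lemma polrep_II (i : k) : i ^+ 2 = -1 ->
  equivalent (polrep (lreg (C1 k) n) d) (smod (schur d (rreg (C1 k) n))).
Proof.
move=> ii; rewrite lreg_lmod_of.
apply: (@polrep_equivalent _ _ d _ char_neq2 _ (fun M => i *: parity M) (-1)).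
- by rewrite mulrNN mulr1.
- by move=> M; rewrite rpredZ // parity_gr.
- move=> M c b hb; rewrite -comp_lfunZl (parity_comm (lact_gr M hb)) -comp_lfunZr.
  by rewrite !scalerA mulrC.
- by move=> M; rewrite -comp_lfunZl -comp_lfunZr parity_sq scalerA -expr2 ii.
- move=> M N f _; rewrite -comp_lfunZl -comp_lfunZr (parity_comm (hpart_hgr false f)).
  by rewrite scale1r.
(* The parity anticommutes with odd f, so j f j = -i^2 f, and i^2 = -1 restores f. *)
move=> M N f _; rewrite -!comp_lfunZl -comp_lfunZr scalerA -expr2 ii.
rewrite (parity_comm (hpart_hgr true f)) -comp_lfunZl -comp_lfunA parity_sq comp_lfun1r.
by rewrite scalerA mulrNN mulr1 scale1r.
Qed.
End TypeII.

Unset Implicit Arguments.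
Theorem theorem5p4 (k : fieldType) (d m n : nat)
    (char_neq2 : 2%N \notin [pchar k]) (le_dm : (d <= m)%N) (le_dn : (d <= n)%N) :
  (* (i), I *)
  equivalent (polrep (klmod (kmn k m n)) d) (smod (schur d (krmod (kmn k m n)))) /\
  (* (i), II *)
  (equivalent (polrep_even (lreg (C1 k) n) d) (smod_even (schur d (rreg (C1 k) n))) /\
   ((exists i : k, i ^+ 2 = -1) ->
    equivalent (polrep (lreg (C1 k) n) d) (smod (schur d (rreg (C1 k) n))))) /\
  (* (ii), I *)
  equivalent (sschPol (kalg k) d) (Pol_even d (kalg k)) /\
  (* (ii), II *)
  equivalent (sschPol (C1 k) d) (Pol_even d (C1 k)).
Proof.
split; first exact: polrep_I.
split; first by split=> [|[i ii]]; [exact: polrep_even_II|exact: polrep_II ii].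
by split; apply: sschPol_equivalent => //; [exact: kalg_mulC|exact: C1_mulC].
Qed.
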